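(* Let $0<\alpha<2$ and let $(\mathbb{R}^{\mathbb{Z}},\mathcal{B}^{\otimes\mathbb{Z}},\mathbb{P},S)$ be a stationary $\alpha$-stable process with associated system $(\Omega,\mathcal{F},\mu,T)$. Then the process is mixing if and only if for all $f\in L^{2}(\mu)$, $\langle U_{T}^{n}f,f\rangle_{L^{2}(\mu)}\to0$ as $n\to\infty$.
   Context: Measure spaces are $\sigma$-finite Lebesgue (standard) spaces and statements are modulo null sets. A nonsingular automorphism $T$ of $(\Omega,\mathcal{F},\mu)$ is a bijective bi-measurable map such that the image of $\mu$ under $T$ is equivalent to $\mu$; $T_*^{-1}\mu$ is the image of $\mu$ under $T^{-1}$, i.e. $B\mapsto\mu(TB)$. $U_T$ is the unitary operator on $L^2(\mu)$ given by $U_Tf(\omega)=\sqrt{\frac{\mathrm{d}T_{*}^{-1}\mu}{\mathrm{d}\mu}(\omega)}\;f(T\omega)$. A process is identified with its distribution $\mathbb{P}$ on $\mathbb{R}^{\mathbb{Z}}$, and $S$ is the shift on $\mathbb{R}^{\mathbb{Z}}$. An IDp process is an infinitely divisible process $X=\{X_n\}_{n\in\mathbb{Z}}$ without Gaussian part. The Lévy measure of a stationary IDp process $X$ is the shift-invariant $\sigma$-finite measure $Q$ on $\mathbb{R}^{\mathbb{Z}}$ with $Q(\{0_{\mathbb{R}^{\mathbb{Z}}}\})=0$, $\int(x_0^2\wedge 1)\,Q(\mathrm{d}\{x_n\}_{n\in\mathbb{Z}})<\infty$ and $$\mathbb{E}\Big[\exp\Big(i\sum_{k=n_1}^{n_2}a_kX_k\Big)\Big]=\exp\Big[\int_{\mathbb{R}^{\mathbb{Z}}}\Big(\exp\Big(i\sum_{k=n_1}^{n_2}a_kx_k\Big)-1-i\sum_{k=n_1}^{n_2}a_kc(x_k)\Big)Q(\mathrm{d}\{x_n\}_{n\in\mathbb{Z}})\Big]$$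 for all $n_1\le n_2$ in $\mathbb{Z}$ and real $a_k$, where $c(x)=-1$ if $x<-1$, $c(x)=x$ if $-1\le x\le 1$, $c(x)=1$ if $x>1$. The Lévy measure system is $(\mathbb{R}^{\mathbb{Z}},\mathcal{B}^{\otimes\mathbb{Z}},Q,S)$. The $\alpha$-stable stationary processes are the stationary IDp processes whose Lévy measure $Q$ is nonzero and satisfies $(R_t)_*Q=t^{\alpha}Q$ for all $t>0$, where $R_t:\{x_n\}_{n\in\mathbb{Z}}\mapsto\{tx_n\}_{n\in\mathbb{Z}}$ and $(R_t)_*Q$ is the image measure $B\mapsto Q(R_t^{-1}B)$. A nonsingular system $(\Omega,\mathcal{F},\mu,T)$ is associated with the $\alpha$-stable process if there is $f\in L^\alpha(\mu)$ such that, with $M(\omega,t)=tf(\omega)$ and $\widetilde{T}_{\alpha}(\omega,s)=\big(T\omega,s(\frac{\mathrm{d}T_{*}^{-1}\mu}{\mathrm{d}\mu}(\omega))^{1/\alpha}\big)$ on $\Omega\times\mathbb{R}_+^*$, the map $(\omega,t)\mapsto\{M\circ\widetilde{T}_{\alpha}^{n}(\omega,t)\}_{n\in\mathbb{Z}}$ is an isomorphism of the measure-preserving system $(\Omega\times\mathbb{R}_{+}^{*},\mathcal{F}\otimes\mathcal{B}_{+},\mu\otimes\frac{1}{s^{1+\alpha}}\,\mathrm{d}s,\widetilde{T}_{\alpha})$ (the Maharam extension) with the Lévy measure system. Such a system always exists, and $\mu$ may be taken to be a probability measure. *)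

(* Defs.v *)
From HB Require Import structures.
From mathcomp Require Import all_boot all_order all_algebra.
From mathcomp Require Import all_classical all_reals all_analysis.
From mathcomp Require Import measurable_realfun complex.

Set Implicit Arguments.
Unset Strict Implicit.
Unset Printing Implicit Defensive.

Import Order.TTheory GRing.Theory Num.Theory.
Import numFieldNormedType.Exports.

Local Open Scope classical_set_scope.
Local Open Scope ring_scope.
Local Open Scope complex_scope.

Section complex_integration.
Context {R : realType}.

Definition cexp (z : R[i]) : R[i] :=
  (expR (complex.Re z) * cos (complex.Im z)) +i*
  (expR (complex.Re z) * sin (complex.Im z)).

Definition cintegral {d} {X : measurableType d} (m : {measure set X -> \bar R})
    (f : X -> R[i]) : R[i] :=
  Rintegral m setT (fun x => complex.Re (f x)) +i*
  Rintegral m setT (fun x => complex.Im (f x)).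

(* Functions are representatives: L^2 classes are not quotiented out. *)
Definition complex_L2 {d} {X : measurableType d} (m : {measure set X -> \bar R})
    (f : X -> R[i]) : Prop :=
  [/\ measurable_fun setT (fun x => complex.Re (f x)),
      measurable_fun setT (fun x => complex.Im (f x)) &
      (\int[m]_x (Normc.normc (f x) ^+ 2)%:E < +oo)%E].

Definition L2_inner {d} {X : measurableType d} (m : {measure set X -> \bar R})
    (f g : X -> R[i]) : R[i] :=
  cintegral m (fun x => f x * ((g x)^*)%C).

End complex_integration.

Section measurable_systems.
Context {R : realType}.

(* Isomorphism modulo null sets.  Images are only required to be measurable for
   the completion of [q], so that the notion is insensitive to whether the
   sigma-algebras are Borel or completed. *)
Definition isomorphism_mod0 {d1 d2} {X : measurableType d1}
    {Y : measurableType d2} (m : set X -> \bar R) (q : set Y -> \bar R)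
    (phi : X -> Y) : Prop :=
  [/\ measurable_fun setT phi,
      forall B, measurable B -> m (phi @^-1` B) = q B &
      exists (X0 : set X) (Y0 : set Y),
        [/\ measurable X0, measurable Y0, m (~` X0) = 0%E, q (~` Y0) = 0%E &
            set_bij X0 Y0 phi /\
            forall A, measurable A -> A `<=` X0 ->
              completed_algebra_gen q (phi @` A)]].

Definition system_isomorphism {d1 d2} {X : measurableType d1}
    {Y : measurableType d2} (m : set X -> \bar R) (T : X -> X)
    (q : set Y -> \bar R) (S : Y -> Y) (phi : X -> Y) : Prop :=
  isomorphism_mod0 m q phi /\ {ae m, forall x, phi (T x) = S (phi x)}.

(* Atoms are allowed: the measure [nu] on the line is arbitrary. *)
Definition lebesgue_space {d} {X : measurableType d}
    (m : set X -> \bar R) : Prop :=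
  exists (nu : {measure set (measurableTypeR R) -> \bar R})
         (phi : X -> measurableTypeR R), isomorphism_mod0 m nu phi.

Definition nonsingular_automorphism {d} {X : measurableType d}
    (m : set X -> \bar R) (T : X -> X) : Prop :=
  [/\ bijective T,
      measurable_fun setT T,
      forall A, measurable A -> measurable (T @` A),
      pushforward m T `<< m &
      m `<< pushforward m T].

(* [D] is a version of the Radon-Nikodym derivative of B |-> m (T B) with
   respect to [m].  As T is nonsingular this derivative is positive and finite
   almost everywhere; versions with values in ]0, +oo[ everywhere are used. *)
Definition rn_derivative {d} {X : measurableType d}
    (m : set X -> \bar R) (T : X -> X) (D : X -> R) : Prop :=
  [/\ measurable_fun setT D,
      forall x, 0 < D x &
      forall B, measurable B -> m (T @` B) = (\int[m]_(x in B) (D x)%:E)%E].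

Definition koopman {X : Type} (T : X -> X) (D : X -> R) (f : X -> R[i]) :
    X -> R[i] :=
  fun x => (Num.sqrt (D x))%:C * f (T x).

(* T^n for n in Z; meaningful when T is a bijection. *)
Definition ziter {X : pointedType} (T : X -> X) (n : int) : X -> X :=
  match n with
  | Posz k => iter k T
  | Negz k => iter k.+1 (pinv setT T)
  end.

End measurable_systems.

Section processes.
Context {R : realType}.

Definition cylinders : set (set (int -> R)) :=
  [set C | exists (n : int) (B : set R),
     measurable B /\ C = [set x | B (x n)]].

(* R^Z with the product of the Borel sigma-algebras. *)
Definition RZ := g_sigma_algebraType cylinders.

Definition shift (x : RZ) : RZ := fun n : int => x (n + 1).

Definition dilation (t : R) (x : RZ) : RZ := fun n : int => t * x n.

Definition zeroRZ : RZ := fun=> 0.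

Definition shift_invariant (m : set RZ -> \bar R) : Prop :=
  forall B : set RZ, measurable B -> m (shift @^-1` B) = m B.

Definition mixing (P : set RZ -> \bar R) : Prop :=
  forall A B : set RZ, measurable A -> measurable B ->
    (fun n : nat => P (A `&` iter n shift @^-1` B)) @ \oo --> (P A * P B)%E.

(* For every k >= 1, P is the law of a sum of k i.i.d. processes. *)
Definition infinitely_divisible (P : set RZ -> \bar R) : Prop :=
  forall k : nat, (0 < k)%N ->
  exists (d : measure_display) (W : measurableType d) (PW : probability W R)
         (Y : 'I_k -> W -> RZ),
    [/\ forall i, measurable_fun setT (Y i),
        forall i j (B : set RZ), measurable B ->
          PW (Y i @^-1` B) = PW (Y j @^-1` B),
        forall B : 'I_k -> set RZ, (forall i, measurable (B i)) ->
          PW (\bigcap_i (Y i @^-1` B i)) =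
            (\prod_(i < k) PW (Y i @^-1` B i))%E &
        forall B : set RZ, measurable B ->
          PW ((fun w => (fun n : int => \sum_(i < k) Y i w n) : RZ) @^-1` B)
          = P B].

Definition truncation (x : R) : R :=
  if x < -1 then -1 else if x <= 1 then x else 1.

(* \sum_{k = n1}^{n2} F k, for n1 <= n2. *)
Definition zsum (n1 n2 : int) (F : int -> R) : R :=
  \sum_(j < `|n2 - n1|%N.+1) F (n1 + (j : nat)%:Z).

(* The exponent below has neither a Gaussian nor a drift term. *)
Definition levy_measure (P : probability RZ R)
    (Q : {measure set RZ -> \bar R}) : Prop :=
  [/\ shift_invariant Q,
      sigma_finite setT Q,
      Q [set zeroRZ] = 0%E,
      (\int[Q]_x (Num.min ((x : int -> R) 0 ^+ 2) 1)%:E < +oo)%E &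
      forall (n1 n2 : int) (a : int -> R), n1 <= n2 ->
        let lin (x : RZ) := zsum n1 n2 (fun k => a k * x k) in
        let comp (x : RZ) := zsum n1 n2 (fun k => a k * truncation (x k)) in
        cintegral P (fun x => cexp ('i%C * (lin x)%:C)) =
        cexp (cintegral Q
          (fun x => cexp ('i%C * (lin x)%:C) - 1 - 'i%C * (comp x)%:C))].

(* A stationary infinitely divisible process without Gaussian part. *)
Definition stationary_IDp (P : probability RZ R)
    (Q : {measure set RZ -> \bar R}) : Prop :=
  [/\ shift_invariant P, infinitely_divisible P & levy_measure P Q].

Definition stable_stationary (alpha : R) (P : probability RZ R)
    (Q : {measure set RZ -> \bar R}) : Prop :=
  [/\ stationary_IDp P Q,
      Q setT != 0%E &
      forall t : R, 0 < t -> forall B : set RZ, measurable B ->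
        Q (dilation t @^-1` B) = ((t `^ alpha)%:E * Q B)%E].

End processes.
Arguments RZ : clear implicits.

Section maharam.
Context {R : realType}.

(* The measure s^{-1-alpha} ds of ]0, +oo[, viewed as a measure on the line that
   is carried by ]0, +oo[. *)
Definition stable_radial (alpha : R) (A : set (measurableTypeR R)) : \bar R :=
  (\int[lebesgue_measure]_(s in A `&` `]0%R, +oo[%classic)
     ((s `^ (1 + alpha))^-1)%:E)%E.

Section measure.
Variable alpha : R.
Local Notation nu := (stable_radial alpha).

Let dens (s : measurableTypeR R) : \bar R := ((s `^ (1 + alpha))^-1)%:E.

Let dens_ge0 s : (0 <= dens s)%E.
Proof. by rewrite lee_fin invr_ge0 powR_ge0. Qed.

Let mpos : measurable (`]0%R, +oo[%classic : set (measurableTypeR R)).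
Proof. exact: measurable_itv. Qed.

Let mdens (A : set (measurableTypeR R)) : measurable_fun A dens.
Proof.
apply: measurable_funTS; apply/measurable_EFinP.
have -> : (fun s : R => (s `^ (1 + alpha))^-1) =
          (fun s => s `^ (- (1 + alpha))).
  by apply/funext => s; rewrite powRN.
exact: measurable_powR.
Qed.

Let nu0 : nu set0 = 0%E.
Proof. by rewrite /stable_radial set0I integral_set0. Qed.

Let nu_ge0 A : (0 <= nu A)%E.
Proof. by apply: integral_ge0 => s _; exact: dens_ge0. Qed.

Let nu_sigma_additive : semi_sigma_additive nu.
Proof.
move=> F mF tF mUF.
have -> : nu (\bigcup_n F n) = (\sum_(n <oo) nu (F n))%E.
  rewrite /stable_radial setI_bigcupl.
  apply: (@ge0_integral_bigcup _ _ _ _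
    (fun k => F k `&` `]0%R, +oo[%classic) dens).
  - by move=> k; exact: measurableI.
  - exact: mdens.
  - by move=> s _; exact: dens_ge0.
  - by apply: trivIset_setIr.
by apply: (@is_cvg_ereal_nneg_natsum _ (fun n => nu (F n))) => n _;
  exact: nu_ge0.
Qed.

HB.instance Definition _ := isMeasure.Build _ _ _ nu
  nu0 nu_ge0 nu_sigma_additive.

Let nu_sigma_finite : sigma_finite setT nu.
Proof.
pose E (n : nat) : set (measurableTypeR R) :=
  `[(- n%:R)%R, n%:R]%classic `&` [set s | (dens s <= n%:R%:E)%E].
have mE n : measurable (E n).
  apply: measurableI; first exact: measurable_itv.
  rewrite -[X in measurable X]setTI.
  by apply: (@emeasurable_fun_infty_c _ _ _ setT dens) => //; exact: mdens.
exists E.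
  apply/esym; rewrite -subTset => s _.
  pose r := Num.max `|s| (s `^ (1 + alpha))^-1.
  have rn : r <= (Num.truncn r).+1%:R by exact/ltW/truncnS_gt.
  exists (Num.truncn r).+1 => //; split => /=.
    by rewrite in_itv/= -ler_norml (le_trans _ rn)// le_max lexx.
  by rewrite lee_fin (le_trans _ rn)// le_max lexx orbT.
move=> n; split=> //.
have mEI : measurable (E n `&` `]0%R, +oo[%classic) by exact: measurableI.
apply: (@le_lt_trans _ _
  (\int[lebesgue_measure]_(s in E n `&` `]0%R, +oo[%classic) n%:R%:E)%E).
  apply: ge0_le_integral => //.
  - by move=> s _; exact: dens_ge0.
  - by move=> s [[]].
rewrite integral_cst//; apply: lte_mul_pinfty => //.
apply: (@le_lt_trans _ _ (lebesgue_measure `[(- n%:R : R)%R, n%:R]%classic)).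
  by apply: le_measure; rewrite ?inE// => s [[]].
by rewrite lebesgue_measure_itv/=; case: ifP => // _; rewrite -EFinD ltry.
Qed.

HB.instance Definition _ := Measure_isSigmaFinite.Build _ _ _ nu
  nu_sigma_finite.

End measure.

Context {d} {X : measurableType d}.

(* The Maharam extension.  The fibre ]0, +oo[ is encoded as the real line with
   [stable_radial], for which ]-oo, 0] is negligible. *)
Definition maharam_measure (alpha : R) (m : {measure set X -> \bar R}) :
    set (X * measurableTypeR R) -> \bar R :=
  (m \x stable_radial alpha)%E.

HB.instance Definition _ (alpha : R) (m : {measure set X -> \bar R}) :=
  Measure.on (maharam_measure alpha m).

Definition maharam_map (alpha : R) (T : X -> X) (D : X -> R)
    (p : X * measurableTypeR R) : X * measurableTypeR R :=
  (T p.1, p.2 * D p.1 `^ alpha^-1).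

Definition maharam_orbit (alpha : R) (T : X -> X) (D : X -> R) (f : X -> R)
    (p : X * measurableTypeR R) : RZ R :=
  fun n : int => let q := ziter (maharam_map alpha T D) n p in q.2 * f q.1.

Definition associated_system (alpha : R) (m : {measure set X -> \bar R})
    (T : X -> X) (D : X -> R) (Q : {measure set RZ R -> \bar R}) : Prop :=
  exists f : X -> R, f \in Lfun m alpha%:E /\
    system_isomorphism (maharam_measure alpha m) (maharam_map alpha T D)
      Q shift (maharam_orbit alpha T D f).

End maharam.

(* Main.v *)
Require Import Defs.
From HB Require Import structures.
From mathcomp Require Import all_boot all_order all_algebra.
From mathcomp Require Import all_classical all_reals all_analysis.
From mathcomp Require Import complex.
From mathcomp Require Import measurable_realfun ring lra zify.

(** The Maharam extension preserves [m = mu \x s^(-1-alpha) ds], and for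
    [E = A `*` [a, +oo[] the measure of [E /\ T~^(-n) E] is, up to a constant,
    the integral over [A] of [1_A(T^n) min(1, D_n)], where [D_n] is the
    Radon-Nikodym cocycle, whereas [<U_T^n 1_A, 1_A>] is the same integral with
    [sqrt D_n] in place of [min(1, D_n)].  Since
    [min(1, c) <= sqrt c <= e (1 + c) + min(1, c) / e] and [D_n] transports
    [mu], both tend to 0 simultaneously, so [U_T^n -> 0] weakly if and only if
    the Maharam extension is of zero type.

    The Lévy measure system is a measure-preserving factor of the Maharam
    extension, and [{0}] is null for it.  If the extension is of zero type, the
    Lévy exponent of [sum a_k x_k + sum b_k x_(k+n)] tends to the sum of the two
    exponents, because the difference is an integral of
    [(exp(iu) - 1) (exp(iv_n) - 1)]; thus trigonometric polynomials decorrelate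
    under [P], and they are dense in [L1(P)].  Conversely, mixing of [P] gives
    [\int (1 - cos u) (1 - cos v_n) dQ -> 0]; finite sums of the functions
    [1 - cos(t x_k)], pulled back to the Maharam extension, exceed any square
    integrable function outside small sets, which forces zero type there. *)

Import Order.TTheory GRing.Theory Num.Theory.
Import numFieldNormedType.Exports.

Local Open Scope classical_set_scope.
Local Open Scope ring_scope.

Set Implicit Arguments.
Unset Strict Implicit.
Unset Printing Implicit Defensive.

(** * Correlations along a sequence of L2-contractions *)

(** All limits are first taken on nonnegative functions, with integrals in the extended reals. This
    suffices because [U_T] preserves positivity: the complex inner product of [U_T^n f] and [f] is
    bounded by the correlation of [|f|] with itself. Positivity also replaces density arguments in
    L2: if functions [g N] with vanishing self-correlations eventually exceed [h] almost everywhere,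
    then the self-correlation of [h] vanishes as well. This principle ([correlation_cvg0]) is
    applied to multiples of indicators of sets of finite measure on the base, to multiples of
    indicators of rectangles on the extension, and to sums of [1 - cos] on the Lévy side. The last
    family vanishes at the zero path, and this is where [Q {0} = 0] enters. The radial measure is
    infinite near 0, hence the positive lower edge of the rectangles. For the density of
    trigonometric polynomials, a cubic iteration turns sines into signs, so that indicators of rays,
    and from them all measurable sets, are reached by sums, products and bounded limits. *)

Section ereal_limits.
Context {R : realType}.
Implicit Types u v : (\bar R)^nat.

Lemma ge0_cvge0P u : (forall n, 0 <= u n)%E ->
  u @ \oo --> 0%E <->
  forall e : R, 0 < e -> \forall n \near \oo, (u n <= e%:E)%E.
Proof.
move=> u0; split=> [/fine_cvgP[ufin /cvgrPdist_le uc] e e0|h].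
  near=> n; have un : u n \is a fin_num by near: n.
  rewrite -(fineK un) lee_fin -[leLHS]ger0_norm ?fine_ge0// -normrN -[X in `|X|]sub0r.
  by near: n; exact: uc.
apply/fine_cvgP; split.
  have := h 1 ltr01; apply: filterS => n un1.
  by rewrite ge0_fin_numE// (le_lt_trans un1)// ltry.
apply/cvgrPdist_le => e e0; have := h e e0; apply: filterS => n une.
rewrite sub0r normrN ger0_norm ?fine_ge0//.
have un : u n \is a fin_num by rewrite ge0_fin_numE// (le_lt_trans une)// ltry.
by rewrite -lee_fin fineK.
Unshelve. all: by end_near. Qed.

Lemma ge0_le_cvge0 u v : (forall n, 0 <= u n)%E -> (forall n, u n <= v n)%E ->
  v @ \oo --> 0%E -> u @ \oo --> 0%E.
Proof.
move=> u0 uv v0; apply: (@squeeze_cvge _ _ _ _ (cst 0%E) u v) => //.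
- by apply: nearW => n; rewrite u0 uv.
- exact: cvg_cst.
Qed.

Lemma cvgeM0 u (k : R) : u @ \oo --> 0%E -> (fun n => k%:E * u n)%E @ \oo --> 0%E.
Proof. by move=> u0; rewrite -[X in _ --> X](mule0 k%:E); exact: cvgeZl. Qed.

Lemma muleI_gt0 (k : R) (x y : \bar R) : 0 < k ->
  (k%:E * x = k%:E * y)%E -> x = y.
Proof.
move=> k0 /(congr1 (fun z => (k^-1)%:E * z)%E).
by rewrite !muleA -EFinM mulVf ?gt_eqF// !mul1e.
Qed.

End ereal_limits.

Definition image_measure {d d'} {X : measurableType d} {Y : measurableType d'}
    {R : realType} (m : {measure set X -> \bar R}) (f : X -> Y)
    (mf : measurable_fun setT f) : {measure set Y -> \bar R} :=
  measure_function_pushforward__canonical__measure_function_Measure m mf.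

Section correlations.
Context d (X : measurableType d) (R : realType) (m : {measure set X -> \bar R}).
Variables (w : nat -> X -> R) (tau : nat -> X -> X).
Hypothesis mw : forall n, measurable_fun setT (w n).
Hypothesis w0 : forall n x, 0 <= w n x.
Hypothesis mtau : forall n, measurable_fun setT (tau n).
Hypothesis contr : forall n (v : X -> R), measurable_fun setT v ->
  (forall x, 0 <= v x) ->
  (\int[m]_x ((w n x * v (tau n x)) ^+ 2)%:E <= \int[m]_x ((v x) ^+ 2)%:E)%E.

(** The pairing of [u] with a weighted composition operator applied to [v]. Three instances occur:
    [U_T^n] with weight [sqrt D_n], the Maharam map with weight 1, and the shift under [Q] with
    weight 1. *)
Definition correlation (n : nat) (u v : X -> R) : \bar R :=
  (\int[m]_x (u x * (w n x * v (tau n x)))%:E)%E.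

Let mW n (v : X -> R) : measurable_fun setT v ->
  measurable_fun setT (fun x => w n x * v (tau n x)).
Proof. by move=> mv; apply: measurable_funM => //; exact: measurableT_comp. Qed.

Lemma correlation_ge0 n (u v : X -> R) : (forall x, 0 <= u x) ->
  (forall x, 0 <= v x) -> (0 <= correlation n u v)%E.
Proof.
move=> u0 v0; apply: integral_ge0 => x _.
by rewrite lee_fin mulr_ge0// mulr_ge0.
Qed.

(** A weighted arithmetic-geometric inequality in place of Cauchy-Schwarz: it avoids square roots of
    possibly infinite integrals, and [e] can be tuned when one of the two norms is small. *)
Lemma correlation_AMGM n (u v : X -> R) (e : R) : 0 < e ->
  measurable_fun setT u -> measurable_fun setT v ->
  (forall x, 0 <= u x) -> (forall x, 0 <= v x) ->
  (correlation n u v <= e%:E * \int[m]_x ((u x) ^+ 2)%:E +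
                        (e^-1)%:E * \int[m]_x ((v x) ^+ 2)%:E)%E.
Proof.
move=> e0 mu mv u0 v0.
apply: (@le_trans _ _ (e%:E * \int[m]_x ((u x) ^+ 2)%:E +
  (e^-1)%:E * \int[m]_x ((w n x * v (tau n x)) ^+ 2)%:E)%E); last first.
  by apply: leeD2l; apply: lee_wpmul2l; [rewrite lee_fin invr_ge0 ltW|exact: contr].
have e1 : 0 <= e^-1 by rewrite invr_ge0 ltW.
have mu2 : measurable_fun setT (fun x => ((u x) ^+ 2)%:E).
  by apply/measurable_EFinP; exact: measurable_funX.
have mv2 : measurable_fun setT (fun x => ((w n x * v (tau n x)) ^+ 2)%:E).
  by apply/measurable_EFinP; apply: measurable_funX; exact: mW.
rewrite -!ge0_integralZl//; try by [move=> x _; rewrite lee_fin sqr_ge0|rewrite lee_fin ?ltW//].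
rewrite -ge0_integralD//; first last.
- exact: measurable_funeM.
- by move=> x _; rewrite -EFinM lee_fin mulr_ge0// sqr_ge0.
- exact: measurable_funeM.
- by move=> x _; rewrite -EFinM lee_fin mulr_ge0 ?sqr_ge0// ltW.
apply: ge0_le_integral => //.
- by move=> x _; rewrite lee_fin mulr_ge0// mulr_ge0.
- by apply/measurable_EFinP; apply: measurable_funM => //; exact: mW.
- by apply: emeasurable_funD; exact: measurable_funeM.
- move=> x _; rewrite -!EFinM -EFinD lee_fin.
  set a := u x; set b := w n x * _.
  have a0 : 0 <= a by exact: u0.
  have b0 : 0 <= b by rewrite mulr_ge0.
  have : 0 <= e * (a - e^-1 * b) ^+ 2 by rewrite mulr_ge0 ?sqr_ge0// ltW.
  have -> : e * (a - e^-1 * b) ^+ 2 = e * a ^+ 2 + e^-1 * b ^+ 2 - 2 * (a * b).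
    by field; rewrite gt_eqF.
  rewrite subr_ge0; apply: le_trans.
  by rewrite ler_peMl ?mulr_ge0// ler1n.
Qed.

(* [h] is split into its part below [g N], whose correlations are controlled by
   those of [g N], and a remainder that is small in L2. *)
Lemma correlation_cvg0 (g : nat -> X -> R) (h : X -> R) :
  (forall N, measurable_fun setT (g N)) -> (forall N x, 0 <= g N x) ->
  (forall N, correlation n (g N) (g N) @[n --> \oo] --> 0%E) ->
  measurable_fun setT h -> (forall x, 0 <= h x) ->
  (\int[m]_x ((h x) ^+ 2)%:E < +oo)%E ->
  {ae m, forall x, \forall N \near \oo, h x <= g N x} ->
  correlation n h h @[n --> \oo] --> 0%E.
Proof.
move=> mg g0 gc mh h0 h2 hg.
pose E N := [set x | h x <= g N x].
have mE N : measurable (E N).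
  rewrite /E -[X in measurable X]setTI.
  exact: measurable_fun_le.
pose h1 N x := h x * \1_(E N) x.
pose k N x := h x * \1_(~` E N) x.
have mh1 N : measurable_fun setT (h1 N) by apply: measurable_funM.
have mk N : measurable_fun setT (k N).
  by apply: measurable_funM => //; apply: measurable_indic; exact: measurableC.
have h10 N x : 0 <= h1 N x by rewrite mulr_ge0// indicE.
have k0 N x : 0 <= k N x by rewrite mulr_ge0// indicE.
have hE N x : h x = h1 N x + k N x.
  rewrite /h1 /k -mulrDr !indicE in_setC; case: (x \in _) => /=; lra.
have h1g N x : h1 N x <= g N x.
  rewrite /h1 indicE; case: (boolP (x \in E N)); rewrite ?mulr0// mulr1.
  by rewrite inE.
have h1h N x : h1 N x <= h x by rewrite (hE N x) lerDl.
(* Almost everywhere [k N x] vanishes for large [N], and [h ^+ 2] dominates. *)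
have kc : (\int[m]_x (k N x ^+ 2)%:E)%E @[N --> \oo] --> 0%E.
  have := @dominated_convergence _ X R m setT measurableT
    (fun N x => (k N x ^+ 2)%:E) (cst 0%E) (fun x => (h x ^+ 2)%:E).
  case.
  - by move=> N; apply/measurable_EFinP; exact: measurable_funX.
  - exact: measurable_cst.
  - case: hg => N0 [mN0 N00 sub]; exists N0; split => // x /= nx.
    apply: sub => /= hx; apply: nx => _.
    apply: cvg_near_cst.
    apply: filterS hx => N hgx; rewrite /k indicE in_setC mem_set//=.
    by rewrite mulr0 expr0n.
  - apply/integrableP; split; first by apply/measurable_EFinP; exact: measurable_funX.
    by under eq_integral do rewrite gee0_abs ?lee_fin ?sqr_ge0//.
  - apply: aeW => x N _; rewrite gee0_abs ?lee_fin ?sqr_ge0// ler_pXn2r ?nnegrE//.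
    by rewrite (hE N x) lerDr.
  - by move=> _ _; rewrite integral0.
(* Besides the part of [h1 N] with itself, which lies below that of [g N], there remain the pairs
   [(k N, h)] and [(h1 N, k N)]. Each contains the small factor [k N], and [h1 N <= h] in the
   second. *)
have split3 N n : (correlation n h h <= correlation n (g N) (g N) +
    (correlation n (k N) h + correlation n h (k N)))%E.
  have mM (u v : X -> R) : measurable_fun setT u -> measurable_fun setT v ->
     measurable_fun setT (fun x => (u x * (w n x * v (tau n x)))%:E).
    by move=> mu mv; apply/measurable_EFinP; apply: measurable_funM => //; exact: mW.
  have pM (u v : X -> R) : (forall x, 0 <= u x) -> (forall x, 0 <= v x) ->
     forall x, setT x -> (0 <= (u x * (w n x * v (tau n x)))%:E)%E.
    by move=> u0 v0 x _; rewrite lee_fin mulr_ge0// mulr_ge0.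
  rewrite /correlation -ge0_integralD//; try by [exact: mM|exact: pM].
  rewrite -ge0_integralD//; try by [exact: mM|exact: pM|exact: emeasurable_funD (mM _ _ _ _) (mM _ _ _ _)].
  - apply: ge0_le_integral => //; try by [exact: mM|exact: pM].
      by apply: emeasurable_funD; [|apply: emeasurable_funD]; exact: mM.
    move=> x _; rewrite -!EFinD lee_fin.
    have -> : h x * (w n x * h (tau n x)) = h1 N x * (w n x * h1 N (tau n x)) +
       (k N x * (w n x * h (tau n x)) + h1 N x * (w n x * k N (tau n x))).
      by rewrite [in LHS](hE N x) [in LHS](hE N (tau n x)) (hE N (tau n x)); ring.
    apply: lerD; last by apply: lerD => //; rewrite ler_wpM2r// mulr_ge0.
    by rewrite ler_pM// ?mulr_ge0// ler_wpM2l.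
  - move=> x _; rewrite -EFinD lee_fin addr_ge0//; by rewrite mulr_ge0// mulr_ge0.
set H := (\int[m]_x _)%E in h2.
have H0 : (0 <= H)%E by apply: integral_ge0 => x _; rewrite lee_fin sqr_ge0.
apply/ge0_cvge0P; first by move=> n; exact: correlation_ge0.
move=> e e0.
pose Hr := fine H; have HE : H = Hr%:E by rewrite fineK// ge0_fin_numE.
have Hr0 : 0 <= Hr by rewrite fine_ge0.
(* [del * Hr] is at most [e / 4], and [N] will make the squared norm of [k N] at most
   [del * (e / 8)]. Each cross term is then at most [e / 4 + e / 8], which leaves [e / 4] for the
   term of [g N]. The [+ 1] covers [Hr = 0]. *)
pose del := e / (4 * (Hr + 1)).
have del0 : 0 < del by rewrite divr_gt0// mulr_gt0// ltr_wpDl.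
have delH : del * Hr <= e / 4.
  have Hr1 : 0 < Hr + 1 by rewrite ltr_wpDl.
  have -> : del * Hr = e / 4 * (Hr / (Hr + 1)).
    by rewrite /del; field; rewrite gt_eqF.
  apply: ler_piMr; first by rewrite divr_ge0// ltW.
  by rewrite ler_pdivrMr// mul1r lerDl.
have [N kN] : exists N, (\int[m]_x (k N x ^+ 2)%:E <= (del * (e / 8))%:E)%E.
  have k2_0 M : (0 <= \int[m]_x (k M x ^+ 2)%:E)%E.
    by apply: integral_ge0 => x _; rewrite lee_fin sqr_ge0.
  have de0 : 0 < del * (e / 8) by rewrite mulr_gt0// divr_gt0.
  have [N _ kN] := (ge0_cvge0P k2_0).1 kc _ de0.
  by exists N; exact: kN (leqnn N).
have cN : \forall n \near \oo, (correlation n (g N) (g N) <= (e / 4)%:E)%E.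
  apply: (ge0_cvge0P _).1 (gc N) _ (divr_gt0 e0 _) => //.
  by move=> n; exact: correlation_ge0.
apply: filterS cN => n cn.
apply: (le_trans (split3 N n)).
apply: (@le_trans _ _ ((e / 4)%:E + ((e / 8 + e / 4)%:E + (e / 4 + e / 8)%:E))%E); last first.
  by rewrite -!EFinD lee_fin; lra.
have dk : ((del^-1)%:E * \int[m]_x (k N x ^+ 2)%:E <= (e / 8)%:E)%E.
  apply: (@le_trans _ _ ((del^-1)%:E * (del * (e / 8))%:E)%E).
    by apply: lee_wpmul2l => //; rewrite lee_fin invr_ge0 ltW.
  by rewrite -EFinM mulKf ?gt_eqF.
apply: leeD => //; apply: leeD.
  apply: (le_trans (@correlation_AMGM n (k N) h (del^-1) _ _ _ _ _)) => //.
    by rewrite invr_gt0.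
  by rewrite EFinD invrK; apply: leeD => //; rewrite -/H HE -EFinM lee_fin.
apply: (le_trans (@correlation_AMGM n h (k N) del _ _ _ _ _)) => //.
by rewrite EFinD; apply: leeD => //; rewrite -/H HE -EFinM lee_fin.
Qed.

End correlations.

(** * The radial measure *)

Section radial.
Context {R : realType}.
Variable alpha : R.
Hypothesis alpha0 : 0 < alpha.
Local Notation nu := (stable_radial alpha).

Lemma powRN_cvg_pinfty (p : R) : 0 < p -> x `^ (- p) @[x --> +oo] --> (0 : R).
Proof.
move=> p0; apply/cvgrPdist_le => e e0; near=> x.
have x0 : 0 < x by near: x; exact: nbhs_pinfty_gt.
rewrite sub0r normrN ger0_norm ?powR_ge0//.
have ep : 0 < e `^ (- p^-1) by rewrite powR_gt0.
have ex : e `^ (- p^-1) <= x by near: x; apply: nbhs_pinfty_ge; exact: num_real.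
rewrite powRN invf_ple ?posrE ?powR_gt0//.
have -> : e^-1 = (e `^ (- p^-1)) `^ p.
  by rewrite -powRrM mulNr mulVf ?gt_eqF// powR_inv1// ltW.
by apply: ge0_ler_powR => //; rewrite ?nnegrE ltW.
Unshelve. all: by end_near. Qed.

Lemma stable_radial_itv (a : R) : 0 < a ->
  nu `[a, +oo[%classic = (a `^ (- alpha) / alpha)%:E.
Proof.
move=> a0; rewrite /stable_radial setIidl; last first.
  by apply: subset_itv; rewrite ?bnd_simp.
pose F (x : R) := - (x `^ (- alpha) / alpha).
have dF (x : R) : a < x -> is_derive x 1 F ((x `^ (1 + alpha))^-1).
  move=> ax; have x0 : 0 < x by exact: lt_trans ax.
  have := is_derive1_powR (- alpha) x0.
  have -> : (- alpha - 1) = - (1 + alpha) by lra.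
  rewrite powRN => ?.
  suff -> : F = (- alpha^-1) *: (fun y => y `^ (- alpha)).
    apply: is_derive_eq.
    rewrite /GRing.scale/=. 
    by rewrite mulrA mulrNN mulVf ?gt_eqF// mul1r.
  apply/funext => y; change (- (y `^ (- alpha) / alpha) = - alpha^-1 * y `^ (- alpha)).
  by rewrite mulNr mulrC.
have cF (x : R) : 0 < x -> {for x, continuous F}.
  move=> x0; have /(@ex_derive _ _ _ _ _ _ _) := is_derive1_powR (- alpha) x0.
  move=> /derivable1_diffP/differentiable_continuous c.
  by apply: cvgN; apply: cvgMl.
rewrite (@ge0_continuous_FTC2y _ _ F _ 0).
- by rewrite /F EFinN oppeK add0e.
- by move=> x _; rewrite invr_ge0 powR_ge0.
- apply: continuous_in_subspaceT => x; rewrite inE/= in_itv/= andbT => ax.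
  have x0 : 0 < x by exact: lt_le_trans ax.
  have /(@ex_derive _ _ _ _ _ _ _) := is_derive1_powR (1 + alpha) x0.
  move=> /derivable1_diffP/differentiable_continuous c.
  by apply: cvgV => //; rewrite gt_eqF ?powR_gt0.
- rewrite /F -[X in _ --> X]oppr0; apply: cvgN.
  rewrite -[X in _ --> X](mul0r alpha^-1); apply: cvgMl.
  exact: powRN_cvg_pinfty.
- by move=> x ax; have /(@ex_derive _ _ _ _ _ _ _) := dF _ ax.
- by apply: cvg_at_right_filter; exact: cF.
- by move=> x; rewrite in_itv/= andbT => /dF ?; rewrite derive1E derive_val.
Qed.

Lemma stable_radial_itv_gt0 (a : R) : 0 < a -> 0 < a `^ (- alpha) / alpha.
Proof. by move=> a0; rewrite divr_gt0// powR_gt0. Qed.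

(** The tails [a]^ (- alpha) / alpha[are homogeneous, and uniqueness of measures extends this to
    Borel sets. With]c = D x [^ alpha^-1] the fibre mass is multiplied by exactly [D x]. *)
Lemma stable_radial_scale (c : R) (B : set (measurableTypeR R)) : 0 < c ->
  measurable B ->
  nu ((fun s : measurableTypeR R => s * c) @^-1` B) = ((c `^ alpha)%:E * nu B)%E.
Proof.
move=> c0 mB.
have ms : measurable_fun setT ((fun s => s * c) : measurableTypeR R -> measurableTypeR R).
  exact: measurable_funM.
(* The measure is infinite near 0, so half-lines with [`]0, a[] removed are used
   as a generating pi-system. *)
pose G := [set A : set (measurableTypeR R) |
  exists x a : R, 0 < a /\ A = `[x, +oo[ `\` `]0, a[].
pose g (n : nat) : set (measurableTypeR R) := `[- n%:R : R, +oo[ `\` `]0, n.+1%:R^-1[.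
(* Nonpositive numbers are null, so removing []0, a[] amounts to raising the left end to
   [Num.max x a]. *)
have Gval (x a : R) : 0 < a -> nu (`[x, +oo[ `\` `]0, a[) = nu (`[Num.max x a, +oo[).
  move=> a0; rewrite /stable_radial; congr (integral _ _ _).
  apply/seteqP; split => y; rewrite /= !in_itv/= !andbT ge_max.
    move=> [[xy] + y0]; rewrite y0/= => /negP; rewrite -leNgt => ay.
    by rewrite xy ay.
  by move=> [/andP[xy ay] y0]; rewrite xy y0/=; split => //; split => //; apply/negP; rewrite -leNgt.
pose m2 := mscale (NngNum (powR_ge0 c alpha)) nu.
have Gval2 (x a : R) : 0 < a -> nu ((fun s : measurableTypeR R => s * c) @^-1` (`[x, +oo[ `\` `]0, a[)) =
    nu (`[Num.max x a / c, +oo[).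
  move=> a0; rewrite /stable_radial; congr (integral _ _ _).
  apply/seteqP; split => y; rewrite /= !in_itv/= !andbT ler_pdivrMr// ge_max.
    move=> [[xy] + y0]; rewrite mulr_gt0//= => /negP; rewrite -leNgt => ay.
    by rewrite xy ay.
  move=> [/andP[xy ay] y0]; rewrite xy mulr_gt0//=; split => //; split => //.
  by apply/negP; rewrite -leNgt.
apply: (@measure_unique _ _ _ G g _ _ _ _ (image_measure nu ms) m2) => //.
- rewrite RGenCInfty.measurableE; apply/seteqP; split; apply: smallest_sub => //.
  + move=> _ [x ->].
    have -> : `[x, +oo[%classic = \bigcup_(n in setT) (`[x, +oo[ `\` `]0, n.+1%:R^-1[).
      apply/seteqP; split => y; last by case=> n _ [].
      move=> xy; have [y0|y0] := leP y 0.
        by exists 0%N => //; split => //=; rewrite in_itv/= ltNge y0.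
      exists (Num.truncn y^-1) => //; split => //=; rewrite in_itv/= y0/=.
      apply/negP; rewrite -leNgt invf_ple ?posrE// ltW//.
      exact: truncnS_gt.
    apply: (sigma_algebra_bigcup).
    move=> n; apply: sub_sigma_algebra; exists x, n.+1%:R^-1; split => //.
  + apply: smallest_sigma_algebra.
  + move=> _ [x [a [a0 ->]]].
    have h : measurable ((`[x, +oo[ `\` `]0, a[) : set (measurableTypeR R)).
      by apply: measurableD; exact: measurable_itv.
    by rewrite -RGenCInfty.measurableE.
- move=> _ _ [x [a [a0 ->]]] [x' [a' [a'0 ->]]].
  exists (Num.max x x'), (Num.max a a'); split; first by rewrite lt_max a0.
  apply/seteqP; split => y; rewrite /= !in_itv/= !andbT ge_max lt_max.
    by move=> [[-> h1] [-> h2]]; split => //; case: (0 < y) h1 h2 => //= /negP/negbTE -> /negP/negbTE ->.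
  by move=> [/andP[-> ->]]; case: (0 < y) => //= /negP; rewrite negb_or => /andP[/negP ? /negP ?].
- by move=> n; exists (- n%:R), n.+1%:R^-1; split.
- apply/seteqP; split => // y _.
  have [y0|y0] := leP y 0.
    exists (Num.truncn (- y)).+1 => //; split => /=; rewrite in_itv/=.
      by rewrite andbT lerNl ltW// truncnS_gt.
    by rewrite ltNge y0.
  exists (Num.truncn y^-1) => //; split => //=; rewrite in_itv/= ?y0/=.
    by rewrite andbT (@le_trans _ _ 0)// ?ltW// oppr_le0.
  apply/negP; rewrite -leNgt invf_ple ?posrE// ltW//.
  exact: truncnS_gt.
- move=> _ [x [a [a0 ->]]]; rewrite /= /pushforward Gval2// /m2 /mscale/= Gval//.
  have m0 : 0 < Num.max x a by rewrite lt_max a0 orbT.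
  rewrite !stable_radial_itv// ?divr_gt0// -EFinM; congr EFin.
  rewrite powRM ?invr_ge0 ?ltW//.
  rewrite -[c^-1]powR_inv1 ?ltW// -powRrM mulN1r opprK; ring.
- move=> k; rewrite /= /pushforward Gval2// stable_radial_itv ?ltry//.
  by rewrite divr_gt0// lt_max invr_gt0 ltr0n orbT.
Qed.

End radial.

(** * The Maharam extension *)

Lemma measurable_iter {d'} {Y : measurableType d'} (f : Y -> Y) n :
  measurable_fun setT f -> measurable_fun setT (iter n f).
Proof.
by move=> mf; elim: n => [|n IH]; [exact: measurable_id|exact: measurableT_comp].
Qed.

Lemma iter_preserving {d} {Y : measurableType d} {R : realType}
    (k : set Y -> \bar R) (f : Y -> Y) :
  measurable_fun setT f ->
  (forall E, measurable E -> k (f @^-1` E) = k E) ->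
  forall n E, measurable E -> k (iter n f @^-1` E) = k E.
Proof.
move=> mf kf; elim=> [//|n IH] E mE.
have -> : iter n.+1 f @^-1` E = f @^-1` (iter n f @^-1` E).
  by apply/seteqP; split => y /=; rewrite -iterSr.
rewrite kf ?IH//.
by rewrite -[X in measurable X]setTI; exact: measurable_iter.
Qed.

Lemma ge0_integral_preserving {d d'} {X : measurableType d}
    {Y : measurableType d'} {R : realType}
    (m : {measure set X -> \bar R}) (k : {measure set Y -> \bar R})
    (f : X -> Y) : measurable_fun setT f ->
  (forall E, measurable E -> m (f @^-1` E) = k E) ->
  forall F : Y -> \bar R, measurable_fun setT F -> (forall y, 0 <= F y)%E ->
  (\int[m]_x F (f x) = \int[k]_y F y)%E.
Proof.
move=> mf mk F mF F0.
rewrite -(@ge0_integral_pushforward _ _ _ _ _ _ mf m setT F)//.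
by apply: eq_measure_integral => A mA _; exact: mk.
Qed.

Section maharam_extension.
Context {R : realType} {d} {X : measurableType d}.
Variable alpha : R.
Hypothesis alpha0 : 0 < alpha.
Variable mu : {sigma_finite_measure set X -> \bar R}.
Variable T : X -> X.
Hypothesis hT : nonsingular_automorphism mu T.
Variable D : X -> R.
Hypothesis hD : rn_derivative mu T D.
Local Notation nu := (stable_radial alpha).
Local Notation m := (maharam_measure alpha mu).
Local Notation MT := (maharam_map alpha T D).

Let mT : measurable_fun setT T. Proof. by case: hT. Qed.
Let mD : measurable_fun setT D. Proof. by case: hD. Qed.
Let D0 x : 0 < D x. Proof. by case: hD. Qed.

Let measurable_fst_powR (c : X -> R) : measurable_fun setT c ->
  measurable_fun setT (fun p : X * measurableTypeR R => c p.1 `^ alpha^-1).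
Proof.
move=> mc; apply: (measurableT_comp (measurable_powR alpha^-1)).
exact: (measurableT_comp mc measurable_fst).
Qed.

Lemma measurable_maharam_map : measurable_fun setT MT.
Proof.
apply/measurable_fun_pairP; split => /=.
  exact: (measurableT_comp mT measurable_fst).
apply: measurable_funM; first exact: measurable_snd.
exact: measurable_fst_powR.
Qed.

Let powR_invK (c : R) : 0 < c -> (c `^ alpha^-1) `^ alpha = c.
Proof. by move=> c0; rewrite -powRrM mulVf ?gt_eqF// powRr1// ltW. Qed.

(** On a rectangle [A x B], the fibre over a point [x] of [T^-1 A] contributes [D x * nu B];
    integrating the density [D] over [T^-1 A] gives the measure of [T (T^-1 A) = A]. Uniqueness of
    the product measure does the rest. *)
Lemma maharam_measure_preserving (E : set (X * measurableTypeR R)) :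
  measurable E -> m (MT @^-1` E) = m E.
Proof.
move=> mE; apply/esym.
apply: (@product_measure_unique _ _ _ _ _ mu (stable_radial alpha)
  (image_measure m measurable_maharam_map)) => // A B mA mB.
rewrite /= /pushforward.
have TA : measurable (T @^-1` A) by rewrite -[X in measurable X]setTI; exact: mT.
transitivity (\int[mu]_(x in T @^-1` A) ((D x)%:E * nu B))%E.
  rewrite [RHS]integral_mkcond; apply: eq_integral => x _ /=.
  rewrite patchE; case: ifPn => xA.
    transitivity (((D x `^ alpha^-1) `^ alpha)%:E * nu B)%E; last by rewrite powR_invK.
    rewrite -stable_radial_scale ?powR_gt0//.
    congr (stable_radial alpha _); apply/seteqP; split => s.
      by rewrite /xsection/= inE => -[].
    by rewrite /xsection/= inE/= => ?; split => //; rewrite inE in xA.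
  transitivity (nu set0); last by rewrite measure0.
  congr (stable_radial alpha _).
  apply/seteqP; split => // s; rewrite /xsection/= inE/= => -[/= Ax _].
  by move: xA; rewrite notin_setE; apply.
rewrite ge0_integralZr//.
- case: hD => _ _ <- //; congr (mu _ * _)%E.
  rewrite image_preimage// -subTset => y _ /=.
  by case: hT => -[g _ gK] _ _ _ _; exists (g y).
- by apply/measurable_EFinP; exact: measurable_funTS.
- by move=> x _; rewrite lee_fin ltW.
Qed.

Lemma maharam_iter_preserving n (E : set (X * measurableTypeR R)) :
  measurable E -> m (iter n MT @^-1` E) = m E.
Proof.
exact: (iter_preserving measurable_maharam_map maharam_measure_preserving).
Qed.

(** By the chain rule, a version of the derivative of [B |-> mu (T^n B)] with respect to [mu]. *)
Definition rn_cocycle (n : nat) (x : X) : R := \prod_(i < n) D (iter i T x).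

Lemma rn_cocycle_gt0 n x : 0 < rn_cocycle n x.
Proof. by apply: prodr_gt0 => i _. Qed.

Lemma rn_cocycleS n x : rn_cocycle n.+1 x = D x * rn_cocycle n (T x).
Proof.
rewrite /rn_cocycle big_ord_recl; congr (_ * _); apply: eq_bigr => i _.
by rewrite -iterSr.
Qed.

Lemma measurable_rn_cocycle n : measurable_fun setT (rn_cocycle n).
Proof.
elim: n => [|n IH].
  rewrite [rn_cocycle 0](_ : _ = cst 1)//; apply/funext => x.
  by rewrite /rn_cocycle big_ord0.
rewrite [rn_cocycle _](_ : _ = fun x => D x * rn_cocycle n (T x)).
  by apply: measurable_funM => //; exact: measurableT_comp.
by apply/funext => x; rewrite rn_cocycleS.
Qed.

Lemma maharam_iterE n (p : X * measurableTypeR R) :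
  iter n MT p = (iter n T p.1, p.2 * rn_cocycle n p.1 `^ alpha^-1).
Proof.
elim: n p => [|n IH] p.
  by rewrite /rn_cocycle/= big_ord0 powR1 mulr1; case: p.
rewrite iterSr IH /= -iterSr rn_cocycleS powRM ?mulrA// ltW//.
exact: rn_cocycle_gt0.
Qed.

Lemma maharam_integral_itv (a : R) (u c : X -> R) : 0 < a ->
  measurable_fun setT u -> (forall x, 0 <= u x) ->
  measurable_fun setT c -> (forall x, 0 < c x) ->
  (\int[m]_p (u p.1 * (\1_(`[a, +oo[) (p.2 * c p.1 `^ alpha^-1)))%:E =
   (a `^ (- alpha) / alpha)%:E * \int[mu]_x (u x * c x)%:E)%E.
Proof.
move=> a0 mu0 u0 mc c0.
have ms : measurable_fun setT (fun p : X * measurableTypeR R => p.2 * c p.1 `^ alpha^-1).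
  apply: measurable_funM; first exact: measurable_snd.
  exact: measurable_fst_powR.
rewrite /maharam_measure fubini_tonelli1//; last first.
- by move=> p; rewrite lee_fin mulr_ge0// indicE.
- apply/measurable_EFinP; apply: measurable_funM.
    exact: (measurableT_comp mu0 measurable_fst).
  apply: measurableT_comp => //; apply: measurable_indic; exact: measurable_itv.
have k0 := stable_radial_itv_gt0 alpha0 a0.
rewrite -ge0_integralZl//; last first.
- by rewrite lee_fin ltW.
- by move=> x _; rewrite lee_fin mulr_ge0// ltW.
- by apply/measurable_EFinP; exact: measurable_funM.
apply: eq_integral => x _; rewrite /fubini_F/=.
under eq_integral do rewrite EFinM.
have ms' : measurable_fun setT
    (fun s : measurableTypeR R => s * c x `^ alpha^-1 : measurableTypeR R).
  exact: measurable_funM.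
have mi : measurable (`[a, +oo[ : set (measurableTypeR R)) by exact: measurable_itv.
have mI : measurable ((fun s : measurableTypeR R => s * c x `^ alpha^-1) @^-1` `[a, +oo[).
  by rewrite -[X in measurable X]setTI; exact: ms'.
rewrite ge0_integralZl//; last first.
- by rewrite lee_fin.
- by apply/measurable_EFinP; exact: (measurableT_comp (measurable_indic mi) ms').
rewrite [X in (_ * X)%E](_ : _ = nu ((fun s : measurableTypeR R => s * c x `^ alpha^-1) @^-1` `[a, +oo[)); last first.
  by rewrite -[in RHS](setIT (_ @^-1` _)) -integral_indic.
rewrite stable_radial_scale ?powR_gt0//.
by rewrite powR_invK// stable_radial_itv// !EFinM muleA muleC.
Qed.

(** Read off from the invariance of the Maharam measure: the same function at level 1 is integrated
    before and after [n] steps, and the common positive factor [k] cancels. *)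
Lemma rn_cocycle_change_of_variables n (g : X -> R) : measurable_fun setT g ->
  (forall x, 0 <= g x) ->
  (\int[mu]_x (rn_cocycle n x * g (iter n T x))%:E = \int[mu]_x (g x)%:E)%E.
Proof.
move=> mg g0.
have k0 := stable_radial_itv_gt0 alpha0 ltr01.
set k := (_ / _) in k0.
have := maharam_integral_itv ltr01 mg g0 (measurable_cst (1 : R)) (fun=> ltr01).
have mgn : measurable_fun setT (fun x => g (iter n T x)).
  by apply: measurableT_comp => //; exact: measurable_iter.
have := maharam_integral_itv ltr01 mgn (fun=> g0 _) (measurable_rn_cocycle n) (rn_cocycle_gt0 n).
rewrite -/k; set I1 := integral _ _ _; set I2 := integral _ _ _ => eq1.
set I3 := integral _ _ _; set I4 := integral _ _ _ => eq2.
have I13 : I1 = I3.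
  pose F (p : X * measurableTypeR R) := (g p.1 * (\1_(`[1, +oo[) (p.2 * 1 `^ alpha^-1)))%:E.
  transitivity (\int[m]_p (F (iter n MT p)))%E.
    apply: eq_integral => p _; rewrite /F maharam_iterE/= powR1 mulr1//.
  apply: (ge0_integral_preserving (measurable_iter n measurable_maharam_map)
    (maharam_iter_preserving n)).
    apply/measurable_EFinP; apply: measurable_funM.
      exact: (measurableT_comp mg measurable_fst).
    have mi : measurable (`[1, +oo[ : set (measurableTypeR R)).
      exact: measurable_itv.
    have ms : measurable_fun setT (fun p : X * measurableTypeR R =>
        p.2 * 1 `^ alpha^-1 : measurableTypeR R).
      by apply: measurable_funM => //; exact: measurable_snd.
    exact: (measurableT_comp (measurable_indic mi) ms).
  by move=> p; rewrite lee_fin mulr_ge0// indicE.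
have kI : (k%:E * I2 = k%:E * I4)%E by rewrite -eq1 -eq2.
have I24 : I2 = I4 by exact: muleI_gt0 kI.
transitivity I2; first by apply: eq_integral => x _; rewrite mulrC.
by rewrite I24; apply: eq_integral => x _; rewrite mulr1.
Qed.

(** For positive [s], the conditions [s >= a] and [s * D_n]^ alpha^-1 >= a[together say that]s *
    min(1, D_n) [^ alpha^-1 >= a]. This is the origin of the minimum. *)
Lemma maharam_return_measure (A : set X) (a : R) n : measurable A -> 0 < a ->
  (\int[m]_p (\1_(A `*` `[a, +oo[) p * \1_(A `*` `[a, +oo[) (iter n MT p))%:E =
   (a `^ (- alpha) / alpha)%:E *
   \int[mu]_x (\1_A x * \1_A (iter n T x) * Num.min 1 (rn_cocycle n x))%:E)%E.
Proof.
move=> mA a0.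
rewrite -(@maharam_integral_itv a (fun x => \1_A x * \1_A (iter n T x)) (fun x => Num.min 1 (rn_cocycle n x))) //.
- apply: eq_integral => -[x s] _; congr EFin; rewrite maharam_iterE/= !indicE !in_setX/=.
  have -> : (s * Num.min 1 (rn_cocycle n x) `^ alpha^-1 \in `[a, +oo[%classic) =
     (s \in `[a, +oo[%classic) && (s * rn_cocycle n x `^ alpha^-1 \in `[a, +oo[%classic).
    rewrite !mem_setE !in_itv/= !andbT.
    have ai : 0 <= alpha^-1 by rewrite invr_ge0 ltW.
    have ge0_powR := ge0_ler_powR ai.
    have p1 : 1 `^ alpha^-1 = 1 :> R by rewrite powR1.
    (* The fibre is encoded as the whole line; for nonpositive [s] both sides are false since
       [a > 0]. *)
    have [s0|s0] := leP s 0.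
      have sc (b : R) : 0 < b -> (a <= s * b `^ alpha^-1) = false.
        move=> b0; rewrite lt_geF// (le_lt_trans _ a0)// pmulr_lle0//.
        by rewrite powR_gt0.
      by rewrite !sc ?andbF// ?lt_min ?ltr01/= (rn_cocycle_gt0 n x).
    have [c1|c1] := leP 1 (rn_cocycle n x).
      rewrite powR1 mulr1; case: leP => // /= as_.
      apply/esym/(le_trans as_); rewrite ler_pMr//.
      by rewrite -[leLHS]p1; apply: ge0_powR; rewrite ?nnegrE// ltW// rn_cocycle_gt0.
    apply/idP/andP => [h|[]//]; split => //; apply: (le_trans h).
    rewrite ger_pMr//.
    by rewrite -[leRHS]p1; apply: ge0_powR; rewrite ?nnegrE// ltW// rn_cocycle_gt0.
  by do 4 case: (_ \in _); rewrite /= ?mulr0 ?mul0r ?mulr1.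
- apply: measurable_funM => //; apply: measurableT_comp => //; exact: measurable_iter.
- by apply: measurable_minr => //; exact: measurable_rn_cocycle.
- by move=> x; rewrite lt_min ltr01 rn_cocycle_gt0.
Qed.

End maharam_extension.

(** * Koopman operator and Maharam extension *)

Section complex_limits.
Context {R : realType}.
Implicit Types z : R[i].

Lemma normc_Re z : `|complex.Re z| <= Normc.normc z.
Proof.
by case: z => a b /=; rewrite -sqrtr_sqr ler_wsqrtr// lerDl sqr_ge0.
Qed.

Lemma normc_Im z : `|complex.Im z| <= Normc.normc z.
Proof.
by case: z => a b /=; rewrite -sqrtr_sqr ler_wsqrtr// lerDr sqr_ge0.
Qed.

Lemma normc_le_ReIm z : Normc.normc z <= `|complex.Re z| + `|complex.Im z|.
Proof.
case: z => a b /=; rewrite -[leRHS]ger0_norm ?addr_ge0// -sqrtr_sqr ler_wsqrtr//.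
by rewrite sqrrD !real_normK ?num_real// addrAC lerDl mulrn_wge0// mulr_ge0.
Qed.

Lemma normcJ z : Normc.normc (z^*)%C = Normc.normc z.
Proof. by case: z => a b /=; rewrite sqrrN. Qed.

(** The norm of [R[i]^o] takes its values in [R[i]], where a positive element is a positive real;
    this passes to real radii. *)
Lemma complex_cvg0P (z : nat -> R[i]) :
  (z : nat -> R[i]^o) @ \oo --> (0 : R[i]^o) <->
  forall e : R, 0 < e -> \forall n \near \oo, Normc.normc (z n) <= e.
Proof.
split=> [/cvgrPdist_le h e e0|h]; last apply/cvgrPdist_le => e.
  have : 0 < (e%:C)%C :> R[i] by rewrite ltcR.
  move=> /h; apply: filterS => n; rewrite sub0r normrN.
  by rewrite lecE/= => /andP[_].
rewrite ltcE/= => /andP[/eqP ei e0].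
have := h _ e0; apply: filterS => n zn.
by rewrite sub0r normrN lecE/= ei eqxx.
Qed.

End complex_limits.

Lemma measurable_sqrtr {R : realType} : measurable_fun setT (@Num.sqrt R).
Proof. by apply: continuous_measurable_fun; exact: sqrt_continuous. Qed.

Lemma Rintegral_le_bound {d} {X : measurableType d} {R : realType}
    (m : {measure set X -> \bar R}) (f g : X -> R) (e : R) :
  measurable_fun setT f -> measurable_fun setT g -> (forall x, `|f x| <= g x) ->
  (\int[m]_x (g x)%:E <= e%:E)%E -> `|Rintegral m setT f| <= e.
Proof.
move=> mf mg fg ge.
have le1 : (\int[m]_x `|(f x)%:E| <= e%:E)%E.
  apply: le_trans ge; apply: ge0_le_integral => //.
  - by apply/measurable_EFinP; exact: measurableT_comp.
  - exact/measurable_EFinP.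
  - by move=> x _; rewrite abse_EFin lee_fin.
have intf : m.-integrable setT (EFin \o f).
  apply/integrableP; split; first exact/measurable_EFinP.
  by rewrite (le_lt_trans le1) ?ltry.
rewrite -lee_fin EFin_normr_Rintegral//; apply: le_trans le1.
by apply: le_abse_integral => //; exact/measurable_EFinP.
Qed.

Section koopman_and_maharam.
Context {R : realType} {d} {X : measurableType d}.
Variable alpha : R.
Hypothesis alpha0 : 0 < alpha.
Variable mu : {sigma_finite_measure set X -> \bar R}.
Variable T : X -> X.
Hypothesis hT : nonsingular_automorphism mu T.
Variable D : X -> R.
Hypothesis hD : rn_derivative mu T D.
Local Notation nu := (stable_radial alpha).
Local Notation m := (maharam_measure alpha mu).
Local Notation MT := (maharam_map alpha T D).
Local Notation Dn := (rn_cocycle T D).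

Let mT : measurable_fun setT T. Proof. by case: hT. Qed.
Let mTn n : measurable_fun setT (iter n T). Proof. exact: measurable_iter. Qed.
Let mDn n : measurable_fun setT (Dn n). Proof. exact: (measurable_rn_cocycle hT hD). Qed.
Let Dn0 n x : 0 < Dn n x. Proof. exact: (rn_cocycle_gt0 hD). Qed.
Let mMTn n : measurable_fun setT (iter n MT).
Proof. by apply: measurable_iter; exact: (measurable_maharam_map alpha hT hD). Qed.

Let sDn n x := Num.sqrt (Dn n x).
Let msDn n : measurable_fun setT (sDn n).
Proof. by apply: measurableT_comp => //; exact: measurable_sqrtr. Qed.
Let sDn0 n x : 0 <= sDn n x. Proof. exact: sqrtr_ge0. Qed.

Definition koopman_correlation := correlation mu sDn (fun n => iter n T).

Definition maharam_correlation :=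
  correlation m (fun _ _ => 1) (fun n => iter n MT).

Let koopman_contr n (v : X -> R) : measurable_fun setT v -> (forall x, 0 <= v x) ->
  (\int[mu]_x ((sDn n x * v (iter n T x)) ^+ 2)%:E <= \int[mu]_x ((v x) ^+ 2)%:E)%E.
Proof.
move=> mv v0.
rewrite -(rn_cocycle_change_of_variables alpha0 hT hD n (measurable_funX 2 mv) (fun=> sqr_ge0 _)).
rewrite le_eqVlt; apply/orP; left; apply/eqP.
by apply: eq_integral => x _; rewrite exprMn sqr_sqrtr// ltW.
Qed.

Lemma maharam_integral_iter n (F : X * measurableTypeR R -> \bar R) :
  measurable_fun setT F -> (forall p, 0 <= F p)%E ->
  (\int[m]_p F (iter n MT p) = \int[m]_p F p)%E.
Proof.
exact: (ge0_integral_preserving (@mMTn n) (maharam_iter_preserving alpha0 hT hD n)).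
Qed.

Lemma maharam_contr n (v : X * measurableTypeR R -> R) : measurable_fun setT v ->
  (forall x, 0 <= v x) ->
  (\int[m]_x ((1 * v (iter n MT x)) ^+ 2)%:E <= \int[m]_x ((v x) ^+ 2)%:E)%E.
Proof.
move=> mv v0; under eq_integral do rewrite mul1r.
rewrite (@maharam_integral_iter n (fun p => (v p ^+ 2)%:E))//.
  by apply/measurable_EFinP; exact: measurable_funX.
by move=> p; rewrite lee_fin sqr_ge0.
Qed.

(** Stated on indicators, the functions that rectangles of the extension see directly;
    [koopman_zero_typeW] extends it to nonnegative square integrable functions. *)
Definition koopman_zero_type := forall A : set X, measurable A -> (mu A < +oo)%E ->
  koopman_correlation n \1_A \1_A @[n --> \oo] --> 0%E.

Definition maharam_zero_type := forall h : X * measurableTypeR R -> R,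
  measurable_fun setT h -> (forall p, 0 <= h p) ->
  (\int[m]_p ((h p) ^+ 2)%:E < +oo)%E ->
  maharam_correlation n h h @[n --> \oo] --> 0%E.

Let correlationZ d' (Y : measurableType d') (k : {measure set Y -> \bar R})
   (w : nat -> Y -> R) (tau : nat -> Y -> Y) (c : R) (f : Y -> R) n :
   (forall x, measurable_fun setT (w x)) -> (forall n x, 0 <= w n x) ->
   (forall n, measurable_fun setT (tau n)) ->
   measurable_fun setT f -> (forall x, 0 <= f x) ->
   correlation k w tau n (fun x => c * f x) (fun x => c * f x) =
   ((c ^+ 2)%:E * correlation k w tau n f f)%E.
Proof.
move=> mw w0 mtau mf f0; rewrite /correlation -ge0_integralZl//.
- by apply: eq_integral => x _; rewrite -EFinM; congr EFin; ring.
- apply/measurable_EFinP; do 2 apply: measurable_funM => //.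
  exact: measurableT_comp.
- by move=> x _; rewrite lee_fin !mulr_ge0.
- by rewrite lee_fin sqr_ge0.
Qed.

(** Along an increasing exhaustion [A] by sets of finite measure, the functions [N%:R * \1_(A N)]
    eventually exceed a finite-valued [h] at every point. *)
Lemma koopman_zero_typeW : koopman_zero_type -> forall h : X -> R,
  measurable_fun setT h -> (forall x, 0 <= h x) ->
  (\int[mu]_x ((h x) ^+ 2)%:E < +oo)%E ->
  koopman_correlation n h h @[n --> \oo] --> 0%E.
Proof.
move=> kz h mh h0 h2.
have /sigma_finiteP[A [TA ndA Aoo]] := sigma_finiteT mu.
pose g (N : nat) (x : X) : R := N%:R * \1_(A N) x.
have mA N : measurable (A N) by case: (Aoo N).
apply: (@correlation_cvg0 _ _ _ mu sDn (fun n => iter n T) msDn sDn0 mTn koopman_contr g) => //.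
- by move=> N; apply: measurable_funM.
- by move=> N x; rewrite mulr_ge0.
- move=> N; under eq_cvg do rewrite correlationZ//.
  by apply: cvgeM0; apply: kz => //; case: (Aoo N).
- apply: aeW => x; have : (\bigcup_i A i) x by rewrite -TA.
  case=> i _ Ax; near=> N; rewrite /g indicE mem_set ?mulr1.
    have : (Num.truncn (h x)).+1%:R <= N%:R :> R.
      by rewrite ler_nat; near: N; exact: nbhs_infty_ge.
    by apply: le_trans; rewrite ltW// truncnS_gt.
  by move: Ax; apply/subsetPset/ndA; near: N; exact: nbhs_infty_ge.
Unshelve. all: by end_near. Qed.

Lemma maharam_return_correlation (A : set X) (a : R) n : measurable A -> 0 < a ->
  maharam_correlation n \1_(A `*` `[a, +oo[) \1_(A `*` `[a, +oo[) =
   ((a `^ (- alpha) / alpha)%:E *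
   \int[mu]_x (\1_A x * \1_A (iter n T x) * Num.min 1 (Dn n x))%:E)%E.
Proof.
move=> mA a0; rewrite -(maharam_return_measure alpha0 hT hD n mA a0).
by apply: eq_integral => p _; rewrite mul1r.
Qed.

Lemma maharam_zero_type_of_koopman : koopman_zero_type -> maharam_zero_type.
Proof.
move=> kz h mh h0 h2.
have /sigma_finiteP[A [TA ndA Aoo]] := sigma_finiteT mu.
have mA N : measurable (A N) by case: (Aoo N).
(* The lower edge is positive, as the return formula requires, and decreases to 0, so that the
   rectangles exhaust the positive fibres. *)
pose E (N : nat) : set (X * measurableTypeR R) := A N `*` `[N.+1%:R^-1, +oo[.
have mE N : measurable (E N) by apply: measurableX => //; exact: measurable_itv.
pose g (N : nat) (p : X * measurableTypeR R) : R := N%:R * \1_(E N) p.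
apply: (@correlation_cvg0 _ _ _ m _ (fun n => iter n MT) _ _ mMTn maharam_contr g) => //.
- by move=> N; apply: measurable_funM.
- by move=> N x; rewrite mulr_ge0.
- move=> N; under eq_cvg.
    move=> n; rewrite correlationZ//.
    rewrite -/(maharam_correlation n _ _) maharam_return_correlation ?invr_gt0//.
    over.
  apply: cvgeM0; apply: cvgeM0.
  apply: ge0_le_cvge0 (kz (A N) _ _) => //; last by case: (Aoo N).
  + by move=> n; apply: integral_ge0 => x _; rewrite lee_fin !mulr_ge0// le_min ler01 ltW.
  + move=> n; apply: ge0_le_integral => //.
    * by move=> x _; rewrite lee_fin !mulr_ge0// le_min ler01 ltW.
    * apply/measurable_EFinP; apply: measurable_funM; last exact: measurable_minr.
      by apply: measurable_funM => //; exact: measurableT_comp.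
    * apply/measurable_EFinP; do 2 apply: measurable_funM => //.
      exact: measurableT_comp.
    * move=> x _; rewrite lee_fin mulrAC -mulrA ler_wpM2l// ler_wpM2r//.
      rewrite /sDn; have := Dn0 n x; move: (Dn n x) => c c0.
      have [c1|c1] := leP 1 c; first by rewrite -[leLHS]sqrtr1 ler_wsqrtr.
      rewrite -{1}(ger0_norm (ltW c0)) -sqrtr_sqr; apply: ler_wsqrtr.
      by rewrite expr2 ger_pMr// ltW.
(* Domination can fail only on the nonpositive half of the encoded fibre, which is null. *)
- exists (setT `*` `]-oo, 0%R]); split.
  + by apply: measurableX => //; exact: measurable_itv.
  + apply: (etrans (product_measure1E mu nu measurableT (measurable_itv `]-oo, 0%R]))).
    rewrite [X in (_ * X)%E](_ : _ = 0%E) ?mule0// /= /stable_radial.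
    rewrite [X in integral _ X _](_ : _ = set0) ?integral_set0//.
    apply/seteqP; split => // s /=; rewrite !in_itv/= andbT => -[s0].
    by rewrite ltNge s0.
  + move=> [x s] /= hn; split => //=; rewrite in_itv/= leNgt; apply/negP => s0.
    apply: hn; have : (\bigcup_i A i) x by rewrite -TA.
    case=> i _ Ax; near=> N; rewrite /g indicE mem_set ?mulr1.
      have : (Num.truncn (h (x, s))).+1%:R <= N%:R :> R.
        by rewrite ler_nat; near: N; exact: nbhs_infty_ge.
      by apply: le_trans; rewrite ltW// truncnS_gt.
    split => /=.
      by move: Ax; apply/subsetPset/ndA; near: N; exact: nbhs_infty_ge.
    rewrite in_itv/= andbT invf_ple ?posrE//.
    have : (Num.truncn s^-1).+1%:R <= N%:R :> R.
      by rewrite ler_nat; near: N; exact: nbhs_infty_ge.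
    move=> sN; rewrite (le_trans (ltW (truncnS_gt _)))// (le_trans sN)//.
    by rewrite ler_nat.
Unshelve. all: by end_near. Qed.

(** The rectangle at level 1 has finite measure, so zero type of the extension forces the integrals
    [J n] of [min(1, D_n)] to 0. The rest of the bound on [sqrt D_n] is small uniformly in [n], so
    [e] can be fixed before [n]. *)
Lemma koopman_zero_type_of_maharam : maharam_zero_type -> koopman_zero_type.
Proof.
move=> mz A mA Aoo.
pose E : set (X * measurableTypeR R) := A `*` `[1, +oo[.
have mE : measurable E by apply: measurableX => //; exact: measurable_itv.
pose k := 1 `^ (- alpha) / alpha.
have k0 : 0 < k by exact: (stable_radial_itv_gt0 alpha0 ltr01).
pose J n := (\int[mu]_x (\1_A x * \1_A (iter n T x) * Num.min 1 (Dn n x))%:E)%E.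
have J0 n : (0 <= J n)%E.
  by apply: integral_ge0 => x _; rewrite lee_fin !mulr_ge0// le_min ler01 ltW.
have Jc : J n @[n --> \oo] --> 0%E.
  have -> : J = (fun n => (k^-1)%:E * maharam_correlation n \1_E \1_E)%E.
    apply/funext => n; rewrite maharam_return_correlation//.
    by rewrite muleA -EFinM mulVf ?gt_eqF// mul1e.
  apply: cvgeM0; apply: mz => //.
  under eq_integral => p _.
    rewrite [X in X%:E](_ : _ = \1_E p); last first.
      by rewrite indicE; case: (_ \in _); rewrite /= ?expr1n ?expr0n.
    over.
  rewrite integral_indic// setIT.
  apply: (le_lt_trans (y := (mu A * nu `[1%R, +oo[)%E)).
    have := product_measure1E mu nu mA (measurable_itv `[1%R, +oo[).
    by move=> /eqP; rewrite eq_le => /andP[].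
  by rewrite stable_radial_itv// muleC lte_mul_pinfty// lee_fin ltW.
have pM n : forall x, setT x -> (0 <= (\1_A x * \1_A (iter n T x) * Num.min 1 (Dn n x))%:E)%E.
  by move=> x _; rewrite lee_fin !mulr_ge0// le_min ler01 ltW.
have mM n : measurable_fun setT (fun x => (\1_A x * \1_A (iter n T x) * Num.min 1 (Dn n x))%:E).
  apply/measurable_EFinP; apply: measurable_funM; last exact: measurable_minr.
  by apply: measurable_funM => //; exact: measurableT_comp.
have mD1 n : measurable_fun setT (fun x => (Dn n x * \1_A (iter n T x))%:E).
  by apply/measurable_EFinP; apply: measurable_funM => //; exact: measurableT_comp.
have mA1 : measurable_fun setT (fun x => (\1_A x)%:E : \bar R).
  by apply/measurable_EFinP.
have muA : mu A = (fine (mu A))%:E by rewrite fineK// ge0_fin_numE.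
set M := fine (mu A) in muA.
have M0 : 0 <= M by rewrite fine_ge0.
(* [sqrt c <= e (1 + c) + min(1, c) / e] *)
have bound (e : R) n : 0 < e ->
    (koopman_correlation n \1_A \1_A <= (e * (M + M))%:E + (e^-1)%:E * J n)%E.
  move=> e0.
  have DA : (\int[mu]_x (Dn n x * \1_A (iter n T x))%:E = mu A)%E.
    rewrite (rn_cocycle_change_of_variables alpha0 hT hD n (g := \1_A))//.
    by rewrite integral_indic// setIT.
  have AA : (\int[mu]_x (\1_A x)%:E = mu A)%E by rewrite integral_indic// setIT.
  rewrite EFinM EFinD -muA -{1}AA -DA -ge0_integralD//; last first.
    by move=> x _; rewrite lee_fin mulr_ge0// ltW.
  have i0 : 0 <= e^-1 by rewrite invr_ge0 ltW.
  rewrite /J -!ge0_integralZl//; first last.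
  - by rewrite lee_fin ltW.
  - by move=> x _; rewrite -EFinD lee_fin addr_ge0// mulr_ge0// ltW.
  - exact: emeasurable_funD.
  - exact: pM.
  rewrite -ge0_integralD//; first last.
  - exact: measurable_funeM.
  - by move=> x xT; rewrite mule_ge0// pM.
  - by apply: measurable_funeM; exact: emeasurable_funD.
  - move=> x _; rewrite -EFinD -EFinM lee_fin; apply: mulr_ge0; first exact: ltW.
    by rewrite addr_ge0// mulr_ge0// ltW.
  apply: ge0_le_integral => //.
  - by move=> x _; rewrite lee_fin !mulr_ge0.
  - apply/measurable_EFinP; do 2 apply: measurable_funM => //.
    exact: measurableT_comp.
  - apply: emeasurable_funD; apply: measurable_funeM => //.
    exact: emeasurable_funD.
  - move=> x _ /=; rewrite -!EFinD lee_fin /sDn.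
    have := Dn0 n x; move: (Dn n x) => c c0.
    have ic b : (0 : R) <= b -> 0 <= e^-1 * b by move=> b0; rewrite mulr_ge0.
    rewrite !indicE; case: (x \in A) => /=; last first.
      rewrite !mul0r mulr0 addr0 add0r.
      by rewrite mulr_ge0 ?mulr_ge0// ltW.
    case: (_ \in A) => /=; last first.
      by rewrite !mulr0 mul0r mulr0 !addr0 mulr1 ltW.
    rewrite !mulr1 !mul1r.
    (* For [c >= 1], the square of [sqrt c - 1 / e] gives [2 sqrt c <= e c + 1 / e]; for [c < 1],
       the square of [e - sqrt c] gives [2 sqrt c <= e + c / e]. *)
    have [c1|c1] := leP 1 c.
      rewrite mulr1.
      have : 0 <= e * (Num.sqrt c - e^-1) ^+ 2 by rewrite mulr_ge0 ?sqr_ge0// (ltW e0).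
      rewrite sqrrB sqr_sqrtr ?(ltW c0)// => h.
      have : e * (c - Num.sqrt c * e^-1 *+ 2 + e^-1 ^+ 2) =
             e * c - Num.sqrt c *+ 2 + e^-1 by field; rewrite gt_eqF.
      move=> h'; rewrite h' in h.
      have := sqrtr_ge0 c; nra.
    have : 0 <= e^-1 * (e - Num.sqrt c) ^+ 2 by rewrite mulr_ge0 ?sqr_ge0.
    rewrite sqrrB sqr_sqrtr ?(ltW c0)// => h.
    have : e^-1 * (e ^+ 2 - e * Num.sqrt c *+ 2 + c) =
             e - Num.sqrt c *+ 2 + e^-1 * c by field; rewrite gt_eqF.
    move=> h'; rewrite h' in h.
    have := sqrtr_ge0 c; nra.
apply/ge0_cvge0P; first by move=> n; apply: correlation_ge0.
move=> e e0.
(* The uniform part [del * (M + M)] takes [e / 2]; [J n <= del * (e / 2)] leaves [e / 2] for the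
   other part. *)
pose del := e / (4 * (M + 1)).
have M1 : 0 < M + 1 by rewrite ltr_wpDl.
have del0 : 0 < del by rewrite divr_gt0// mulr_gt0.
have delM : del * (M + M) <= e / 2.
  have -> : del * (M + M) = e / 2 * (M / (M + 1)).
    by rewrite /del; field; rewrite gt_eqF.
  apply: ler_piMr; first by rewrite divr_ge0// ltW.
  by rewrite ler_pdivrMr// mul1r lerDl.
have := (ge0_cvge0P J0).1 Jc (del * (e / 2)) _.
case; first by rewrite mulr_gt0// divr_gt0.
move=> N _ hN; exists N => // n Nn.
apply: (le_trans (bound del n del0)).
rewrite [leRHS](_ : _ = (e / 2)%:E + (e / 2)%:E)%E; last first.
  by rewrite -EFinD -splitr.
apply: leeD; first by rewrite lee_fin.
apply: (@le_trans _ _ ((del^-1)%:E * (del * (e / 2))%:E)%E).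
  by apply: lee_wpmul2l; [rewrite lee_fin invr_ge0 ltW|exact: hN].
by rewrite -EFinM mulKf ?gt_eqF.
Qed.

Lemma koopman_iterE n (f : X -> R[i]) x :
  iter n (koopman T D) f x = ((sDn n x)%:C)%C * f (iter n T x).
Proof.
elim: n x => [|n IH] x.
  by rewrite /sDn /rn_cocycle/= big_ord0 sqrtr1 mul1r.
rewrite iterS {1}/koopman IH -iterSr mulrA -rmorphM/= /sDn (rn_cocycleS T D).
by rewrite sqrtrM// ltW//; case: hD.
Qed.

(** * Complex square integrable functions *)

Definition koopman_mixing := forall f : X -> R[i], complex_L2 mu f ->
  (fun n : nat => L2_inner mu (iter n (koopman T D) f) f : R[i]^o) @ \oo
      --> (0 : R[i]^o).

(** The modulus of [U_T^n f] is [U_T^n |f|], so the integrand is bounded by that of the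
    self-correlation of [|f|]; the real and imaginary parts take [e / 2] each. *)
Lemma koopman_mixing_of_zero_type : koopman_zero_type -> koopman_mixing.
Proof.
move=> kz f [mRe mIm f2].
pose h x := Normc.normc (f x).
have h0 x : 0 <= h x by rewrite /h; case: (f x) => a b /=; exact: sqrtr_ge0.
have mh : measurable_fun setT h.
  rewrite [h](_ : _ = fun x => Num.sqrt (complex.Re (f x) ^+ 2 + complex.Im (f x) ^+ 2)).
    apply: measurableT_comp; first exact: measurable_sqrtr.
    by apply: measurable_funD; apply: measurable_funX.
  by apply/funext => x; rewrite /h; case: (f x).
have hc := koopman_zero_typeW kz mh h0 f2.
apply/complex_cvg0P => e e0.
have := (ge0_cvge0P _).1 hc (e / 2) (divr_gt0 e0 (ltr0n _ 2)).
case; first by move=> n; apply: correlation_ge0.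
move=> N _ hN; exists N => // n Nn.
have {hN Nn} hn := hN n Nn.
apply: le_trans (normc_le_ReIm _) _; rewrite [leRHS]splitr.
pose G x := h x * (sDn n x * h (iter n T x)).
have mG : measurable_fun setT G.
  do 2 apply: measurable_funM => //; exact: measurableT_comp.
have GE x : Normc.normc (iter n (koopman T D) f x * ((f x)^*)%C) = G x.
  rewrite Normc.normcM normcJ koopman_iterE Normc.normcM /G mulrC /=.
  by rewrite expr0n/= addr0 sqrtr_sqr ger0_norm.
have mRe' : measurable_fun setT (fun x => complex.Re (f (iter n T x))).
  exact: (measurableT_comp mRe).
have mIm' : measurable_fun setT (fun x => complex.Im (f (iter n T x))).
  exact: (measurableT_comp mIm).
apply: lerD; apply: Rintegral_le_bound hn => //.
- rewrite [X in measurable_fun _ X](_ : _ = fun x =>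
    sDn n x * (complex.Re (f (iter n T x)) * complex.Re (f x) +
               complex.Im (f (iter n T x)) * complex.Im (f x))).
    by apply: measurable_funM => //; apply: measurable_funD; apply: measurable_funM.
  apply/funext => x; rewrite koopman_iterE.
  by case: (f x) (f (iter n T x)) => a b [a' b'] /=; ring.
- by move=> x; rewrite -/(G x) -GE normc_Re.
- rewrite [X in measurable_fun _ X](_ : _ = fun x =>
    sDn n x * (complex.Im (f (iter n T x)) * complex.Re (f x) -
               complex.Re (f (iter n T x)) * complex.Im (f x))).
    by apply: measurable_funM => //; apply: measurable_funB; apply: measurable_funM.
  apply/funext => x; rewrite koopman_iterE.
  by case: (f x) (f (iter n T x)) => a b [a' b'] /=; ring.
- by move=> x; rewrite -/(G x) -GE normc_Im.
Qed.

Lemma koopman_zero_type_of_mixing : koopman_mixing -> koopman_zero_type.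
Proof.
move=> km A mA Aoo.
pose f (x : X) : R[i] := ((\1_A x)%:C)%C.
have fL2 : complex_L2 mu f.
  split; [exact: (measurable_indic mA)|exact: measurable_cst|].
  under eq_integral => x _.
    rewrite [X in X%:E](_ : _ = \1_A x); last first.
      by rewrite /f/= expr0n addr0 sqrtr_sqr indicE; case: (_ \in _); rewrite /= ?normr1 ?normr0 ?expr1n ?expr0n.
    over.
  by rewrite integral_indic// setIT.
have /complex_cvg0P kc := km f fL2.
have c0 n : (0 <= koopman_correlation n \1_A \1_A)%E by apply: correlation_ge0.
(* [Rintegral] sends an infinite integral to 0, so finiteness is needed before the limit of the
   inner products says anything about the correlations. *)
have fin n : koopman_correlation n \1_A \1_A \is a fin_num.
  rewrite ge0_fin_numE//.
  apply: le_lt_trans (@correlation_AMGM _ _ _ mu sDn _ msDn sDn0 mTn koopman_contr n _ _ 1 ltr01 _ _ _ _) _ => //.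
  rewrite invr1 !mul1e.
  under eq_integral => x _.
    rewrite [X in X%:E](_ : _ = \1_A x); last first.
      by rewrite indicE; case: (_ \in _); rewrite /= ?expr1n ?expr0n.
    over.
  by rewrite integral_indic// setIT lte_add_pinfty.
apply/ge0_cvge0P => // e e0.
have := kc e e0; apply: filterS => n.
move=> /(le_trans (normc_Re _)) /(le_trans (ler_norm _)).
rewrite -lee_fin; apply: le_trans.
rewrite /L2_inner /cintegral/= /Rintegral.
rewrite [X in fine X](_ : _ = koopman_correlation n \1_A \1_A) ?fineK//.
apply: eq_integral => x _; rewrite koopman_iterE /f /=; congr EFin; ring.
Qed.

End koopman_and_maharam.

(** * Trigonometric bounds and linear functionals *)

Section trigonometric_bounds.
Context {R : realType}.
Implicit Types x y : R.

Lemma normr_sin_le x : `|sin x| <= `|x|.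
Proof.
wlog x0 : x / 0 <= x.
  move=> h; have [/h//|x0] := leP 0 x.
  by rewrite -normrN -sinN -[leRHS]normrN h// oppr_ge0 ltW.
have [|c _] := @MVT_segment R sin cos 0 x x0 (fun y _ => is_derive_sin y).
  by apply: continuous_subspaceT; exact: continuous_sin.
rewrite sin0 !subr0 => ->; rewrite normrM.
by apply: ler_piMl => //; exact: cos_max.
Qed.

Lemma onem_cosE x : 1 - cos x = 2 * sin (x / 2) ^+ 2.
Proof.
have := cosD (x / 2) (x / 2); rewrite -splitr => ->.
have := cos2Dsin2 (x / 2); lra.
Qed.

Lemma onem_cos_le_norm x : 1 - cos x <= `|x|.
Proof.
rewrite onem_cosE -(real_normK (num_real (sin _))).
have := normr_sin_le (x / 2); rewrite normrM [`|2^-1|]ger0_norm//.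
have := sin_max (x / 2); have := normr_ge0 (sin (x / 2)); nra.
Qed.

Lemma onem_cos_le_sqr x : 1 - cos x <= x ^+ 2.
Proof.
rewrite onem_cosE -(real_normK (num_real (sin _))) -(real_normK (num_real x)).
have := normr_sin_le (x / 2); rewrite normrM [`|2^-1|]ger0_norm//.
have := normr_ge0 (sin (x / 2)); nra.
Qed.

(** The exponent 2 is the one matched by the integrability of [Num.min (x k ^+ 2) 1] under the Lévy
    measure. *)
Lemma normr_sinB_le x : `|sin x - x| <= x ^+ 2.
Proof.
wlog x0 : x / 0 <= x.
  move=> h; have [/h//|x0] := leP 0 x.
  by have := h (- x); rewrite sinN sqrrN -opprD normrN; apply; rewrite oppr_ge0 ltW.
have df y : y \in `]0, x[%R -> is_derive y 1 (fun y : R => sin y - y) (cos y - 1).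
  by move=> _; exact: is_deriveB.
have [|c] := MVT_segment x0 df.
  apply: continuous_subspaceT => y; apply: continuousB => //.
  exact: continuous_sin.
rewrite in_itv/= => /andP[c0 cx].
rewrite sin0 !subr0 => ->; rewrite normrM (ger0_norm x0) expr2.
rewrite ler_wpM2r// distrC ger0_norm ?subr_ge0 ?cos_le1//.
by apply: le_trans (onem_cos_le_norm _) _; rewrite ger0_norm.
Qed.

(** Since [|exp(ix) - 1|^2 = 2 (1 - cos x)], this is [|p + q|^2 <= 2 |p|^2 + 2 |q|^2] with
    [p = exp(ix) (exp(iy) - 1)] and [q = exp(ix) - 1]; the square expanded below is [|p - q|^2]. *)
Lemma onem_cosD_le x y : 1 - cos (x + y) <= 2 * (1 - cos x) + 2 * (1 - cos y).
Proof.
rewrite cosD.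
have := cos2Dsin2 x; have := cos2Dsin2 y.
move: (cos x) (sin x) (cos y) (sin y) => a b c e h1 h2.
have : 0 <= (a * c - b * e - 2 * a + 1) ^+ 2 + (a * e + b * c - 2 * b) ^+ 2.
  by rewrite addr_ge0// sqr_ge0.
have -> : (a * c - b * e - 2 * a + 1) ^+ 2 + (a * e + b * c - 2 * b) ^+ 2 =
   (a ^+ 2 + b ^+ 2) * (c ^+ 2 + e ^+ 2) + 4 * (a ^+ 2 + b ^+ 2) + 1
   - 4 * c * (a ^+ 2 + b ^+ 2) + 2 * (a * c - b * e) - 4 * a by ring.
rewrite h1 h2; lra.
Qed.

(** The left side is the imaginary part of [(exp(ix) - 1) (exp(iy) - 1)]: the failure of additivity
    of the sine is of second order. *)
Lemma normr_trig_cross x y :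
  `|sin (x + y) - sin x - sin y| <= (1 - cos x) + (1 - cos y).
Proof.
have -> : sin (x + y) - sin x - sin y = - (sin x * (1 - cos y) + sin y * (1 - cos x)).
  by rewrite sinD; ring.
rewrite normrN (le_trans (ler_normD _ _))// addrC !normrM.
by apply: lerD; rewrite [X in _ * X]ger0_norm ?subr_ge0 ?cos_le1//;
   apply: ler_piMl; rewrite ?subr_ge0 ?cos_le1// sin_max.
Qed.

End trigonometric_bounds.

Section linear_functionals.
Context {R : realType}.
Implicit Types (l : seq (int * R)) (x : RZ R).

(* A finitely supported linear form is a list of pairs (index, coefficient) with
   repetitions allowed, so that addition of forms is concatenation. *)
Definition lin l x : R := \sum_(p <- l) p.2 * x p.1.
Definition lin_truncation l x : R := \sum_(p <- l) p.2 * truncation (x p.1).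
Definition translate (n : nat) l : seq (int * R) := [seq (p.1 + n%:Z, p.2) | p <- l].
Definition opposite l : seq (int * R) := [seq (p.1, - p.2) | p <- l].

Lemma iter_shiftE n x (k : int) : (iter n (@Defs.shift R) x : int -> R) k = x (k + n%:Z).
Proof.
elim: n k => [|n IH] k; first by rewrite addr0.
rewrite iterS /Defs.shift IH.
by have -> : k + n.+1%:Z = k + 1 + n%:Z by lia.
Qed.

Lemma lin_cat l1 l2 x : lin (l1 ++ l2) x = lin l1 x + lin l2 x.
Proof. by rewrite /lin big_cat. Qed.

Lemma lin_truncation_cat l1 l2 x :
  lin_truncation (l1 ++ l2) x = lin_truncation l1 x + lin_truncation l2 x.
Proof. by rewrite /lin_truncation big_cat. Qed.

Lemma lin_translate n l x : lin (translate n l) x = lin l (iter n (@Defs.shift R) x).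
Proof. by rewrite /lin big_map; apply: eq_bigr => p _; rewrite iter_shiftE. Qed.

Lemma lin_truncation_translate n l x :
  lin_truncation (translate n l) x = lin_truncation l (iter n (@Defs.shift R) x).
Proof.
by rewrite /lin_truncation big_map; apply: eq_bigr => p _; rewrite iter_shiftE.
Qed.

Lemma lin_opposite l x : lin (opposite l) x = - lin l x.
Proof. by rewrite /lin big_map -sumrN; apply: eq_bigr => p _; rewrite mulNr. Qed.

Lemma lin_truncation_opposite l x :
  lin_truncation (opposite l) x = - lin_truncation l x.
Proof.
by rewrite /lin_truncation big_map -sumrN; apply: eq_bigr => p _; rewrite mulNr.
Qed.

(** Coefficients of equal indices are added up, and the sum of all [|p.1|] is a crude bound for the
    indices. The coefficients [a] are fixed before [F], so that they serve both the linear form and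
    its truncation. *)
Lemma lin_zsum l : exists (N : nat) (a : int -> R), forall F : int -> R,
  \sum_(p <- l) p.2 * F p.1 = zsum (- N%:Z) N%:Z (fun k => a k * F k).
Proof.
pose N := (\sum_(p <- l) `|p.1|)%N.
exists N, (fun k => \sum_(p <- l | p.1 == k) p.2) => F.
rewrite /zsum.
under [RHS]eq_bigr do rewrite big_distrl/= big_mkcond/=.
rewrite exchange_big/= [LHS]big_seq [RHS]big_seq; apply: eq_bigr => p pl.
have pN : (`|p.1| <= N)%N.
  by rewrite /N (big_rem p)//= leq_addr.
pose k : int := p.1; pose j0 := absz (k + N%:Z).
have jN : (j0 < (absz (N%:Z - - N%:Z)).+1)%N by rewrite -/k in pN; rewrite /j0; lia.
rewrite (bigD1 (Ordinal jN))//= big1 ?addr0.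
  have -> : - N%:Z + j0%:Z = k by rewrite -/k in pN; rewrite /j0; lia.
  by rewrite eqxx.
move=> j /eqP jne; case: eqP => // pj; exfalso; apply: jne.
by apply: val_inj => /=; rewrite /j0 /k pj; lia.
Qed.

Lemma measurable_coordinate (k : int) :
  measurable_fun setT (fun x : RZ R => x k).
Proof.
move=> _ B mB; rewrite setTI; apply: sub_sigma_algebra; exists k, B; split => //.
Qed.

Lemma measurable_lin l : measurable_fun setT (lin l).
Proof.
apply: measurable_sum => p; apply: measurable_funM => //.
exact: measurable_coordinate.
Qed.

Lemma truncationE (y : R) : truncation y = Num.max (-1) (Num.min y 1).
Proof.
rewrite /truncation; have [h1|h1] := ltP y (-1).
  have y1 : y <= 1 by lra.
  by rewrite (min_l y1) max_l// ltW.
have [h2|h2] := leP y 1; first by rewrite max_r.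
by rewrite max_r//; lra.
Qed.

Lemma measurable_truncation : measurable_fun setT (@truncation R).
Proof.
rewrite (_ : truncation = fun y : R => Num.max (-1) (Num.min y 1)).
  by apply: measurable_maxr => //; exact: measurable_minr.
by apply/funext => y; rewrite truncationE.
Qed.

Lemma measurable_lin_truncation l : measurable_fun setT (lin_truncation l).
Proof.
apply: measurable_sum => p; apply: measurable_funM => //.
exact: (measurableT_comp measurable_truncation (measurable_coordinate _)).
Qed.

Lemma measurable_shift : measurable_fun setT (@Defs.shift R).
Proof.
apply: (@measurability _ _ _ _ setT (@Defs.shift R) (@cylinders R)) => //.
move=> _ [_ [n [B [mB ->]]] <-]; rewrite setTI.
by apply: sub_sigma_algebra; exists (n + 1), B.
Qed.

End linear_functionals.

Lemma measurable_sin {R : realType} : measurable_fun setT (@sin R).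
Proof. by apply: continuous_measurable_fun; exact: continuous_sin. Qed.

Lemma measurable_cos {R : realType} : measurable_fun setT (@cos R).
Proof. by apply: continuous_measurable_fun; exact: continuous_cos. Qed.

(** * The Lévy exponent *)

Lemma le_integrable_EFin {d} {X : measurableType d} {R : realType}
    (m : {measure set X -> \bar R}) (f g : X -> R) :
  measurable_fun setT f -> (forall x, `|f x| <= g x) ->
  m.-integrable setT (EFin \o g) -> m.-integrable setT (EFin \o f).
Proof.
move=> mf fg ig; apply: (le_integrable measurableT _ _ ig).
  exact/measurable_EFinP.
by move=> x _ /=; rewrite lee_fin (le_trans (fg x))// ler_norm.
Qed.

Lemma Rintegral_preserving {d d'} {X : measurableType d}
    {Y : measurableType d'} {R : realType}
    (m : {measure set X -> \bar R}) (k : {measure set Y -> \bar R})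
    (f : X -> Y) : measurable_fun setT f ->
  (forall E, measurable E -> m (f @^-1` E) = k E) ->
  forall F : Y -> R, measurable_fun setT F ->
  Rintegral m setT (fun x => F (f x)) = Rintegral k setT F.
Proof.
move=> mf mk F mF; congr fine; rewrite integralE [RHS]integralE.
have mE : measurable_fun setT (EFin \o F) by exact/measurable_EFinP.
rewrite -(ge0_integral_preserving mf mk (measurable_funepos mE) (funepos_ge0 _)).
rewrite -(ge0_integral_preserving mf mk (measurable_funeneg mE) (funeneg_ge0 _)).
rewrite -[fun x => (F (f x))%:E]/((EFin \o F) \o f).
by rewrite funepos_comp funeneg_comp.
Qed.

Section levy_exponent.
Context {R : realType}.
Variables (P : probability (RZ R) R) (Q : {measure set (RZ R) -> \bar R}).
Hypothesis hPQ : levy_measure P Q.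
Local Notation S := (@Defs.shift R).
Implicit Types l : seq (int * R).

Lemma levy_iter_preserving n (E : set (RZ R)) : measurable E ->
  Q (iter n S @^-1` E) = Q E.
Proof.
by apply: iter_preserving; [exact: measurable_shift|case: hPQ].
Qed.

Let mS n : measurable_fun setT (iter n S).
Proof. by apply: measurable_iter; exact: measurable_shift. Qed.

Lemma levy_integrable_min (k : int) :
  Q.-integrable setT (fun x : RZ R => (Num.min (x k ^+ 2) 1)%:E).
Proof.
have mk (j : int) : measurable_fun setT (fun x : RZ R => (Num.min (x j ^+ 2) 1)%:E).
  apply/measurable_EFinP; apply: measurable_minr => //.
  by apply: measurable_funX; exact: measurable_coordinate.
have k0 (j : int) (x : RZ R) : (0 <= (Num.min (x j ^+ 2) 1)%:E)%E.
  by rewrite lee_fin le_min sqr_ge0 ler01.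
apply/integrableP; split => //.
under eq_integral do rewrite gee0_abs//.
case: hPQ => _ _ _ h0 _.
case: k => n.
  rewrite -(ge0_integral_preserving (mS n) (levy_iter_preserving n) (mk 0) (k0 0)) in h0.
  apply: le_lt_trans h0; rewrite le_eqVlt; apply/orP; left; apply/eqP.
  by apply: eq_integral => x _; rewrite iter_shiftE add0r.
(* For a negative index the invariance is used the other way round: [n.+1] shifts bring the
   coordinate [Negz n] to the coordinate 0. *)
rewrite -(ge0_integral_preserving (mS n.+1) (levy_iter_preserving n.+1) (mk (Negz n)) (k0 _)).
apply: le_lt_trans h0; rewrite le_eqVlt; apply/orP; left; apply/eqP.
apply: eq_integral => x _; rewrite iter_shiftE.
by have -> : Negz n + n.+1%:Z = 0 by lia.
Qed.

(** With [sin_compensated], the Lévy integrand in real terms: its real part is [- onem_cos l] and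
    its imaginary part is [sin_compensated l]. *)
Definition onem_cos l (x : RZ R) : R := 1 - cos (lin l x).
Definition sin_compensated l (x : RZ R) : R := sin (lin l x) - lin_truncation l x.

Lemma onem_cos_ge0 l x : 0 <= onem_cos l x.
Proof. by rewrite subr_ge0 cos_le1. Qed.

Lemma onem_cos_le2 l x : onem_cos l x <= 2.
Proof. by rewrite /onem_cos; have := cos_geN1 (lin l x); lra. Qed.

Lemma measurable_cos_lin l : measurable_fun setT (fun x => cos (lin l x)).
Proof. exact: (measurableT_comp measurable_cos (measurable_lin l)). Qed.

Lemma measurable_sin_lin l : measurable_fun setT (fun x => sin (lin l x)).
Proof. exact: (measurableT_comp measurable_sin (measurable_lin l)). Qed.

Lemma measurable_onem_cos l : measurable_fun setT (onem_cos l).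
Proof. by apply: measurable_funB => //; exact: measurable_cos_lin. Qed.

Lemma measurable_sin_compensated l : measurable_fun setT (sin_compensated l).
Proof.
apply: measurable_funB; first exact: measurable_sin_lin.
exact: measurable_lin_truncation.
Qed.

Lemma lin1 (p : int * R) (x : RZ R) : lin [:: p] x = p.2 * x p.1.
Proof. by rewrite /lin big_seq1. Qed.

Lemma lin_truncation1 (p : int * R) (x : RZ R) :
  lin_truncation [:: p] x = p.2 * truncation (x p.1).
Proof. by rewrite /lin_truncation big_seq1. Qed.

Lemma lin_cons p l (x : RZ R) : lin (p :: l) x = lin [:: p] x + lin l x.
Proof. by rewrite -cat1s lin_cat. Qed.

Lemma lin_truncation_cons p l (x : RZ R) :
  lin_truncation (p :: l) x = lin_truncation [:: p] x + lin_truncation l x.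
Proof. by rewrite -cat1s lin_truncation_cat. Qed.

Lemma onem_cos1_le p (x : RZ R) :
  onem_cos [:: p] x <= (2 + p.2 ^+ 2) * Num.min (x p.1 ^+ 2) 1.
Proof.
have [h|h] := leP (x p.1 ^+ 2) 1.
  rewrite /onem_cos lin1; apply: (le_trans (onem_cos_le_sqr _)).
  by rewrite exprMn ler_wpM2r ?sqr_ge0// lerDr.
rewrite mulr1; apply: (le_trans (onem_cos_le2 _ _)).
by rewrite lerDl sqr_ge0.
Qed.

Lemma sin_compensated1_le p (x : RZ R) :
  `|sin_compensated [:: p] x| <=
    (1 + `|p.2| + p.2 ^+ 2) * Num.min (x p.1 ^+ 2) 1.
Proof.
rewrite /sin_compensated lin1 lin_truncation1; case: p => k a /=.
move: (x k) => {x} y; have a0 := normr_ge0 a; have a2 := sqr_ge0 a.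
have [h|h] := leP (y ^+ 2) 1.
  have -> : truncation y = y.
    have : -1 <= y <= 1.
      by rewrite -ler_norml -(@ler_pXn2r _ 2)// ?nnegrE// real_normK ?num_real// expr1n.
    move=> /andP[y1 y2]; rewrite truncationE (min_l y2) max_r//.
  apply: (le_trans (normr_sinB_le _)).
  rewrite exprMn ler_wpM2r ?sqr_ge0//; lra.
rewrite mulr1; apply: (le_trans (ler_normB _ _)).
have t1 : `|truncation y| <= 1.
  by rewrite truncationE ler_norml le_max lexx/= ge_max ge_min lexx orbT andbT; lra.
rewrite normrM; have := sin_max (a * y); have := ler_wpM2l a0 t1; lra.
Qed.

Lemma integrable_onem_cos l : Q.-integrable setT (EFin \o onem_cos l).
Proof.
elim: l => [|p l IH].
  rewrite (_ : EFin \o _ = cst 0%E); first exact: integrable0.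
  by apply/funext => x; rewrite /= /onem_cos /lin big_nil cos0 subrr.
have ip : Q.-integrable setT (EFin \o onem_cos [:: p]).
  apply: (@le_integrable_EFin _ _ _ _ _ (fun x : RZ R => (2 + p.2 ^+ 2) * Num.min (x p.1 ^+ 2) 1)).
  - exact: measurable_onem_cos.
  - by move=> x; rewrite ger0_norm ?onem_cos_ge0// onem_cos1_le.
  - rewrite (_ : EFin \o _ = fun x : RZ R => ((2 + p.2 ^+ 2)%:E * (Num.min (x p.1 ^+ 2) 1)%:E)%E)//.
    by apply: integrableZl => //; exact: levy_integrable_min.
apply: (@le_integrable_EFin _ _ _ _ _ (fun x : RZ R => 2 * onem_cos [:: p] x + 2 * onem_cos l x)).
- exact: measurable_onem_cos.
- move=> x; rewrite ger0_norm ?onem_cos_ge0// /onem_cos lin_cons.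
  exact: onem_cosD_le.
- rewrite (_ : EFin \o _ = (fun x => 2%:E * (onem_cos [:: p] x)%:E) \+ (fun x => 2%:E * (onem_cos l x)%:E))%E//.
  by apply: integrableD => //; apply: integrableZl.
Qed.

(** By induction on the form: the truncations add up exactly, and what the sine lacks in additivity
    is bounded by terms [1 - cos], already known to be integrable. *)
Lemma integrable_sin_compensated l : Q.-integrable setT (EFin \o sin_compensated l).
Proof.
elim: l => [|p l IH].
  rewrite (_ : EFin \o _ = cst 0%E); first exact: integrable0.
  by apply/funext => x; rewrite /= /sin_compensated /lin /lin_truncation !big_nil sin0 subrr.
have ip : Q.-integrable setT (EFin \o sin_compensated [:: p]).
  apply: (@le_integrable_EFin _ _ _ _ _ (fun x : RZ R => (1 + `|p.2| + p.2 ^+ 2) * Num.min (x p.1 ^+ 2) 1)).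
  - exact: measurable_sin_compensated.
  - exact: sin_compensated1_le.
  - rewrite (_ : EFin \o _ = fun x : RZ R => ((1 + `|p.2| + p.2 ^+ 2)%:E * (Num.min (x p.1 ^+ 2) 1)%:E)%E)//.
    by apply: integrableZl => //; exact: levy_integrable_min.
apply: (@le_integrable_EFin _ _ _ _ _ (fun x : RZ R => (`|sin_compensated [:: p] x| + `|sin_compensated l x|) +
   (onem_cos [:: p] x + onem_cos l x))).
- exact: measurable_sin_compensated.
- move=> x; rewrite [sin_compensated (p :: l) x](_ : _ = (sin_compensated [:: p] x + sin_compensated l x) +
     (sin (lin (p :: l) x) - sin (lin [:: p] x) - sin (lin l x))); last first.
    by rewrite /sin_compensated lin_truncation_cons; ring.
  apply: (le_trans (ler_normD _ _)); apply: lerD; first exact: ler_normD.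
  by rewrite lin_cons; exact: normr_trig_cross.
- rewrite (_ : EFin \o _ = ((fun x => (`|sin_compensated [:: p] x|)%:E) \+ (fun x => (`|sin_compensated l x|)%:E)) \+
    ((fun x => (onem_cos [:: p] x)%:E) \+ (fun x => (onem_cos l x)%:E)))%E//.
  by apply: integrableD => //; apply: integrableD => //;
    solve [exact: integrable_norm|exact: integrable_onem_cos].
Qed.

Definition levy_exponent_re l : R := Rintegral Q setT (fun x => - onem_cos l x).
Definition levy_exponent_im l : R := Rintegral Q setT (sin_compensated l).

(** The Lévy-Khintchine formula in polar form: the characteristic function has modulus
    [expR (levy_exponent_re l)] and argument [levy_exponent_im l]. *)
Lemma levy_formula l :
  Rintegral P setT (fun x => cos (lin l x)) = expR (levy_exponent_re l) * cos (levy_exponent_im l) /\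
  Rintegral P setT (fun x => sin (lin l x)) = expR (levy_exponent_re l) * sin (levy_exponent_im l).
Proof.
have [N [a lE]] := lin_zsum l.
have N0 : - N%:Z <= N%:Z by rewrite (@le_trans _ _ 0)// oppr_le0.
case: hPQ => _ _ _ _ h; have {h} := h _ _ a N0; cbv zeta.
have cE (c : R) : cexp ('i%C * (c%:C)%C) = (cos c +i* sin c)%C.
  by rewrite /cexp /= !mul0r mulr0 !mul1r subr0 add0r expR0 !mul1r.
have -> : (fun x : RZ R => cexp ('i%C * ((zsum (- N%:Z) N%:Z (fun k => a k * x k))%:C)%C)) =
          (fun x => (cos (lin l x) +i* sin (lin l x))%C).
  by apply/funext => x; rewrite cE -lE.
have -> : (fun x : RZ R => cexp ('i%C * ((zsum (- N%:Z) N%:Z (fun k => a k * x k))%:C)%C) - 1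
     - 'i%C * ((zsum (- N%:Z) N%:Z (fun k => a k * truncation (x k)))%:C)%C) =
     (fun x => ((- onem_cos l x) +i* sin_compensated l x)%C).
  apply/funext => x; rewrite cE -lE -(lE (fun k => truncation (x k))).
  rewrite -/(lin l x) -/(lin_truncation l x) /onem_cos /sin_compensated.
  by apply/eqP; rewrite eq_complex /=; apply/andP; split; apply/eqP; ring.
by rewrite /cintegral /= => -[].
Qed.

End levy_exponent.

(** * Mixing for bounded functions *)

Section bounded_functions.
Context {d} {X : measurableType d} {R : realType}.
Variable P : probability X R.
Implicit Types (f g : X -> R).

Let PT : (P : {measure set X -> \bar R}) setT = 1%E.
Proof. by have := @probability_setT _ X R P. Qed.

Definition bounded_measurable f :=
  measurable_fun setT f /\ exists M : R, forall x, `|f x| <= M.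

Local Notation E f := (Rintegral P setT f).

Lemma bounded_measurable_cst (c : R) : bounded_measurable (cst c).
Proof. by split => //; exists `|c|. Qed.

Lemma bounded_measurable_indic (A : set X) : measurable A ->
  bounded_measurable \1_A.
Proof.
move=> mA; split => //; exists 1 => x.
by rewrite indicE; case: (_ \in _); rewrite ?normr1 ?normr0.
Qed.

Lemma bounded_measurableD f g : bounded_measurable f -> bounded_measurable g ->
  bounded_measurable (fun x => f x + g x).
Proof.
move=> [mf [M fM]] [mg [N gN]]; split; first exact: measurable_funD.
by exists (M + N) => x; rewrite (le_trans (ler_normD _ _))// lerD.
Qed.

Lemma bounded_measurableM f g : bounded_measurable f -> bounded_measurable g ->
  bounded_measurable (fun x => f x * g x).
Proof.
move=> [mf [M fM]] [mg [N gN]]; split; first exact: measurable_funM.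
by exists (M * N) => x; rewrite normrM ler_pM.
Qed.

Lemma bounded_measurableZ (c : R) f : bounded_measurable f ->
  bounded_measurable (fun x => c * f x).
Proof. exact: (bounded_measurableM (bounded_measurable_cst c)). Qed.

Lemma bounded_measurableN f : bounded_measurable f ->
  bounded_measurable (fun x => - f x).
Proof.
move=> [mf [M fM]]; split; first exact: measurableT_comp.
by exists M => x; rewrite normrN.
Qed.

Lemma bounded_measurableB f g : bounded_measurable f -> bounded_measurable g ->
  bounded_measurable (fun x => f x - g x).
Proof.
by move=> bf bg; apply: bounded_measurableD => //; exact: bounded_measurableN.
Qed.

Lemma bounded_measurable_norm f : bounded_measurable f ->
  bounded_measurable (fun x => `|f x|).
Proof.
move=> [mf [M fM]]; split; first exact: measurableT_comp.
by exists M => x; rewrite normr_id.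
Qed.

Lemma bounded_measurable_comp (tau : X -> X) f : measurable_fun setT tau ->
  bounded_measurable f -> bounded_measurable (fun x => f (tau x)).
Proof.
move=> mt [mf [M fM]]; split; first exact: measurableT_comp.
by exists M.
Qed.

Lemma bounded_measurable_integrable f : bounded_measurable f ->
  P.-integrable setT (EFin \o f).
Proof.
move=> [mf [M fM]]; apply: (@le_integrable_EFin _ _ _ P f (cst M)) => //.
apply/integrableP; split; first by apply/measurable_EFinP.
rewrite (_ : (fun x => _) = cst `|M|%:E)//.
by rewrite integral_cst//= PT mule1 ltry.
Qed.

Lemma bounded_RintegralD f g : bounded_measurable f -> bounded_measurable g ->
  E (fun x => f x + g x) = E f + E g.
Proof. by move=> bf bg; rewrite RintegralD//; exact: bounded_measurable_integrable. Qed.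

Lemma bounded_RintegralB f g : bounded_measurable f -> bounded_measurable g ->
  E (fun x => f x - g x) = E f - E g.
Proof. by move=> bf bg; rewrite RintegralB//; exact: bounded_measurable_integrable. Qed.

Lemma bounded_RintegralZ (c : R) f : bounded_measurable f ->
  E (fun x => c * f x) = c * E f.
Proof. by move=> bf; rewrite RintegralZl//; exact: bounded_measurable_integrable. Qed.

Lemma Rintegral_probability_cst (c : R) : E (cst c) = c.
Proof. by rewrite Rintegral_cst//= PT mulr1. Qed.

Lemma Rintegral_probability_indic (A : set X) : measurable A -> E \1_A = fine (P A).
Proof. by move=> mA; rewrite /Rintegral integral_indic// setIT. Qed.

Lemma bounded_le_Rintegral f g : bounded_measurable f -> bounded_measurable g ->
  (forall x, f x <= g x) -> E f <= E g.
Proof.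
by move=> bf bg fg; apply: le_Rintegral => //; exact: bounded_measurable_integrable.
Qed.

Lemma bounded_le_normr_Rintegral f : bounded_measurable f ->
  `|E f| <= E (fun x => `|f x|).
Proof. by move=> bf; apply: le_normr_Rintegral => //; exact: bounded_measurable_integrable. Qed.

Lemma bounded_Rintegral_cvg0 (u : nat -> X -> R) (M : R) :
  (forall n, measurable_fun setT (u n)) -> (forall n x, `|u n x| <= M) ->
  (forall x, u n x @[n --> \oo] --> (0 : R)) ->
  E (fun x => `|u n x|) @[n --> \oo] --> (0 : R).
Proof.
move=> mu uM u0.
have := @dominated_convergence _ X R P setT measurableT
    (fun n x => (`|u n x|)%:E) (cst 0%E) (cst M%:E).
case.
- by move=> n; apply/measurable_EFinP; exact: measurableT_comp.
- exact: measurable_cst.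
- apply: aeW => x _; apply: cvg_EFin; first exact: nearW.
  by rewrite -(normr0 R); apply: cvg_norm; exact: u0.
- by apply: (bounded_measurable_integrable (bounded_measurable_cst M)).
- by apply: aeW => x n _; rewrite abse_EFin normr_id lee_fin.
- move=> _ _; rewrite integral0 => /fine_cvgP[_]; exact.
Qed.

(** * Linear spans and approximation in L1 *)

Inductive linear_span (G : set (X -> R)) : (X -> R) -> Prop :=
| linear_span0 : linear_span G (cst 0)
| linear_spanD c e f : G e -> linear_span G f ->
    linear_span G (fun x => c * e x + f x).

Section span.
Variable G : set (X -> R).
Hypothesis Gb : forall e, G e -> bounded_measurable e.

Lemma linear_span_bounded f : linear_span G f -> bounded_measurable f.
Proof.
elim=> [|c e h Ge _ bh]; first exact: bounded_measurable_cst.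
by apply: bounded_measurableD => //; exact/bounded_measurableZ/Gb.
Qed.

Lemma linear_span_gen e : G e -> linear_span G e.
Proof.
move=> Ge; rewrite (_ : e = fun x => 1 * e x + cst 0 x).
  by apply: linear_spanD => //; exact: linear_span0.
by apply/funext => x; rewrite mul1r addr0.
Qed.

Lemma linear_span_add f g : linear_span G f -> linear_span G g ->
  linear_span G (fun x => f x + g x).
Proof.
move=> sf sg; elim: sf => [|c e h Ge _ IH].
  by rewrite (_ : (fun x => _) = g)//; apply/funext => x; rewrite add0r.
rewrite (_ : (fun x => _) = fun x => c * e x + (h x + g x)).
  exact: linear_spanD.
by apply/funext => x; rewrite addrA.
Qed.

Lemma linear_span_scale (k : R) f : linear_span G f ->
  linear_span G (fun x => k * f x).
Proof.
elim=> [|c e h Ge _ IH].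
  rewrite (_ : (fun x => _) = cst 0); first exact: linear_span0.
  by apply/funext => x; rewrite mulr0.
rewrite (_ : (fun x => _) = fun x => (k * c) * e x + k * h x).
  exact: linear_spanD.
by apply/funext => x; ring.
Qed.

Lemma linear_span_mul :
  (forall e e', G e -> G e' -> linear_span G (fun x => e x * e' x)) ->
  forall f g, linear_span G f -> linear_span G g ->
  linear_span G (fun x => f x * g x).
Proof.
move=> GG f g sf sg; elim: sf => [|c e h Ge _ IH].
  rewrite (_ : (fun x => _) = cst 0); first exact: linear_span0.
  by apply/funext => x; rewrite mul0r.
rewrite (_ : (fun x => _) = fun x => (c * (e x * g x) + h x * g x)); last first.
  by apply/funext => x; ring.
apply: linear_span_add => //; apply: linear_span_scale.
elim: sg {IH} => [|c' e' h' Ge' _ IH'].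
  rewrite (_ : (fun x => _) = cst 0); first exact: linear_span0.
  by apply/funext => x; rewrite mulr0.
rewrite (_ : (fun x => _) = fun x => (c' * (e x * e' x) + e x * h' x)).
  by apply: linear_span_add => //; apply: linear_span_scale; exact: GG.
by apply/funext => x; ring.
Qed.

Definition L1_approximable f := forall e : R, 0 < e ->
  exists2 g, linear_span G g & E (fun x => `|f x - g x|) <= e.

Lemma L1_approximable_span f : linear_span G f -> L1_approximable f.
Proof.
move=> sf e e0; exists f => //.
under eq_Rintegral do rewrite subrr normr0.
by rewrite Rintegral_probability_cst ltW.
Qed.

Lemma L1_approximable_trans f :
  bounded_measurable f ->
  (forall e : R, 0 < e -> exists g, [/\ bounded_measurable g,
     L1_approximable g & E (fun x => `|f x - g x|) <= e]) ->
  L1_approximable f.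
Proof.
move=> bf h e e0; have e2 : 0 < e / 2 by rewrite divr_gt0.
have [g [bg ag fg]] := h _ e2; have [k sk gk] := ag _ e2.
exists k => //; have bk := linear_span_bounded sk.
apply: (@le_trans _ _ (E (fun x => `|f x - g x| + `|g x - k x|))).
  apply: bounded_le_Rintegral.
  - by apply: bounded_measurable_norm; exact: bounded_measurableB.
  - by apply: bounded_measurableD; apply: bounded_measurable_norm; exact: bounded_measurableB.
  - by move=> x; rewrite (le_trans _ (ler_normD _ _))// addrA subrK.
rewrite bounded_RintegralD; try by apply: bounded_measurable_norm; exact: bounded_measurableB.
by rewrite [leRHS]splitr lerD.
Qed.

Lemma L1_approximable_add f g : bounded_measurable f -> bounded_measurable g ->
  L1_approximable f -> L1_approximable g -> L1_approximable (fun x => f x + g x).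
Proof.
move=> bf bg af ag e e0; have e2 : 0 < e / 2 by rewrite divr_gt0.
have [f' sf ff] := af _ e2; have [g' sg gg] := ag _ e2.
have bf' := linear_span_bounded sf; have bg' := linear_span_bounded sg.
exists (fun x => f' x + g' x); first exact: linear_span_add.
apply: (@le_trans _ _ (E (fun x => `|f x - f' x| + `|g x - g' x|))).
  apply: bounded_le_Rintegral.
  - by apply: bounded_measurable_norm; apply: bounded_measurableB; exact: bounded_measurableD.
  - by apply: bounded_measurableD; apply: bounded_measurable_norm; exact: bounded_measurableB.
  - by move=> x; rewrite (le_trans _ (ler_normD _ _))// opprD addrACA.
rewrite bounded_RintegralD; try by apply: bounded_measurable_norm; exact: bounded_measurableB.
by rewrite [leRHS]splitr lerD.
Qed.

Lemma L1_approximable_scale (c : R) f : bounded_measurable f ->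
  L1_approximable f -> L1_approximable (fun x => c * f x).
Proof.
move=> bf af e e0.
have c1 : 0 < `|c| + 1 by rewrite ltr_wpDl.
have [f' sf ff] := af _ (divr_gt0 e0 c1).
have bf' := linear_span_bounded sf.
exists (fun x => c * f' x); first exact: linear_span_scale.
under eq_Rintegral do rewrite -mulrBr normrM.
rewrite bounded_RintegralZ; last by apply: bounded_measurable_norm; exact: bounded_measurableB.
apply: (@le_trans _ _ ((`|c| + 1) * (e / (`|c| + 1)))).
  apply: ler_pM => //; last by rewrite lerDl.
  by apply: Rintegral_ge0 => x _.
by rewrite mulrC divfK// gt_eqF.
Qed.

(** Approximants in L1 come without a uniform bound, so the factors are replaced one at a time: [f]
    by [f'] using the bound of [g], then [g] with a precision that depends on the bound of [f']. *)
Lemma L1_approximable_mul f g :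
  (forall e e', G e -> G e' -> linear_span G (fun x => e x * e' x)) ->
  bounded_measurable f -> bounded_measurable g ->
  L1_approximable f -> L1_approximable g -> L1_approximable (fun x => f x * g x).
Proof.
move=> GG bf bg af ag.
have aux k h : linear_span G k -> bounded_measurable h -> L1_approximable h ->
    L1_approximable (fun x => k x * h x).
  move=> sk bh ah e e0; have [mk [M kM]] := linear_span_bounded sk.
  have M1 : 0 < `|M| + 1 by rewrite ltr_wpDl.
  have [h' sh hh] := ah _ (divr_gt0 e0 M1).
  have bh' := linear_span_bounded sh.
  exists (fun x => k x * h' x); first exact: linear_span_mul.
  apply: (@le_trans _ _ (E (fun x => (`|M| + 1) * `|h x - h' x|))).
    apply: bounded_le_Rintegral.
    - apply: bounded_measurable_norm; apply: bounded_measurableB;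
        by apply: bounded_measurableM => //; split => //; exists M.
    - by apply: bounded_measurableZ; apply: bounded_measurable_norm; exact: bounded_measurableB.
    - move=> x; rewrite -mulrBr normrM ler_wpM2r// (le_trans (kM x))//.
      by rewrite (le_trans (ler_norm _))// lerDl.
  rewrite bounded_RintegralZ; last by apply: bounded_measurable_norm; exact: bounded_measurableB.
  by rewrite -ler_pdivlMl// mulrC.
apply: L1_approximable_trans; first exact: bounded_measurableM.
move=> e e0; case: (bg) => mg [M gM].
have M1 : 0 < `|M| + 1 by rewrite ltr_wpDl.
have [f' sf ff] := af _ (divr_gt0 e0 M1).
have bf' := linear_span_bounded sf.
exists (fun x => f' x * g x); split.
- exact: bounded_measurableM.
- exact: aux.
- apply: (@le_trans _ _ (E (fun x => (`|M| + 1) * `|f x - f' x|))).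
    apply: bounded_le_Rintegral.
    - by apply: bounded_measurable_norm; apply: bounded_measurableB; apply: bounded_measurableM.
    - by apply: bounded_measurableZ; apply: bounded_measurable_norm; exact: bounded_measurableB.
    - move=> x; rewrite -mulrBl normrM mulrC ler_wpM2r// (le_trans (gM x))//.
      by rewrite (le_trans (ler_norm _))// lerDl.
  rewrite bounded_RintegralZ; last by apply: bounded_measurable_norm; exact: bounded_measurableB.
  by rewrite -ler_pdivlMl// mulrC.
Qed.

Lemma L1_approximable_cvg (u : nat -> X -> R) f (M : R) :
  (forall n, measurable_fun setT (u n)) -> (forall n x, `|u n x| <= M) ->
  bounded_measurable f -> (forall n, L1_approximable (u n)) ->
  (forall x, u n x @[n --> \oo] --> f x) -> L1_approximable f.
Proof.
move=> mu uM bf au uf; apply: L1_approximable_trans => // e e0.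
case: (bf) => mf [N fN].
have : E (fun x => `|f x - u n x|) @[n --> \oo] --> (0 : R).
  apply: (@bounded_Rintegral_cvg0 (fun n x => f x - u n x) (N + M)).
  - by move=> n; exact: measurable_funB.
  - by move=> n x; rewrite (le_trans (ler_normB _ _))// lerD.
  - by move=> x; rewrite -(subrr (f x)); apply: cvgB => //; exact: cvg_cst.
move=> /cvgrPdist_le/(_ _ e0)[n _ /(_ n (leqnn n))]; rewrite sub0r normrN => h.
exists (u n); split => //; first by split => //; exists M.
exact: le_trans (ler_norm _) h.
Qed.

End span.

(** * Asymptotic decorrelation of bounded functions *)

Section mixing_functions.
Variable tau : nat -> X -> X.
Hypothesis mtau : forall n, measurable_fun setT (tau n).
Hypothesis taupres : forall n A, measurable A -> P (tau n @^-1` A) = P A.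

Definition mixing_pair f g :=
  E (fun x => f x * g (tau n x)) @[n --> \oo] --> E f * E g.

Lemma mixing_pair_linearr f g g' (c : R) : bounded_measurable f ->
  bounded_measurable g -> bounded_measurable g' ->
  mixing_pair f g -> mixing_pair f g' -> mixing_pair f (fun x => c * g x + g' x).
Proof.
move=> bf bg bg' h h'; rewrite /mixing_pair.
have bt n k : bounded_measurable k -> bounded_measurable (fun x => f x * k (tau n x)).
  by move=> bk; apply: bounded_measurableM => //; exact: bounded_measurable_comp.
have -> : (fun n => E (fun x => f x * (c * g (tau n x) + g' (tau n x)))) =
   (fun n => c * E (fun x => f x * g (tau n x)) + E (fun x => f x * g' (tau n x))).
  apply/funext => n.
  transitivity (E (fun x => c * (f x * g (tau n x)) + f x * g' (tau n x))).
    by apply: eq_Rintegral => x _; ring.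
  rewrite bounded_RintegralD ?bounded_RintegralZ//; try exact: bt.
  by apply: bounded_measurableZ; exact: bt.
rewrite bounded_RintegralD ?bounded_RintegralZ//; last exact: bounded_measurableZ.
rewrite mulrDr mulrCA; apply: cvgD => //.
by apply: cvgMr.
Qed.

Lemma mixing_pair_linearl f f' g (c : R) : bounded_measurable f ->
  bounded_measurable f' -> bounded_measurable g ->
  mixing_pair f g -> mixing_pair f' g -> mixing_pair (fun x => c * f x + f' x) g.
Proof.
move=> bf bf' bg h h'; rewrite /mixing_pair.
have bt n k : bounded_measurable k -> bounded_measurable (fun x => k x * g (tau n x)).
  by move=> bk; apply: bounded_measurableM => //; exact: bounded_measurable_comp.
have -> : (fun n => E (fun x => (c * f x + f' x) * g (tau n x))) =
   (fun n => c * E (fun x => f x * g (tau n x)) + E (fun x => f' x * g (tau n x))).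
  apply/funext => n.
  transitivity (E (fun x => c * (f x * g (tau n x)) + f' x * g (tau n x))).
    by apply: eq_Rintegral => x _; ring.
  rewrite bounded_RintegralD ?bounded_RintegralZ//; try exact: bt.
  by apply: bounded_measurableZ; exact: bt.
rewrite bounded_RintegralD ?bounded_RintegralZ//; last exact: bounded_measurableZ.
rewrite mulrDl -mulrA; apply: cvgD => //.
by apply: cvgMr.
Qed.

Lemma mixing_pair0 f : mixing_pair f (cst 0) /\ mixing_pair (cst 0) f.
Proof.
rewrite /mixing_pair Rintegral_probability_cst mulr0 mul0r.
split; apply: cvg_near_cst; apply: nearW => n.
  by under eq_Rintegral do rewrite mulr0; rewrite Rintegral_probability_cst.
by under eq_Rintegral do rewrite mul0r; rewrite Rintegral_probability_cst.
Qed.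

Lemma mixing_pair_span (G : set (X -> R)) :
  (forall e, G e -> bounded_measurable e) ->
  (forall e e', G e -> G e' -> mixing_pair e e') ->
  forall f g, linear_span G f -> linear_span G g -> mixing_pair f g.
Proof.
move=> Gb GG f g sf sg; elim: sf => [|c e h Ge sh IH].
  by case: (mixing_pair0 g).
apply: mixing_pair_linearl => //; try by [exact: Gb|exact: (linear_span_bounded Gb)].
elim: sg {IH} => [|c' e' h' Ge' sh' IH].
  by case: (mixing_pair0 e).
apply: mixing_pair_linearr => //; try by [exact: Gb|exact: (linear_span_bounded Gb)].
exact: GG.
Qed.

(** Here too [g'] is chosen after the bound of [f'] is known. Replacing [f] and then [g] in the
    correlation costs [e / 5] each, replacing both in the product of the means costs [2 e / 5], and
    mixing of [f'] and [g'] takes the last fifth. *)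
Lemma mixing_pair_approximable (G : set (X -> R)) :
  (forall e, G e -> bounded_measurable e) ->
  (forall e e', G e -> G e' -> mixing_pair e e') ->
  forall f g, bounded_measurable f -> bounded_measurable g ->
  L1_approximable G f -> L1_approximable G g -> mixing_pair f g.
Proof.
move=> Gb GG f g bf bg af ag; apply/cvgrPdist_le => e e0.
case: (bg) => mg [M gM].
have M1 : 0 < `|M| + 1 by rewrite ltr_wpDl.
have [f' sf ff] := af (e / 5 / (`|M| + 1)) (divr_gt0 (divr_gt0 e0 (ltr0n _ 5)) M1).
have bf' := linear_span_bounded Gb sf.
case: (bf') => mf' [N fN].
have N1 : 0 < `|N| + 1 by rewrite ltr_wpDl.
have [g' sg gg] := ag (e / 5 / (`|N| + 1)) (divr_gt0 (divr_gt0 e0 (ltr0n _ 5)) N1).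
have bg' := linear_span_bounded Gb sg.
have gM' x : `|g x| <= `|M| + 1.
  by rewrite (le_trans (gM x))// (le_trans (ler_norm _))// lerDl.
have fN' x : `|f' x| <= `|N| + 1.
  by rewrite (le_trans (fN x))// (le_trans (ler_norm _))// lerDl.
have bt n k k' : bounded_measurable k -> bounded_measurable k' ->
    bounded_measurable (fun x => k x * k' (tau n x)).
  by move=> bk bk'; apply: bounded_measurableM => //; exact: bounded_measurable_comp.
have close (k k' : X -> R) (D : R) : bounded_measurable k -> bounded_measurable k' ->
    E (fun x => `|k x - k' x|) <= D -> `|E k - E k'| <= D.
  move=> bk bk'; apply: le_trans; rewrite -bounded_RintegralB//.
  by apply: bounded_le_normr_Rintegral; exact: bounded_measurableB.
have step1 n : `|E (fun x => f x * g (tau n x)) - E (fun x => f' x * g (tau n x))| <= e / 5.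
  apply: close; [exact: bt|exact: bt|].
  apply: (@le_trans _ _ (E (fun x => (`|M| + 1) * `|f x - f' x|))).
    apply: bounded_le_Rintegral.
    - by apply: bounded_measurable_norm; apply: bounded_measurableB; apply: bt.
    - by apply: bounded_measurableZ; apply: bounded_measurable_norm; exact: bounded_measurableB.
    - by move=> x; rewrite -mulrBl normrM mulrC ler_wpM2r.
  rewrite bounded_RintegralZ; last by apply: bounded_measurable_norm; exact: bounded_measurableB.
  by rewrite -ler_pdivlMl// mulrC.
have step2 n : `|E (fun x => f' x * g (tau n x)) - E (fun x => f' x * g' (tau n x))| <= e / 5.
  apply: close; [exact: bt|exact: bt|].
  apply: (@le_trans _ _ (E (fun x => (`|N| + 1) * `|g (tau n x) - g' (tau n x)|))).
    apply: bounded_le_Rintegral.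
    - by apply: bounded_measurable_norm; apply: bounded_measurableB; apply: bt.
    - apply: bounded_measurableZ; apply: bounded_measurable_norm.
      by apply: bounded_measurableB; exact: bounded_measurable_comp.
    - by move=> x; rewrite -mulrBr normrM ler_wpM2r.
  rewrite bounded_RintegralZ; last first.
    apply: bounded_measurable_norm.
    by apply: bounded_measurableB; exact: bounded_measurable_comp.
  rewrite (Rintegral_preserving (mtau n) (taupres n) (F := fun x => `|g x - g' x|)).
    by rewrite -ler_pdivlMl// mulrC.
  by case: (bounded_measurable_norm (bounded_measurableB bg bg')).
have norm_E k (D : R) : bounded_measurable k -> (forall x, `|k x| <= D) -> `|E k| <= D.
  move=> bk kD; apply: (le_trans (bounded_le_normr_Rintegral bk)).
  rewrite -[leRHS](Rintegral_probability_cst D); apply: bounded_le_Rintegral => //.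
    exact: bounded_measurable_norm.
  exact: bounded_measurable_cst.
have step3 : `|E f * E g - E f' * E g'| <= e / 5 + e / 5.
  have -> : E f * E g - E f' * E g' = (E f - E f') * E g + E f' * (E g - E g') by ring.
  rewrite (le_trans (ler_normD _ _))// !normrM; apply: lerD.
    apply: (@le_trans _ _ (e / 5 / (`|M| + 1) * (`|M| + 1))).
      by apply: ler_pM => //; [exact: close|exact: norm_E].
    by rewrite divfK// gt_eqF.
  apply: (@le_trans _ _ ((`|N| + 1) * (e / 5 / (`|N| + 1)))).
    by apply: ler_pM => //; [exact: norm_E|exact: close].
  by rewrite mulrC divfK// gt_eqF.
have := mixing_pair_span Gb GG sf sg.
move=> /cvgrPdist_le/(_ (e / 5)) -/(_ (divr_gt0 e0 (ltr0n _ 5))).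
apply: filterS => n mn.
set a := E f * E g in step3 *; set a' := E f' * E g' in step3 mn.
have s1 := step1 n; have s2 := step2 n.
set b := E (fun x => f x * g (tau n x)) in s1 *.
set b1 := E (fun x => f' x * g (tau n x)) in s1 s2.
set b2 := E (fun x => f' x * g' (tau n x)) in s2 mn.
have -> : a - b = (a - a') + (a' - b2) - (b1 - b2) - (b - b1) by ring.
have h1 := ler_normB ((a - a') + (a' - b2) - (b1 - b2)) (b - b1).
have h2 := ler_normB ((a - a') + (a' - b2)) (b1 - b2).
have h3 := ler_normD (a - a') (a' - b2).
lra.
Qed.

Lemma mixing_pair_indic (A B : set X) : measurable A -> measurable B ->
  mixing_pair \1_A \1_B <->
  P (A `&` tau n @^-1` B) @[n --> \oo] --> (P A * P B)%E.
Proof.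
move=> mA mB.
have mtB n : measurable (tau n @^-1` B) by rewrite -[X in measurable X]setTI; exact: mtau.
have E1 n : E (fun x => \1_A x * \1_B (tau n x)) = fine (P (A `&` tau n @^-1` B)).
  rewrite -Rintegral_probability_indic; last exact: measurableI.
  apply: eq_Rintegral => x _; rewrite !indicE in_setI -natrM mulnb.
  by congr ((_ && _)%:R); apply/idP/idP; rewrite !inE.
have E2 : (P A * P B)%E = (E \1_A * E \1_B)%:E.
  by rewrite !Rintegral_probability_indic// EFinM !fineK// fin_num_measure.
rewrite /mixing_pair E2; under eq_cvg do rewrite E1.
split => [h|/fine_cvgP[]//].
apply/fine_cvgP; split => //; apply: nearW => n.
by rewrite fin_num_measure//; exact: measurableI.
Qed.

(** Counting the thresholds [1, ..., N] below [y] writes an integer part as a sum of indicators of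
    level sets. *)
Lemma staircase (y : R) N : 0 <= y ->
  \sum_(k < N) (if k.+1%:R <= y then 1 else 0 : R) = (minn N (Num.truncn y))%:R.
Proof.
move=> y0; elim: N => [|N IH]; first by rewrite big_ord0 min0n.
rewrite big_ord_recr/= IH -truncn_ge_nat//.
have [h|h] := ltnP N (Num.truncn y).
  by rewrite (minn_idPl h) natr1.
by rewrite addr0 (minn_idPr (leqW h)).
Qed.

(** An affine change of [f] brings its values into [[0, 1]]. There the integer part of [N%:R * k],
    divided by [N], is uniformly within [1 / N] of [k] and is a sum of [N] multiples of
    indicators. *)
Lemma L1_approximable_simple f : bounded_measurable f ->
  L1_approximable [set e | exists2 A, measurable A & e = \1_A] f.
Proof.
set G := [set e | _].
have Gb e : G e -> bounded_measurable e.
  by case=> A mA ->; exact: bounded_measurable_indic.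
suff h01 (k : X -> R) : measurable_fun setT k -> (forall x, 0 <= k x <= 1) -> L1_approximable G k.
  move=> bf; case: (bf) => mf [M fM].
  have M1 : 0 < `|M| + 1 by rewrite ltr_wpDl.
  pose k x := (f x / (`|M| + 1) + 1) / 2.
  have mk : measurable_fun setT k.
    apply: measurable_funM => //; apply: measurable_funD => //.
    exact: measurable_funM.
  have k01 x : 0 <= k x <= 1.
    have : `|f x / (`|M| + 1)| <= 1.
      rewrite normrM normfV (gtr0_norm M1) ler_pdivrMr// mul1r.
      by rewrite (le_trans (fM x))// (le_trans (ler_norm _))// lerDl.
    by rewrite ler_norml /k => /andP[]; move: (f x / _) => z; lra.
  have bk : bounded_measurable k.
    by split => //; exists 1 => x; rewrite ger0_norm; case/andP: (k01 x).
  have b1 : bounded_measurable (\1_setT : X -> R) by exact: bounded_measurable_indic.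
  rewrite (_ : f = fun x => (2 * (`|M| + 1)) * k x + (- (`|M| + 1)) * \1_setT x).
    apply: (L1_approximable_add Gb); try exact: bounded_measurableZ.
      by apply: (L1_approximable_scale Gb) => //; exact: h01.
    apply: (L1_approximable_scale Gb) => //; apply: L1_approximable_span => //.
    by apply: linear_span_gen; exists setT.
  by apply/funext => x; rewrite indicE in_setT mulr1 /k; field; rewrite gt_eqF.
move=> mk k01 e e0.
pose N := (Num.truncn e^-1).+1.
have N0 : 0 < N%:R :> R by rewrite ltr0n.
have Ne : N%:R^-1 <= e.
  by rewrite invf_ple ?posrE// ltW// truncnS_gt.
pose A (j : nat) := [set x | j.+1%:R <= N%:R * k x].
have mA j : measurable (A j).
  rewrite /A -[X in measurable X]setTI.
  by apply: (measurable_fun_le (f := cst _)) => //; exact: measurable_funM.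
pose u (n : nat) (x : X) : R := \sum_(j < n) (N%:R^-1 * \1_(A j) x).
have su n : linear_span G (u n).
  elim: n => [|n IH].
    rewrite (_ : u 0 = cst 0); first exact: linear_span0.
    by apply/funext => x; rewrite /u big_ord0.
  rewrite (_ : u n.+1 = fun x => N%:R^-1 * \1_(A n) x + u n x).
    by apply: linear_spanD => //; exists (A n).
  by apply/funext => x; rewrite /u big_ord_recr/= addrC.
exists (u N) => //.
have uE x : u N x = N%:R^-1 * (Num.truncn (N%:R * k x))%:R.
  have /andP[k0 k1] := k01 x.
  have Nk0 : 0 <= N%:R * k x by rewrite mulr_ge0.
  have tN : (Num.truncn (N%:R * k x) <= N)%N.
    rewrite -(ler_nat R); apply: (@le_trans _ _ (N%:R * k x)).
      by rewrite truncn_le.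
    by rewrite ger_pMr.
  rewrite -[in RHS](minn_idPr tN) /u -mulr_sumr.
  rewrite -staircase//; congr (_ * _); apply: eq_bigr => j _.
  by rewrite indicE; case: ifPn => h; [rewrite mem_set|rewrite memNset//; exact/negP].
rewrite -[leRHS](Rintegral_probability_cst e); apply: bounded_le_Rintegral.
- apply: bounded_measurable_norm; apply: bounded_measurableB.
    by split => //; exists 1 => x; rewrite ger0_norm; case/andP: (k01 x).
  exact: (linear_span_bounded Gb).
- exact: bounded_measurable_cst.
- move=> x; rewrite uE; have /andP[k0 k1] := k01 x.
  have Nk0 : 0 <= N%:R * k x by rewrite mulr_ge0.
  have := truncn_itv Nk0; set t := (Num.truncn _)%:R; rewrite -natr1 -/t => /andP[t1 t2].
  have -> : k x - N%:R^-1 * t = N%:R^-1 * (N%:R * k x - t) by field; rewrite gt_eqF.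
  rewrite ger0_norm; last by apply: mulr_ge0; [rewrite invr_ge0 ltW|rewrite subr_ge0].
  apply: le_trans Ne; rewrite -[leRHS]mulr1 ler_pM2l ?invr_gt0//; lra.
Qed.

Lemma mixing_pair_bounded :
  (forall A B, measurable A -> measurable B ->
    P (A `&` tau n @^-1` B) @[n --> \oo] --> (P A * P B)%E) ->
  forall f g, bounded_measurable f -> bounded_measurable g -> mixing_pair f g.
Proof.
move=> mix f g bf bg.
apply: (@mixing_pair_approximable [set e | exists2 A, measurable A & e = \1_A]) => //;
  try exact: L1_approximable_simple.
- by move=> e [A mA ->]; exact: bounded_measurable_indic.
- by move=> e e' [A mA ->] [B mB ->]; apply/mixing_pair_indic => //; exact: mix.
Qed.

End mixing_functions.
End bounded_functions.

(** * Mixing and the Lévy measure *)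

Lemma cos_mulE {R : realType} (a b : R) :
  cos a * cos b = 2^-1 * cos (a + b) + 2^-1 * cos (a - b).
Proof. by rewrite !cosD cosN sinN; field. Qed.

(** * The sign as a limit of iterates of an odd cubic *)

Section sign_iteration.
Context {R : realType}.

(* [-1] and [1] are attracting fixed points: the iterates converge to the sign. *)
Definition sharpen (z : R) : R := (3 * z - z ^+ 3) / 2.

Lemma sharpen_itv (z : R) : `|z| <= 1 -> `|sharpen z| <= 1.
Proof.
rewrite !ler_norml /sharpen => /andP[h1 h2].
have p1 : 0 <= (1 - z) ^+ 2 * (2 + z) by apply: mulr_ge0; [exact: sqr_ge0|lra].
have p2 : 0 <= (1 + z) ^+ 2 * (2 - z) by apply: mulr_ge0; [exact: sqr_ge0|lra].
apply/andP; split.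
  have : (1 + z) ^+ 2 * (2 - z) = 2 + 3 * z - z ^+ 3 by ring.
  lra.
have : (1 - z) ^+ 2 * (2 + z) = 2 - 3 * z + z ^+ 3 by ring.
lra.
Qed.

Lemma iter_sharpen_itv n (z : R) : `|z| <= 1 -> `|iter n sharpen z| <= 1.
Proof. by move=> z1; elim: n => //= n IH; exact: sharpen_itv. Qed.

Lemma iter_sharpenN n (z : R) : iter n sharpen (- z) = - iter n sharpen z.
Proof. by elim: n => //= n ->; rewrite /sharpen; ring. Qed.

(** One step multiplies the distance [1 - w] by [(1 - w) (2 + w) / 2]. For [w >= z > 0] this factor
    is at most its value [q] at [z], and [q < 1] because [2 - (1 - z) (2 + z) = z (1 + z)]. Oddness
    gives the negative case. *)
Lemma iter_sharpen_cvg (z : R) : `|z| <= 1 ->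
  iter n sharpen z @[n --> \oo] --> Num.sg z.
Proof.
move=> z1.
wlog z0 : z z1 / 0 <= z.
  move=> h; have [z0|z0] := leP 0 z; first exact: h.
  rewrite -[z]opprK sgrN; under eq_cvg do rewrite iter_sharpenN.
  by apply: cvgN; apply: h; rewrite ?normrN// oppr_ge0 ltW.
move: z0; rewrite le_eqVlt => /predU1P[<-|z0].
  rewrite sgr0; apply: cvg_near_cst; apply: nearW => n.
  by elim: n => //= n ->; rewrite /sharpen mulr0 expr0n subrr mul0r.
rewrite gtr0_sg//; rewrite ger0_norm in z1; last exact: ltW.
pose q := (1 - z) * (2 + z) / 2.
have q0 : 0 <= q by rewrite /q divr_ge0// mulr_ge0//; lra.
have q1 : q < 1.
  have : 0 < z * (1 + z) by apply: mulr_gt0 => //; lra.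
  rewrite /q ltr_pdivrMr// mul1r -[_ < 2]subr_gt0.
  by have -> : 2 - (1 - z) * (2 + z) = z * (1 + z) by ring.
have main n : 0 <= 1 - iter n sharpen z <= (1 - z) * q ^+ n.
  elim: n => [|n /andP[IH0 IH1]]; first by rewrite /= expr0 mulr1 lexx andbT; lra.
  rewrite iterS; set w := iter n sharpen z in IH0 IH1 *.
  have wz : 1 - w <= 1 - z.
    apply: (le_trans IH1); apply: ler_piMr; first by lra.
    by apply: exprn_ile1 => //; exact: ltW.
  have -> : 1 - sharpen w = (1 - w) * ((1 - w) * (2 + w) / 2).
    by rewrite /sharpen; field.
  have wq : (1 - w) * (2 + w) / 2 <= q.
    rewrite /q ler_wpM2r// -subr_ge0.
    have -> : (1 - z) * (2 + z) - (1 - w) * (2 + w) = (w - z) * (1 + w + z) by ring.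
    by apply: mulr_ge0; lra.
  apply/andP; split.
    by rewrite mulr_ge0// divr_ge0// mulr_ge0//; lra.
  rewrite exprSr [leRHS]mulrA; apply: ler_pM => //.
  by rewrite divr_ge0// mulr_ge0//; lra.
apply/cvgrPdist_le => e e0.
have : (1 - z) * q ^+ n @[n --> \oo] --> (1 - z) * 0.
  by apply: cvgMr; apply: cvg_expr; rewrite ger0_norm.
rewrite mulr0 => /cvgrPdist_le/(_ _ e0); apply: filterS => n.
rewrite sub0r normrN => /(le_trans (ler_norm _)) h.
have /andP[m0 m1] := main n.
by rewrite ger0_norm// (le_trans m1).
Qed.

End sign_iteration.

Section levy_asymptotics.
Context {R : realType}.
Variables (P : probability (RZ R) R) (Q : {measure set (RZ R) -> \bar R}).
Hypothesis hPQ : levy_measure P Q.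
Hypothesis Pinv : shift_invariant P.
Local Notation S := (@Defs.shift R).
Local Notation levy_re := (levy_exponent_re Q).
Local Notation levy_im := (levy_exponent_im Q).
Implicit Types l : seq (int * R).

Let mS n : measurable_fun setT (iter n S).
Proof. by apply: measurable_iter; exact: measurable_shift. Qed.

Let Piter n (A : set (RZ R)) : measurable A -> P (iter n S @^-1` A) = P A.
Proof. by apply: iter_preserving; [exact: measurable_shift|exact: Pinv]. Qed.

Let Qiter n (A : set (RZ R)) : measurable A -> Q (iter n S @^-1` A) = Q A.
Proof. exact: (levy_iter_preserving hPQ). Qed.

(** The phase [s] makes one real family contain both cosines and sines of linear forms, with
    products that stay in the span. *)
Definition trig l (s : R) (x : RZ R) : R := cos (lin l x + s).

Lemma trigE l s x : trig l s x = cos s * cos (lin l x) + (- sin s) * sin (lin l x).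
Proof. by rewrite /trig cosD; ring. Qed.

Lemma bounded_measurable_trig l s : bounded_measurable (trig l s).
Proof.
split; last by exists 1 => x; exact: cos_max.
apply: (measurableT_comp measurable_cos).
by apply: measurable_funD => //; exact: measurable_lin.
Qed.

Lemma bounded_measurable_cos_lin l : bounded_measurable (fun x => cos (lin l x)).
Proof.
by split; [exact: measurable_cos_lin|exists 1 => x; exact: cos_max].
Qed.

Lemma bounded_measurable_sin_lin l : bounded_measurable (fun x => sin (lin l x)).
Proof.
by split; [exact: measurable_sin_lin|exists 1 => x; exact: sin_max].
Qed.

Lemma Rintegral_trig l s :
  Rintegral P setT (trig l s) = expR (levy_re l) * cos (levy_im l + s).
Proof.
have [hc hs] := levy_formula hPQ l.
rewrite (_ : trig l s = fun x => cos s * cos (lin l x) + (- sin s) * sin (lin l x)).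
  2: by apply/funext => x; rewrite trigE.
have bc := bounded_measurable_cos_lin l; have bs := bounded_measurable_sin_lin l.
rewrite bounded_RintegralD; try exact: bounded_measurableZ.
by rewrite !bounded_RintegralZ// hc hs cosD; ring.
Qed.

Lemma levy_re_translate n l : levy_re (translate n l) = levy_re l.
Proof.
rewrite /levy_exponent_re.
under eq_Rintegral do rewrite /onem_cos lin_translate.
apply: (Rintegral_preserving (mS n) (@Qiter n) (F := fun x => - onem_cos l x)).
by apply: measurableT_comp => //; exact: measurable_onem_cos.
Qed.

Lemma levy_im_translate n l : levy_im (translate n l) = levy_im l.
Proof.
transitivity (Rintegral Q setT (fun x => sin_compensated l (iter n S x))).
  apply: eq_Rintegral => x _.
  by rewrite /sin_compensated lin_translate lin_truncation_translate.
apply: (Rintegral_preserving (mS n) (@Qiter n) (F := sin_compensated l)).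
exact: measurable_sin_compensated.
Qed.

Lemma onem_cos_opposite l x : onem_cos (opposite l) x = onem_cos l x.
Proof. by rewrite /onem_cos lin_opposite cosN. Qed.

Lemma levy_re_opposite l : levy_re (opposite l) = levy_re l.
Proof.
by rewrite /levy_exponent_re; under eq_Rintegral do rewrite onem_cos_opposite.
Qed.

Lemma levy_im_opposite l : levy_im (opposite l) = - levy_im l.
Proof.
rewrite /levy_exponent_im -mulN1r.
rewrite -RintegralZl//; last exact: (integrable_sin_compensated hPQ).
apply: eq_Rintegral => x _.
by rewrite /sin_compensated lin_opposite lin_truncation_opposite sinN; ring.
Qed.

Lemma opposite_translate n l : opposite (translate n l) = translate n (opposite l).
Proof. by rewrite /opposite /translate -!map_comp. Qed.

(** With [cross_im], the real and imaginary parts of [(exp(iu) - 1) (exp(iv) - 1)] for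
    [u = lin l1 x] and [v = lin l2 x]; the compensators cancel because truncation is additive over
    concatenation. *)
Definition cross_re l1 l2 (x : RZ R) : R :=
  onem_cos l1 x * onem_cos l2 x - sin (lin l1 x) * sin (lin l2 x).
Definition cross_im l1 l2 (x : RZ R) : R :=
  - (sin (lin l1 x) * onem_cos l2 x + onem_cos l1 x * sin (lin l2 x)).

Lemma measurable_cross_re l1 l2 : measurable_fun setT (cross_re l1 l2).
Proof.
apply: measurable_funB; apply: measurable_funM;
  solve [exact: measurable_onem_cos|exact: measurable_sin_lin].
Qed.

Lemma measurable_cross_im l1 l2 : measurable_fun setT (cross_im l1 l2).
Proof.
apply: measurableT_comp => //; apply: measurable_funD; apply: measurable_funM;
  solve [exact: measurable_onem_cos|exact: measurable_sin_lin].
Qed.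

Let intN l : Q.-integrable setT (EFin \o (fun x => - onem_cos l x)).
Proof.
apply: (@le_integrable_EFin _ _ _ _ _ (onem_cos l)).
- by apply: measurableT_comp => //; exact: measurable_onem_cos.
- by move=> x; rewrite normrN ger0_norm// onem_cos_ge0.
- exact: (integrable_onem_cos hPQ).
Qed.

Lemma cross_reE l1 l2 x : - onem_cos (l1 ++ l2) x =
  (- onem_cos l1 x + - onem_cos l2 x) + cross_re l1 l2 x.
Proof. by rewrite /cross_re /onem_cos lin_cat cosD; ring. Qed.

Lemma cross_imE l1 l2 x : sin_compensated (l1 ++ l2) x =
  (sin_compensated l1 x + sin_compensated l2 x) + cross_im l1 l2 x.
Proof.
by rewrite /cross_im /sin_compensated /onem_cos lin_cat lin_truncation_cat sinD; ring.
Qed.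

Lemma integrable_cross_re l1 l2 : Q.-integrable setT (EFin \o cross_re l1 l2).
Proof.
rewrite (_ : EFin \o _ = (EFin \o (fun x => - onem_cos (l1 ++ l2) x)%R) \-
   ((EFin \o (fun x => - onem_cos l1 x)%R) \+ (EFin \o (fun x => - onem_cos l2 x)%R)))%E.
  by apply: integrableB => //; apply: integrableD.
by apply/funext => x /=; rewrite cross_reE -!EFinD; congr EFin; ring.
Qed.

Lemma integrable_cross_im l1 l2 : Q.-integrable setT (EFin \o cross_im l1 l2).
Proof.
have i := integrable_sin_compensated hPQ.
rewrite (_ : EFin \o _ = (EFin \o sin_compensated (l1 ++ l2)) \-
   ((EFin \o sin_compensated l1) \+ (EFin \o sin_compensated l2)))%E.
  by apply: integrableB => //; apply: integrableD.
by apply/funext => x /=; rewrite cross_imE -!EFinD; congr EFin; ring.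
Qed.

Lemma levy_re_cat l1 l2 : levy_re (l1 ++ l2) =
  levy_re l1 + levy_re l2 + Rintegral Q setT (cross_re l1 l2).
Proof.
rewrite /levy_exponent_re; under eq_Rintegral do rewrite cross_reE.
have i12 : Q.-integrable setT (EFin \o (fun x => - onem_cos l1 x + - onem_cos l2 x)).
  exact: (@integrableD _ _ _ Q setT measurableT _ _ (intN l1) (intN l2)).
rewrite (RintegralD measurableT i12 (integrable_cross_re _ _)).
by rewrite (RintegralD measurableT (intN l1) (intN l2)).
Qed.

Lemma levy_im_cat l1 l2 : levy_im (l1 ++ l2) =
  levy_im l1 + levy_im l2 + Rintegral Q setT (cross_im l1 l2).
Proof.
transitivity (Rintegral Q setT (fun x =>
    (sin_compensated l1 x + sin_compensated l2 x) + cross_im l1 l2 x)).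
  by apply: eq_Rintegral => x _; exact: cross_imE.
have i := integrable_sin_compensated hPQ.
have i12 : Q.-integrable setT (EFin \o (fun x => sin_compensated l1 x + sin_compensated l2 x)).
  exact: (@integrableD _ _ _ Q setT measurableT _ _ (i l1) (i l2)).
rewrite (RintegralD measurableT i12 (integrable_cross_im _ _)).
by rewrite (RintegralD measurableT (i l1) (i l2)).
Qed.

Definition levy_correlation :=
  correlation Q (fun _ _ => 1) (fun n => iter n S).

Definition levy_zero_type := forall h : RZ R -> R,
  measurable_fun setT h -> (forall x, 0 <= h x) ->
  (\int[Q]_x ((h x) ^+ 2)%:E < +oo)%E ->
  levy_correlation n h h @[n --> \oo] --> 0%E.

Definition asymptotically_additive := forall l1 l2,
  levy_re (l1 ++ translate n l2) @[n --> \oo] --> levy_re l1 + levy_re l2 /\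
  levy_im (l1 ++ translate n l2) @[n --> \oo] --> levy_im l1 + levy_im l2.

(* An upper bound of [|exp(i lin l x) - 1|]. *)
Definition increment l (x : RZ R) : R := onem_cos l x + `|sin (lin l x)|.

Lemma increment_ge0 l x : 0 <= increment l x.
Proof. by rewrite addr_ge0// onem_cos_ge0. Qed.

Lemma measurable_increment l : measurable_fun setT (increment l).
Proof.
apply: measurable_funD; first exact: measurable_onem_cos.
by apply: measurableT_comp => //; exact: measurable_sin_lin.
Qed.

(** With [c] the cosine and [s] the sine, the left side is at most
    [2 ((1 - c)^2 + s^2) = 4 (1 - c)]; thus increments are square integrable under [Q]. *)
Lemma increment_sqr l x : increment l x ^+ 2 <= 4 * onem_cos l x.
Proof.
have := cos2Dsin2 (lin l x); rewrite -(real_normK (num_real (sin _))) /increment /onem_cos.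
have := sqr_ge0 ((1 - cos (lin l x)) - `|sin (lin l x)|).
move: (cos _) `|sin _| => c s; nra.
Qed.

Lemma cross_re_le l1 l2 x :
  `|cross_re l1 l2 x| <= increment l1 x * increment l2 x.
Proof.
rewrite (le_trans (ler_normB _ _))// !normrM /increment.
rewrite !(ger0_norm (onem_cos_ge0 _ _)).
have := onem_cos_ge0 l1 x; have := onem_cos_ge0 l2 x.
have := normr_ge0 (sin (lin l1 x)); have := normr_ge0 (sin (lin l2 x)); nra.
Qed.

Lemma cross_im_le l1 l2 x :
  `|cross_im l1 l2 x| <= increment l1 x * increment l2 x.
Proof.
rewrite normrN (le_trans (ler_normD _ _))// !normrM /increment.
rewrite !(ger0_norm (onem_cos_ge0 _ _)).
have := onem_cos_ge0 l1 x; have := onem_cos_ge0 l2 x.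
have := normr_ge0 (sin (lin l1 x)); have := normr_ge0 (sin (lin l2 x)); nra.
Qed.

Lemma asymptotically_additive_of_zero_type :
  levy_zero_type -> asymptotically_additive.
Proof.
move=> zt l1 l2.
(* A single function above both increments, so that one self-correlation bounds the cross integrals;
   its square is at most [8] times the sum of the two [onem_cos]. *)
pose h x := increment l1 x + increment l2 x.
have mh : measurable_fun setT h by apply: measurable_funD; exact: measurable_increment.
have h0 x : 0 <= h x by rewrite addr_ge0// increment_ge0.
have h2 : (\int[Q]_x ((h x) ^+ 2)%:E < +oo)%E.
  have i : Q.-integrable setT (fun x => (8 * onem_cos l1 x + 8 * onem_cos l2 x)%:E).
    rewrite (_ : (fun x => _) = (fun x => 8%:E * (onem_cos l1 x)%:E) \+
       (fun x => 8%:E * (onem_cos l2 x)%:E))%E//.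
    by apply: integrableD => //; apply: integrableZl => //; exact: (integrable_onem_cos hPQ).
  case/integrableP: i => mi; apply: le_lt_trans.
  apply: ge0_le_integral => //.
  - by move=> x _; rewrite lee_fin sqr_ge0.
  - by apply/measurable_EFinP; exact: measurable_funX.
  - exact: (measurableT_comp (@abse_measurable R setT) mi).
  - move=> x _; rewrite abse_EFin lee_fin (le_trans _ (ler_norm _))// /h.
    have := increment_sqr l1 x; have := increment_sqr l2 x.
    have := sqr_ge0 (increment l1 x - increment l2 x); nra.
have hc := zt h mh h0 h2.
have bound (c : seq (int * R) -> seq (int * R) -> RZ R -> R) :
    (forall l l', measurable_fun setT (c l l')) ->
    (forall l l' x, `|c l l' x| <= increment l x * increment l' x) ->
    Rintegral Q setT (c l1 (translate n l2)) @[n --> \oo] --> (0 : R).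
  move=> mc cb; apply/cvgrPdist_le => e e0.
  have c0 n : (0 <= levy_correlation n h h)%E by apply: correlation_ge0.
  have := (ge0_cvge0P c0).1 hc e e0.
  apply: filterS => n hn; rewrite sub0r normrN.
  apply: (Rintegral_le_bound (mc _ _) _ _ hn).
    by apply: measurable_funM => //; apply: measurable_funM => //; exact: measurableT_comp.
  move=> x; apply: (le_trans (cb _ _ _)); rewrite mul1r.
  have -> : increment (translate n l2) x = increment l2 (iter n S x).
    by rewrite /increment /onem_cos lin_translate.
  by apply: ler_pM; rewrite ?increment_ge0// /h ?lerDl ?lerDr increment_ge0.
split.
- have -> : (fun n => levy_re (l1 ++ translate n l2)) = (fun n =>
      levy_re l1 + levy_re l2 + Rintegral Q setT (cross_re l1 (translate n l2))).
    by apply/funext => n; rewrite levy_re_cat levy_re_translate.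
  rewrite -[X in _ --> X]addr0; apply: cvgD; first exact: cvg_cst.
  by apply: bound; [exact: measurable_cross_re|exact: cross_re_le].
- have -> : (fun n => levy_im (l1 ++ translate n l2)) = (fun n =>
      levy_im l1 + levy_im l2 + Rintegral Q setT (cross_im l1 (translate n l2))).
    by apply/funext => n; rewrite levy_im_cat levy_im_translate.
  rewrite -[X in _ --> X]addr0; apply: cvgD; first exact: cvg_cst.
  by apply: bound; [exact: measurable_cross_im|exact: cross_im_le].
Qed.

Lemma trig_mul l1 l2 s1 s2 x : trig l1 s1 x * trig l2 s2 x =
  2^-1 * trig (l1 ++ l2) (s1 + s2) x +
  (2^-1 * trig (l1 ++ opposite l2) (s1 - s2) x + 0).
Proof.
rewrite /trig !lin_cat lin_opposite addr0.
have -> : lin l1 x + lin l2 x + (s1 + s2) = (lin l1 x + s1) + (lin l2 x + s2) by ring.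
have -> : lin l1 x - lin l2 x + (s1 - s2) = (lin l1 x + s1) - (lin l2 x + s2) by ring.
exact: cos_mulE.
Qed.

Let trigs := [set e | exists l s, e = trig l s].

Let trigs_bounded e : trigs e -> bounded_measurable e.
Proof. by case=> l [s ->]; exact: bounded_measurable_trig. Qed.

Let trigs_mul e e' : trigs e -> trigs e' -> linear_span trigs (fun x => e x * e' x).
Proof.
move=> [l1 [s1 ->]] [l2 [s2 ->]].
rewrite (_ : (fun x => _) = (fun x => 2^-1 * trig (l1 ++ l2) (s1 + s2) x +
  (2^-1 * trig (l1 ++ opposite l2) (s1 - s2) x + cst 0 x))); last first.
  by apply/funext => x; exact: trig_mul.
apply: linear_spanD.
  by exists (l1 ++ l2), (s1 + s2).
by apply: linear_spanD; [exists (l1 ++ opposite l2), (s1 - s2)|exact: linear_span0].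
Qed.

(** The product formula produces the forms [l1 + l2] and [l1 - l2], with [l2] translated. As
    [levy_re] is even and [levy_im] odd, the two limits recombine into the product of the means by
    the same formula. *)
Lemma mixing_pair_trig : asymptotically_additive ->
  forall e e', trigs e -> trigs e' -> mixing_pair P (fun n => iter n S) e e'.
Proof.
move=> aa _ _ [l1 [s1 ->]] [l2 [s2 ->]]; rewrite /mixing_pair !Rintegral_trig.
have [re1 im1] := aa l1 l2; have [re2 im2] := aa l1 (opposite l2).
rewrite levy_re_opposite in re2; rewrite levy_im_opposite in im2.
have -> : (fun n => Rintegral P setT (fun x => trig l1 s1 x * trig l2 s2 (iter n S x))) =
    (fun n => 2^-1 * (expR (levy_re (l1 ++ translate n l2)) *
                cos (levy_im (l1 ++ translate n l2) + (s1 + s2))) +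
        2^-1 * (expR (levy_re (l1 ++ translate n (opposite l2))) *
                cos (levy_im (l1 ++ translate n (opposite l2)) + (s1 - s2)))).
  apply/funext => n; rewrite -opposite_translate -!Rintegral_trig.
  have b1 := bounded_measurable_trig (l1 ++ translate n l2) (s1 + s2).
  have b2 := bounded_measurable_trig (l1 ++ opposite (translate n l2)) (s1 - s2).
  rewrite -!bounded_RintegralZ// -bounded_RintegralD; try exact: bounded_measurableZ.
  apply: eq_Rintegral => x _.
  have -> : trig l2 s2 (iter n S x) = trig (translate n l2) s2 x.
    by rewrite /trig lin_translate.
  by rewrite trig_mul addr0.
have -> : expR (levy_re l1) * cos (levy_im l1 + s1) * (expR (levy_re l2) * cos (levy_im l2 + s2)) =
   2^-1 * (expR (levy_re l1 + levy_re l2) * cos (levy_im l1 + levy_im l2 + (s1 + s2))) +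
   2^-1 * (expR (levy_re l1 + levy_re l2) * cos (levy_im l1 - levy_im l2 + (s1 - s2))).
  have -> : levy_im l1 + levy_im l2 + (s1 + s2) = (levy_im l1 + s1) + (levy_im l2 + s2) by ring.
  have -> : levy_im l1 - levy_im l2 + (s1 - s2) = (levy_im l1 + s1) - (levy_im l2 + s2) by ring.
  by rewrite expRD mulrACA cos_mulE; ring.
have cc (u v : nat -> R) a b s : u n @[n --> \oo] --> a -> v n @[n --> \oo] --> b ->
    2^-1 * (expR (u n) * cos (v n + s)) @[n --> \oo] --> 2^-1 * (expR a * cos (b + s)).
  move=> ua vb; apply: cvgMr; apply: cvgM.
    by apply: (cvg_comp _ _ ua); exact: continuous_expR.
  apply: (@cvg_comp _ _ _ (fun n => v n + s) cos _ (nbhs (b + s))).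
    by apply: cvgD => //; exact: cvg_cst.
  exact: continuous_cos.
by apply: cvgD; exact: cc.
Qed.

(** * Density of trigonometric polynomials in L1(P) *)

Let approx := L1_approximable P trigs.

(* The sign of [x k - c] is the limit of the signs of [sin ((x k - c) / j)]. *)
Lemma L1_approximable_ray (k : int) (c : R) :
  approx \1_[set x : RZ R | c < x k].
Proof.
pose z (j : nat) (x : RZ R) : R := sin ((x k - c) / j.+1%:R).
have bz j : bounded_measurable (z j).
  split; last by exists 1 => x; exact: sin_max.
  apply: (measurableT_comp measurable_sin); apply: measurable_funM => //.
  by apply: measurable_funB => //; exact: measurable_coordinate.
have az j : approx (z j).
  apply: L1_approximable_span => //; apply: linear_span_gen.
  (* The phase [- pi / 2] turns the cosine of [trig] into a sine. *)
  exists [:: (k, j.+1%:R^-1)], (- (c / j.+1%:R) - pi / 2); apply/funext => x.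
  rewrite /trig lin1/= -sinDpihalf addrA subrK /z; congr sin; ring.
have biter j n : bounded_measurable (fun x => iter n sharpen (z j x)) /\
    approx (fun x => iter n sharpen (z j x)).
  elim: n => [|n [bI aI]]; first by split; [exact: bz|exact: az].
  have e : (fun x => iter n.+1 sharpen (z j x)) = fun x =>
     (3 / 2) * iter n sharpen (z j x) + (- 2^-1) *
     (iter n sharpen (z j x) * (iter n sharpen (z j x) * iter n sharpen (z j x))).
    by apply/funext => x; rewrite iterS /sharpen; field.
  have b2 := bounded_measurableM bI bI; have b3 := bounded_measurableM bI b2.
  rewrite e; split.
    by apply: bounded_measurableD; exact: bounded_measurableZ.
  apply: (L1_approximable_add trigs_bounded); try exact: bounded_measurableZ.
    exact: (L1_approximable_scale trigs_bounded).
  apply: (L1_approximable_scale trigs_bounded) => //.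
  apply: (L1_approximable_mul trigs_bounded trigs_mul) => //.
  exact: (L1_approximable_mul trigs_bounded trigs_mul).
have mlim (u : nat -> RZ R -> R) (v : RZ R -> R) : (forall n, measurable_fun setT (u n)) ->
    (forall x, u n x @[n --> \oo] --> v x) -> measurable_fun setT v.
  by move=> mu uv; apply: (measurable_fun_cvg mu) => x _; exact: uv.
have sgle (y : R) : `|Num.sg y| <= 1 by rewrite normr_sg; case: (_ == _).
have bsz j : bounded_measurable (fun x => Num.sg (z j x)).
  split; last by exists 1.
  apply: (mlim (fun n x => iter n sharpen (z j x))).
    by move=> n; case: (biter j n) => -[].
  by move=> x; apply: iter_sharpen_cvg; exact: sin_max.
have asz j : approx (fun x => Num.sg (z j x)).
  apply: (@L1_approximable_cvg _ _ _ P _ trigs_bounded (fun n x => iter n sharpen (z j x)) _ 1) => //.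
  - by move=> n; case: (biter j n) => -[].
  - by move=> n x; apply: iter_sharpen_itv; exact: sin_max.
  - by move=> n; case: (biter j n).
  - by move=> x; apply: iter_sharpen_cvg; exact: sin_max.
have szc x : Num.sg (z j x) @[j --> \oo] --> Num.sg (x k - c).
  apply: cvg_near_cst; near=> j.
  have jx : `|x k - c| < j.+1%:R.
    have : (Num.truncn `|x k - c|).+1%:R <= j%:R :> R.
      by rewrite ler_nat; near: j; exact: nbhs_infty_ge.
    move=> h; rewrite (lt_le_trans (truncnS_gt _))// (le_trans h)// ler_nat//.
  have j0 : 0 < j.+1%:R :> R by rewrite ltr0n.
  have pi1 : 1 < pi :> R by apply: lt_le_trans (pi_ge2 R); rewrite ltr1n.
  rewrite /z; move: (x k - c) jx => y jx.
  (* As soon as [j.+1] exceeds [|x k - c|], the argument of the sine lies in []-1, 1[], within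
     []-pi, pi[], where the sine has the sign of its argument. *)
  have pos (w : R) : 0 < w -> `|w| < j.+1%:R -> 0 < sin (w / j.+1%:R).
    move=> w0; rewrite gtr0_norm// => wj; apply: sin_gt0_pi.
    by rewrite divr_gt0//= (lt_trans _ pi1)// ltr_pdivrMr// mul1r.
  have [y0|y0|->] := ltgtP y 0; last by rewrite mul0r sin0.
  - rewrite (ltr0_sg y0) ltr0_sg// -oppr_gt0 -sinN -mulNr pos ?oppr_gt0// normrN//.
  - by rewrite (gtr0_sg y0) gtr0_sg// pos.
have bs : bounded_measurable (fun x : RZ R => Num.sg (x k - c)).
  split; last by exists 1.
  by apply: (mlim (fun j x => Num.sg (z j x))) => // j; case: (bsz j).
have as_ : approx (fun x : RZ R => Num.sg (x k - c)).
  apply: (@L1_approximable_cvg _ _ _ P _ trigs_bounded (fun j x => Num.sg (z j x)) _ 1) => //.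
  by move=> j; case: (bsz j).
(* [(s^2 + s) / 2] sends the signs 1, 0 and -1 to 1, 0 and 0. *)
have -> : \1_[set x : RZ R | c < x k] = (fun x => 2^-1 * (Num.sg (x k - c) * Num.sg (x k - c)) +
    2^-1 * Num.sg (x k - c)).
  apply/funext => x; rewrite indicE.
  have [y0|y0|y0] := ltgtP c (x k).
  - by rewrite mem_set//= gtr0_sg ?subr_gt0//; field.
  - by rewrite memNset/= ?ltr0_sg ?subr_lt0//; [field|rewrite ltNge ltW].
  - by rewrite memNset/= y0 ?subrr ?sgr0 ?mulr0 ?addr0// ltxx.
have b2 := bounded_measurableM bs bs.
apply: (L1_approximable_add trigs_bounded); try exact: bounded_measurableZ.
  apply: (L1_approximable_scale trigs_bounded) => //.
  exact: (L1_approximable_mul trigs_bounded trigs_mul).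
exact: (L1_approximable_scale trigs_bounded).
Unshelve. all: by end_near. Qed.

Let good (A : set (RZ R)) := measurable A /\ approx \1_A.

Let good_setC (A : set (RZ R)) : good A -> good (~` A).
Proof.
move=> [mA aA]; split; first exact: measurableC.
have b := bounded_measurable_indic mA.
rewrite (_ : \1_(~` A) = fun x => trig [::] 0 x + (-1) * \1_A x).
  apply: (L1_approximable_add trigs_bounded).
  - exact: bounded_measurable_trig.
  - exact: bounded_measurableZ.
  - by apply: L1_approximable_span => //; apply: linear_span_gen; exists [::], 0.
  - exact: (L1_approximable_scale trigs_bounded).
apply/funext => x; rewrite /trig /lin big_nil addr0 cos0 !indicE in_setC.
by case: (x \in A) => /=; lra.
Qed.

Let good_setI (A B : set (RZ R)) : good A -> good B -> good (A `&` B).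
Proof.
move=> [mA aA] [mB aB]; split; first exact: measurableI.
rewrite (_ : \1_(A `&` B) = fun x => \1_A x * \1_B x).
  by apply: (L1_approximable_mul trigs_bounded trigs_mul) => //; exact: bounded_measurable_indic.
by apply/funext => x; rewrite !indicE in_setI; case: (_ \in A) => /=; lra.
Qed.

(** Closure under complement and intersection comes from the algebra generated by [trigs]; a
    countable union is the bounded pointwise limit of its finite stages. *)
Let good_sigma_algebra : sigma_algebra setT good.
Proof.
have g0 : good set0.
  split => //; apply: L1_approximable_span => //.
  by rewrite indic0; exact: linear_span0.
split => //; first by move=> A gA; rewrite setTD; exact: good_setC.
move=> A gA; have mU : measurable (\bigcup_i A i).
  by apply: bigcup_measurable => i _; case: (gA i).
split => //.
pose B n := \big[setU/set0]_(i < n) A i.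
have gB n : good (B n).
  elim: n => [|n IH]; first by rewrite /B big_ord0.
  rewrite /B big_ord_recr/= -[X in good X]setCK setCU.
  by apply: good_setC; apply: good_setI; exact: good_setC.
apply: (@L1_approximable_cvg _ _ _ P _ trigs_bounded (fun n => \1_(B n)) _ 1) => //.
- by move=> n; apply: measurable_indic; case: (gB n).
- by move=> n x; rewrite indicE; case: (_ \in _); rewrite ?normr1 ?normr0.
- exact: bounded_measurable_indic.
- by move=> n; case: (gB n).
- move=> x; apply: cvg_near_cst; have [[i _ Aix]|nA] := pselect ((\bigcup_i A i) x).
    near=> n; rewrite !indicE [in RHS]mem_set; last by exists i.
    rewrite mem_set//; rewrite /B -bigcup_mkord; exists i => //=.
    by near: n; exact: nbhs_infty_gt.
  apply: nearW => n; rewrite !indicE !memNset// /B -bigcup_mkord => -[i _ Aix].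
  by apply: nA; exists i.
Unshelve. all: by end_near. Qed.

(** Two generation arguments are nested: cylinders generate the measurable sets of paths, and for a
    fixed coordinate the Borel sets with a good cylinder form a sigma-algebra that contains the
    rays. *)
Lemma L1_approximable_indic (A : set (RZ R)) : measurable A -> approx \1_A.
Proof.
move=> mA; suff : good A by case.
apply: (smallest_sub good_sigma_algebra _ mA).
move=> _ [k [B [mB ->]]].
pose F := [set B : set R | good [set x : RZ R | B (x k)]].
suff : F B by [].
have sF : sigma_algebra setT F.
  case: good_sigma_algebra => g0 gC gU; split.
  - by rewrite /F/= (_ : [set x | _] = set0).
  - move=> C FC; rewrite /F/=.
    rewrite (_ : [set x | _] = ~` [set x : RZ R | C (x k)]); first exact: good_setC.
    by apply/seteqP; split => x /=; [case|split].
  - move=> C FC; rewrite /F/=.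
    rewrite (_ : [set x | _] = \bigcup_i [set x : RZ R | C i (x k)])//.
    exact: gU.
have : measurable B by [].
rewrite [X in X B -> _](_ : _ = <<s (@RGenOInfty.G R) >>); last exact: RGenOInfty.measurableE.
apply: (smallest_sub sF) => _ [c ->]; rewrite /F/=.
rewrite (_ : [set x | _] = [set x : RZ R | c < x k]); last first.
  by apply/seteqP; split => x /=; rewrite in_itv/= andbT.
split; last exact: L1_approximable_ray.
have mr : measurable (`]c, +oo[%classic : set R) by exact: measurable_itv.
have := measurable_coordinate (R := R) k measurableT mr; rewrite setTI.
by congr measurable; apply/seteqP; split => x /=; rewrite in_itv/= andbT.
Qed.

Lemma mixing_of_zero_type : levy_zero_type -> mixing P.
Proof.
move=> /asymptotically_additive_of_zero_type aa A B mA mB.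
apply/(mixing_pair_indic P mS) => //.
apply: (mixing_pair_approximable mS Piter trigs_bounded (mixing_pair_trig aa));
  solve [exact: bounded_measurable_indic|exact: L1_approximable_indic].
Qed.

(** The integral of [cross_re l1 (translate n l2)] is the defect of additivity of [levy_re]. Mixing
    makes the modulus of the characteristic function asymptotically multiplicative, which sends this
    defect to 0. *)
Lemma onem_cos_correlation_cvg0 : mixing P -> forall l1 l2,
  levy_correlation n (onem_cos l1) (onem_cos l2) @[n --> \oo] --> 0%E.
Proof.
move=> mix.
have mp := mixing_pair_bounded mS Piter mix.
(* Only the modulus of the characteristic function is used, so that no branch of
   the complex logarithm has to be chosen. *)
have re_cvg l1 l2 : levy_re (l1 ++ translate n l2) @[n --> \oo] --> levy_re l1 + levy_re l2.
  pose C n := Rintegral P setT (fun x => cos (lin (l1 ++ translate n l2) x)).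
  pose D n := Rintegral P setT (fun x => sin (lin (l1 ++ translate n l2) x)).
  have [c1 s1] := levy_formula hPQ l1; have [c2 s2] := levy_formula hPQ l2.
  have bc := bounded_measurable_cos_lin; have bs := bounded_measurable_sin_lin.
  have bt n (f g : RZ R -> R) : bounded_measurable f -> bounded_measurable g ->
     bounded_measurable (fun x => f x * g (iter n S x)).
    by move=> bf bg; apply: bounded_measurableM => //; exact: bounded_measurable_comp.
  have Cc : C n @[n --> \oo] --> expR (levy_re l1 + levy_re l2) * cos (levy_im l1 + levy_im l2).
    have -> : C = fun n => Rintegral P setT (fun x => cos (lin l1 x) * cos (lin l2 (iter n S x))) -
       Rintegral P setT (fun x => sin (lin l1 x) * sin (lin l2 (iter n S x))).
      apply/funext => n; rewrite -(bounded_RintegralB P (bt n _ _ (bc l1) (bc l2)) (bt n _ _ (bs l1) (bs l2))).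
      by apply: eq_Rintegral => x _; rewrite lin_cat lin_translate cosD.
    have -> : expR (levy_re l1 + levy_re l2) * cos (levy_im l1 + levy_im l2) =
       Rintegral P setT (fun x => cos (lin l1 x)) * Rintegral P setT (fun x => cos (lin l2 x)) -
       Rintegral P setT (fun x => sin (lin l1 x)) * Rintegral P setT (fun x => sin (lin l2 x)).
      by rewrite c1 c2 s1 s2 cosD expRD; ring.
    by apply: cvgB; apply: mp.
  have Dc : D n @[n --> \oo] --> expR (levy_re l1 + levy_re l2) * sin (levy_im l1 + levy_im l2).
    have -> : D = fun n => Rintegral P setT (fun x => sin (lin l1 x) * cos (lin l2 (iter n S x))) +
       Rintegral P setT (fun x => cos (lin l1 x) * sin (lin l2 (iter n S x))).
      apply/funext => n; rewrite -(bounded_RintegralD P (bt n _ _ (bs l1) (bc l2)) (bt n _ _ (bc l1) (bs l2))).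
      by apply: eq_Rintegral => x _; rewrite lin_cat lin_translate sinD.
    have -> : expR (levy_re l1 + levy_re l2) * sin (levy_im l1 + levy_im l2) =
       Rintegral P setT (fun x => sin (lin l1 x)) * Rintegral P setT (fun x => cos (lin l2 x)) +
       Rintegral P setT (fun x => cos (lin l1 x)) * Rintegral P setT (fun x => sin (lin l2 x)).
      by rewrite c1 c2 s1 s2 sinD expRD; ring.
    by apply: cvgD; apply: mp.
  pose r n := levy_re (l1 ++ translate n l2).
  (* The squared modulus of the characteristic function is [expR (r n) * expR (r n)]. Its limit is
     positive, so [ln] is continuous there. *)
  have rE n : r n = 2^-1 * ln (C n * C n + D n * D n).
    rewrite /C /D; have [-> ->] := levy_formula hPQ (l1 ++ translate n l2).
    rewrite -/(r n); set t := levy_im _.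
    have -> : expR (r n) * cos t * (expR (r n) * cos t) + expR (r n) * sin t * (expR (r n) * sin t) =
       expR (r n) * expR (r n) * (cos t ^+ 2 + sin t ^+ 2) by ring.
    by rewrite cos2Dsin2 mulr1 -expRD expRK; field.
  under eq_cvg do rewrite -/(r _) rE.
  set a := levy_re l1 + levy_re l2 in Cc Dc *; set t := levy_im l1 + levy_im l2 in Cc Dc *.
  have -> : a = 2^-1 * ln (expR a * cos t * (expR a * cos t) + expR a * sin t * (expR a * sin t)).
    have -> : expR a * cos t * (expR a * cos t) + expR a * sin t * (expR a * sin t) =
       expR a * expR a * (cos t ^+ 2 + sin t ^+ 2) by ring.
    by rewrite cos2Dsin2 mulr1 -expRD expRK; field.
  apply: cvgMr; apply: continuous_cvg; last by apply: cvgD; apply: cvgM.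
  apply: continuous_ln.
  have -> : expR a * cos t * (expR a * cos t) + expR a * sin t * (expR a * sin t) =
     expR a * expR a * (cos t ^+ 2 + sin t ^+ 2) by ring.
  by rewrite cos2Dsin2 mulr1 mulr_gt0 ?expR_gt0.
move=> l1 l2.
(* Averaging over [l2] and its opposite cancels the sine terms. *)
have b2 n x : onem_cos l1 x * (1 * onem_cos l2 (iter n S x)) =
    2^-1 * (cross_re l1 (translate n l2) x + cross_re l1 (translate n (opposite l2)) x).
  rewrite -opposite_translate /cross_re onem_cos_opposite lin_opposite sinN.
  have -> : onem_cos (translate n l2) x = onem_cos l2 (iter n S x).
    by rewrite /onem_cos lin_translate.
  by field.
have i12 n : Q.-integrable setT (EFin \o (fun x => cross_re l1 (translate n l2) x +
    cross_re l1 (translate n (opposite l2)) x)).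
  exact: (@integrableD _ _ _ Q setT measurableT _ _ (integrable_cross_re _ _) (integrable_cross_re _ _)).
have -> : (fun n => levy_correlation n (onem_cos l1) (onem_cos l2)) = (fun n =>
    (2^-1 * ((levy_re (l1 ++ translate n l2) - (levy_re l1 + levy_re l2)) +
     (levy_re (l1 ++ translate n (opposite l2)) - (levy_re l1 + levy_re l2))))%:E).
  apply/funext => n; rewrite /levy_correlation /correlation.
  under eq_integral do rewrite b2.
  have := RintegralZl (2^-1) measurableT (i12 n).
  have iz := integrableZl measurableT (2^-1) (i12 n).
  rewrite [LHS]/Rintegral => h; rewrite -[LHS]fineK; last first.
    by apply: integrable_fin_num => //; exact: iz.
  rewrite h RintegralD//; try exact: integrable_cross_re.
  rewrite !levy_re_cat !levy_re_translate levy_re_opposite; congr EFin; ring.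
apply: cvg_EFin; first exact: nearW.
have -> : 0 = 2^-1 * ((levy_re l1 + levy_re l2 - (levy_re l1 + levy_re l2)) +
  (levy_re l1 + levy_re l2 - (levy_re l1 + levy_re l2))) :> R.
  by rewrite subrr addr0 mulr0.
apply: cvgMr; apply: cvgD; apply: cvgB; try exact: cvg_cst.
  exact: re_cvg.
by rewrite -(levy_re_opposite l2); exact: re_cvg.
Qed.

End levy_asymptotics.

(** * Transfer to the Maharam extension *)

Section factor_maps.
Context {R : realType} {d d'} {X : measurableType d} {Y : measurableType d'}.
Variables (m : {measure set X -> \bar R}) (k : {measure set Y -> \bar R}).
Variables (tau : X -> X) (sigma : Y -> Y) (phi : X -> Y).
Hypotheses (mtau : measurable_fun setT tau) (msigma : measurable_fun setT sigma).
Hypothesis mphi : measurable_fun setT phi.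
Hypothesis tau_preserving : forall E, measurable E -> m (tau @^-1` E) = m E.
Hypothesis phi_image : forall B, measurable B -> m (phi @^-1` B) = k B.
Hypothesis equivariant : {ae m, forall x, phi (tau x) = sigma (phi x)}.

(** The exceptional null set of one step stays null when pulled back by [iter n tau], as [tau]
    preserves [m]. *)
Lemma equivariant_iter n :
  {ae m, forall x, phi (iter n tau x) = iter n sigma (phi x)}.
Proof.
elim: n => [|n IH]; first exact: aeW.
have step : {ae m, forall x, phi (tau (iter n tau x)) = sigma (phi (iter n tau x))}.
  case: equivariant => N [mN N0 sub]; exists (iter n tau @^-1` N); split.
  - by rewrite -[X in measurable X]setTI; exact: measurable_iter.
  - by rewrite (iter_preserving mtau tau_preserving).
  - by move=> x /= nx; exact: sub.
by move: IH step; apply: filterS2 => x /= <- ->.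
Qed.

Lemma factor_correlation n (u v : Y -> R) :
  measurable_fun setT u -> measurable_fun setT v ->
  (forall y, 0 <= u y) -> (forall y, 0 <= v y) ->
  correlation m (fun _ _ => 1) (fun n => iter n tau) n (u \o phi) (v \o phi) =
  correlation k (fun _ _ => 1) (fun n => iter n sigma) n u v.
Proof.
move=> mu mv u0 v0; rewrite /correlation.
have msn := measurable_iter n msigma; have mtn := measurable_iter n mtau.
have mF : measurable_fun setT (fun y => (u y * (1 * v (iter n sigma y)))%:E).
  apply/measurable_EFinP; apply: measurable_funM => //; apply: measurable_funM => //.
  exact: measurableT_comp.
rewrite -(ge0_integral_preserving mphi phi_image mF); last first.
  by move=> y; rewrite lee_fin !mulr_ge0.
apply: ge0_ae_eq_integral => //.
- apply/measurable_EFinP; apply: measurable_funM; first exact: measurableT_comp.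
  by apply: measurable_funM => //; apply: measurableT_comp => //; exact: measurableT_comp.
- exact: (measurableT_comp mF mphi).
- by move=> x _; rewrite lee_fin !mulr_ge0//= ?u0// v0.
- by move=> x _; rewrite lee_fin !mulr_ge0.
- by move: (equivariant_iter n); apply: filterS => x /= -> _.
Qed.

End factor_maps.

(** * Functions that dominate away from the zero path *)

Section mixing_levy.
Context {R : realType}.
Variables (P : probability (RZ R) R) (Q : {measure set (RZ R) -> \bar R}).
Hypothesis hPQ : levy_measure P Q.
Hypothesis Pinv : shift_invariant P.
Hypothesis mix : mixing P.

(** An enumeration of all pairs (coordinate, scale). A number that encodes no pair gets the default
    [(0, 0)], which merely repeats a probe. *)
Definition index_pair (i : nat) : int * nat := odflt (0, 0%N) (unpickle i).

(* Every nonzero coordinate satisfies [0 < |x k / j| < 1] for some [j], where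
   [1 - cos] does not vanish. *)
Definition probe (i : nat) : seq (int * R) :=
  [:: ((index_pair i).1, (index_pair i).2.+1%:R^-1)].

(** Each [1 - cos] is at most 2; the factor [N] makes the sums tend to infinity as soon as one probe
    is positive at [x]. *)
Definition probe_sum (N : nat) (x : RZ R) : R :=
  \sum_(i < N) N%:R * onem_cos (probe i) x.

Lemma probe_sum_ge0 N x : 0 <= probe_sum N x.
Proof. by apply: sumr_ge0 => i _; rewrite mulr_ge0// onem_cos_ge0. Qed.

Lemma measurable_probe_sum N : measurable_fun setT (probe_sum N).
Proof.
apply: measurable_sum => i; apply: measurable_funM => //.
exact: measurable_onem_cos.
Qed.

Let mS n : measurable_fun setT (iter n (@Defs.shift R)).
Proof. by apply: measurable_iter; exact: measurable_shift. Qed.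

(** [N] is fixed while [n] grows, so bilinearity leaves a finite double sum of correlations of
    single probes. *)
Lemma probe_sum_correlation_cvg0 N :
  levy_correlation Q n (probe_sum N) (probe_sum N) @[n --> \oo] --> 0%E.
Proof.
have E n : levy_correlation Q n (probe_sum N) (probe_sum N) =
    (\sum_(i <- index_enum 'I_N) \sum_(j <- index_enum 'I_N)
     (N%:R ^+ 2)%:E * levy_correlation Q n (onem_cos (probe i)) (onem_cos (probe j)))%E.
  rewrite /levy_correlation /correlation.
  have mO l : measurable_fun setT (fun x => onem_cos l (iter n (@Defs.shift R) x)).
    by apply: measurableT_comp => //; exact: measurable_onem_cos.
  have mF (i j : 'I_N) : measurable_fun setT (fun x : RZ R => ((N%:R ^+ 2)%:E *
     (onem_cos (probe i) x * (1 * onem_cos (probe j) (iter n (@Defs.shift R) x)))%:E)%E).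
    apply: measurable_funeM; apply/measurable_EFinP.
    by apply: measurable_funM; [exact: measurable_onem_cos|exact: measurable_funM].
  have F0 (i j : 'I_N) (x : RZ R) : setT x -> (0 <= (N%:R ^+ 2)%:E *
     (onem_cos (probe i) x * (1 * onem_cos (probe j) (iter n (@Defs.shift R) x)))%:E)%E.
    by move=> _; rewrite -EFinM lee_fin !mulr_ge0// onem_cos_ge0.
  transitivity (\int[Q]_x (\sum_(i <- index_enum 'I_N) \sum_(j <- index_enum 'I_N)
     (N%:R ^+ 2)%:E * (onem_cos (probe i) x * (1 * onem_cos (probe j) (iter n (@Defs.shift R) x)))%:E))%E.
    apply: eq_integral => x _; rewrite /probe_sum mul1r big_distrlr/= -sumEFin.
    apply: eq_bigr => i _; rewrite -sumEFin; apply: eq_bigr => j _.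
    by rewrite -EFinM; congr EFin; ring.
  rewrite ge0_integral_sum//; last 2 first.
  - by move=> i; apply: emeasurable_sum => j _; exact: mF.
  - by move=> i x xT; apply: sume_ge0 => j _; exact: F0.
  apply: eq_bigr => i _; rewrite ge0_integral_sum//; last by move=> j x; exact: F0.
  apply: eq_bigr => j _; rewrite ge0_integralZl//.
  - apply/measurable_EFinP.
    by apply: measurable_funM; [exact: measurable_onem_cos|exact: measurable_funM].
  - by move=> x _; rewrite lee_fin !mulr_ge0// onem_cos_ge0.
have c0 n l l' : (0 <= levy_correlation Q n (onem_cos l) (onem_cos l'))%E.
  by apply: correlation_ge0 => //; exact: onem_cos_ge0.
rewrite (_ : (fun n => _) = fun n => (\sum_(i <- index_enum 'I_N) \sum_(j <- index_enum 'I_N)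
     (N%:R ^+ 2)%:E * levy_correlation Q n (onem_cos (probe i)) (onem_cos (probe j)))%E); last first.
  by apply/funext => n; exact: E.
have cvg_sum0 (f : 'I_N -> nat -> \bar R) : (forall i n, 0 <= f i n)%E ->
    (forall i, f i n @[n --> \oo] --> 0%E) ->
    (\sum_(i <- index_enum 'I_N) f i n)%E @[n --> \oo] --> 0%E.
  move=> f0 fc; suff : (\sum_(i <- index_enum 'I_N) f i n)%E @[n --> \oo] -->
      (\sum_(i <- index_enum 'I_N) (fun=> 0) i)%E by rewrite big1.
  by apply: cvg_nnesum => i _; [exact: nearW|exact: fc].
have N2 : (0 <= (N%:R ^+ 2)%:E :> \bar R)%E by rewrite lee_fin sqr_ge0.
apply: (cvg_sum0 _ _ _) => [i n|i]; first by apply: sume_ge0 => j _; rewrite mule_ge0.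
apply: (cvg_sum0 _ _ _) => [j n|j]; first by rewrite mule_ge0.
by apply: cvgeM0; exact: (onem_cos_correlation_cvg0 hPQ Pinv mix).
Qed.

Lemma probe_sum_unbounded (x : RZ R) (c : R) : x <> zeroRZ ->
  \forall N \near \oo, c <= probe_sum N x.
Proof.
move=> x0.
have [k xk] : exists k, x k <> 0.
  apply: contrapT => h; apply: x0; apply/funext => k.
  by apply: contrapT => xk; apply: h; exists k.
pose j := Num.truncn `|x k|.
pose i := pickle (k, j).
have ij : index_pair i = (k, j) by rewrite /index_pair /i pickleK.
have j0 : 0 < j.+1%:R :> R by rewrite ltr0n.
have pos : 0 < onem_cos (probe i) x.
  rewrite /onem_cos /probe ij lin1/=.
  set y := _ * x k.
  have y1 : `|y| < 1.
    by rewrite /y normrM normfV (gtr0_norm j0) ltr_pdivrMl// mulr1 truncnS_gt.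
  have y0 : y != 0 by apply: mulf_neq0; [rewrite invr_eq0 gt_eqF|exact/eqP].
  rewrite subr_gt0 lt_neqAle cos_le1 andbT; apply/negP => /eqP cy.
  have pi1 : 1 < pi :> R by apply: lt_le_trans (pi_ge2 R); rewrite ltr1n.
  (* If [cos y] were 1 then [sin y] would be 0, although the sine is positive on []0, pi[]. *)
  have : 0 < sin `|y| by apply: sin_gt0_pi; rewrite normr_gt0 y0 (lt_trans y1 pi1).
  have sy : sin y = 0.
    have := cos2Dsin2 y; rewrite cy expr1n => sy2.
    by apply/eqP; rewrite -sqrf_eq0; apply/eqP; lra.
  by have [_|_] := ger0P y; rewrite ?sinN sy ?oppr0 ltxx.
near=> N.
have iN : (i < N)%N by near: N; exact: nbhs_infty_gt.
have cN : c / onem_cos (probe i) x <= N%:R.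
  have : (Num.truncn (c / onem_cos (probe i) x)).+1%:R <= N%:R :> R.
    by rewrite ler_nat; near: N; exact: nbhs_infty_ge.
  by apply: le_trans; rewrite ltW// truncnS_gt.
rewrite /probe_sum (bigD1 (Ordinal iN))//=.
apply: (@le_trans _ _ (N%:R * onem_cos (probe i) x)); first by rewrite -ler_pdivrMr.
by rewrite lerDl; apply: sumr_ge0 => i' _; rewrite mulr_ge0// onem_cos_ge0.
Unshelve. all: by end_near. Qed.

(** The integers are reached by [n] and [- n], which gives a countable intersection. Measurability
    is what allows the preimage of [{0}] to serve as an exceptional null set. *)
Lemma measurable_zeroRZ : measurable [set (zeroRZ : RZ R)].
Proof.
have mk (k : int) : measurable [set x : RZ R | x k = 0].
  have := measurable_coordinate (R := R) k measurableT (measurable_set1 0).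
  by rewrite setTI.
rewrite (_ : [set zeroRZ] = (\bigcap_n [set x : RZ R | x n%:Z = 0]) `&`
   (\bigcap_n [set x : RZ R | x (- n%:Z) = 0])).
  by apply: measurableI; apply: bigcap_measurable.
apply/seteqP; split => x; first by move=> ->; split => n _.
move=> [xp xn]; apply/funext => k /=.
by case: (intP k) => [|n|n]; [exact: (xp 0%N)|exact: (xp n.+1)|exact: (xn n.+1)].
Qed.

End mixing_levy.

(** * Both implications through the Maharam extension *)

Unset Implicit Arguments.
Set Strict Implicit.

Local Open Scope complex_scope.

Theorem theorem11 (R : realType) (alpha : R) (halpha : 0 < alpha < 2)
  (d : measure_display) (Omega : measurableType d)
  (mu : {sigma_finite_measure set Omega -> \bar R}) (hmu : lebesgue_space mu)
  (T : Omega -> Omega) (hT : nonsingular_automorphism mu T)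
  (D : Omega -> R) (hD : rn_derivative mu T D)
  (P : probability (RZ R) R) (Q : {measure set (RZ R) -> \bar R})
  (hP : stable_stationary alpha P Q)
  (hassoc : associated_system alpha mu T D Q) :
  mixing P <->
  forall f : Omega -> R[i], complex_L2 mu f ->
    (fun n : nat => L2_inner mu (iter n (koopman T D) f) f : R[i]^o) @ \oo
      --> (0 : R[i]^o).
Proof.
case/andP: halpha => alpha0 _.
case: hP => -[Pinv _ hPQ] _ _.
case: hassoc => f [_ [[mphi phi_image _] equiv]].
set phi := maharam_orbit alpha T D f in mphi phi_image equiv.
have mMT := measurable_maharam_map alpha hT hD.
have pMT := maharam_measure_preserving alpha0 hT hD.
(* Correlations of functions of the path, taken under [Q] or pulled back to the extension, are
   equal; both implications cross between the two systems here. *)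
have fc := factor_correlation mMT (@measurable_shift R) mphi pMT phi_image equiv.
have contr n (v : Omega * measurableTypeR R -> R) : measurable_fun setT v ->
    (forall x, 0 <= v x) ->
    (\int[maharam_measure alpha mu]_x ((1 * v (iter n (maharam_map alpha T D) x)) ^+ 2)%:E <=
     \int[maharam_measure alpha mu]_x ((v x) ^+ 2)%:E)%E.
  exact: (maharam_contr alpha0 hT hD).
split=> [mix|km].
- apply: (koopman_mixing_of_zero_type alpha0 hT hD).
  apply: (koopman_zero_type_of_maharam alpha0 hT hD) => h mh h0 h2.
  apply: (@correlation_cvg0 _ _ _ (maharam_measure alpha mu) (fun _ _ => 1)
    (fun n => iter n (maharam_map alpha T D)) _ _ _ contr (fun N => probe_sum N \o phi)) => //.
  + by move=> n; exact: measurable_iter.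
  + by move=> N; apply: measurableT_comp => //; exact: measurable_probe_sum.
  + by move=> N p; exact: probe_sum_ge0.
  + move=> N.
    have mN := measurable_probe_sum (R := R) N.
    have N0 := probe_sum_ge0 (R := R) N.
    rewrite (_ : (fun n => _) = fun n => levy_correlation Q n (probe_sum N) (probe_sum N)).
      exact: (probe_sum_correlation_cvg0 hPQ Pinv mix).
    by apply/funext => n; exact: (fc n _ _ mN mN N0 N0).
  (* Domination by the pulled-back probe sums can fail only over the zero path, and [Q {0} = 0]. *)
  + have mz := measurable_zeroRZ (R := R).
    exists (phi @^-1` [set zeroRZ]); split.
    * by rewrite -[X in measurable X]setTI; exact: mphi.
    * by case: (hPQ) => _ _ Q0 _ _; exact: (etrans (phi_image _ mz) Q0).
    * move=> p /= np; apply: contrapT => pz; apply: np.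
      exact: probe_sum_unbounded.
- have mz := maharam_zero_type_of_koopman alpha0 hT hD
    (koopman_zero_type_of_mixing alpha0 hT hD km).
  apply: (mixing_of_zero_type hPQ Pinv) => h mh h0 h2.
  (* A square integrable [h] on paths lifts to [h \o phi], which has the same norm, so the zero type
     of the extension applies to it. *)
  rewrite (_ : (fun n => _) = fun n => maharam_correlation alpha mu T D n (h \o phi) (h \o phi)).
    apply: mz; first exact: measurableT_comp.
      by move=> p; exact: h0.
    rewrite (ge0_integral_preserving mphi phi_image (F := fun x => ((h x) ^+ 2)%:E))//.
      by apply/measurable_EFinP; exact: measurable_funX.
    by move=> x; rewrite lee_fin sqr_ge0.
  by apply/funext => n; exact: (esym (fc n _ _ mh mh h0 h0)).
Qed.
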